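(* Let $X=(X_t)_{t\ge 0}$ be a real L\'evy process with no Gaussian component ($\sigma^2=0$), and let $\kappa>1/2$. If $X$ is of bounded variation ($X\in bv$), assume in addition that its drift $\delta$ is $0$. (i) If $\int_0^1 \overline{\Pi}(x^\kappa)\,dx<\infty$, then $$\lim_{t\downarrow 0}\frac{X_t}{t^\kappa}=0\quad\text{a.s.}$$ (ii) Conversely, if $\int_0^1 \overline{\Pi}(x^\kappa)\,dx=\infty$, then for every deterministic function $a:[0,\infty)\to\mathbb{R}$, $$\limsup_{t\downarrow 0}\frac{|X_t-a(t)|}{t^\kappa}=\infty\quad\text{a.s.}$$
   Context: The L\'evy process $X$ ($X_0=0$) has characteristic triplet $(\gamma,\sigma^2,\Pi)$ with $\sigma^2=0$, $\gamma\in\mathbb{R}$, and the L\'evy measure $\Pi$ is carried by $[-1,1]\setminus\{0\}$ with $\int x^2\,\Pi(dx)<\infty$; that is, $E[e^{i\theta X_t}]=e^{t\Psi(\theta)}$ with $$\Psi(\theta)=i\gamma\theta+\int_{[-1,1]}(e^{i\theta x}-1-i\theta x)\,\Pi(dx),\quad \theta\in\mathbb{R}.$$ $X$ is of bounded variation, written $X\in bv$, if and only if $\int_{|x|\le1}|x|\,\Pi(dx)<\infty$ (given $\sigma^2=0$), and then its drift is $\delta=\gamma-\int_{[-1,1]}x\,\Pi(dx)$. The two-sided tail is $\overline{\Pi}(x)=\Pi((x,\infty))+\Pi((-\infty,-x))$, $x>0$. *)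

(* Defs.v *)
From HB Require Import structures.
From mathcomp Require Import all_boot all_order all_algebra.
From mathcomp Require Import all_classical all_reals all_analysis.
From mathcomp Require Export complex.

Set Implicit Arguments.
Unset Strict Implicit.
Unset Printing Implicit Defensive.

Import Order.TTheory GRing.Theory Num.Theory.
Import numFieldNormedType.Exports.

Local Open Scope classical_set_scope.
Local Open Scope ring_scope.
Local Open Scope complex_scope.

(* Processes and paths indexed by [0, oo) are functions on the whole of R whose
   values at negative times are never constrained nor used. *)

Definition cadlag (R : realType) (f : R -> R) : Prop :=
  (forall t, 0 <= t -> f s @[s --> t^'+] --> f t) /\
  (forall t, 0 < t -> cvg (f s @[s --> t^'-])).

(* The full product rule suffices: taking some B i to be setT gives the product
   rule for every subfamily. *)
Definition mutually_independent d (T : measurableType d) (R : realType)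
    (P : probability T R) (n : nat) (Y : 'I_n -> T -> R) : Prop :=
  forall B : 'I_n -> set R, (forall i, measurable (B i)) ->
    P (\bigcap_(i in [set: 'I_n]) (Y i @^-1` B i)) =
    (\prod_(i < n) P (Y i @^-1` B i))%E.

Record levy_process d (T : measurableType d) (R : realType)
    (P : probability T R) (X : R -> {RV P >-> R}) : Prop := LevyProcess {
  levy_start : {ae P, forall w, X 0 w = 0} ;
  levy_indep : forall (n : nat) (t : nat -> R), 0 <= t 0%N ->
    (forall i, (i < n)%N -> t i <= t i.+1) ->
    mutually_independent P (fun (i : 'I_n) w => X (t i.+1) w - X (t i) w) ;
  levy_stationary : forall s t : R, 0 <= s -> s <= t ->
    forall B : set R, measurable B ->
    P ((fun w => X t w - X s w) @^-1` B) = P (X (t - s) @^-1` B) ;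
  levy_cadlag : {ae P, forall w, cadlag (fun t => X t w)} }.

Definition cexp (R : realType) (z : R[i]) : R[i] :=
  (expR (complex.Re z) * cos (complex.Im z)) +i* (expR (complex.Re z) * sin (complex.Im z)).

Definition char_fun d (T : measurableType d) (R : realType)
    (P : probability T R) (Y : T -> R) (theta : R) : R[i] :=
  (\int[P]_w cos (theta * Y w)) +i* (\int[P]_w sin (theta * Y w)).

(* i gamma theta - sigma2 theta^2 / 2
     + \int_[-1,1] (e^{i theta x} - 1 - i theta x) Pi(dx),
   the integral being taken separately on real and imaginary parts; there are
   no jumps larger than 1 since Pi is carried by [-1,1] \ {0}. *)
Definition levy_exponent (R : realType) (gamma sigma2 : R)
    (Pi : {measure set R -> \bar R}) (theta : R) : R[i] :=
  (- (sigma2 * theta ^+ 2 / 2) + \int[Pi]_(x in `[-1, 1]) (cos (theta * x) - 1))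
  +i* (gamma * theta + \int[Pi]_(x in `[-1, 1]) (sin (theta * x) - theta * x)).

(* The Levy measures considered here are those carried by [-1,1] \ {0}. *)
Definition levy_measure (R : realType) (Pi : {measure set R -> \bar R}) : Prop :=
  Pi (~` (`[-1, 1] `\ 0)) = 0%E /\ (\int[Pi]_x (x ^+ 2)%:E < +oo)%E.

Definition levy_triplet d (T : measurableType d) (R : realType)
    (P : probability T R) (X : R -> {RV P >-> R})
    (gamma sigma2 : R) (Pi : {measure set R -> \bar R}) : Prop :=
  [/\ 0 <= sigma2, levy_measure Pi & forall t theta : R, 0 <= t ->
      char_fun P (X t) theta = cexp (t%:C * levy_exponent gamma sigma2 Pi theta)].

Definition in_bv d (T : measurableType d) (R : realType)
    (P : probability T R) (X : R -> {RV P >-> R}) : Prop :=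
  {ae P, forall w, forall t : R, 0 <= t ->
    bounded_variation 0 t (fun s => X s w)}.

(* Meaningful only when x is Pi-integrable, i.e. in the bounded variation case
   (with no Gaussian component). *)
Definition drift (R : realType) (gamma : R) (Pi : {measure set R -> \bar R}) : R :=
  gamma - \int[Pi]_(x in `[-1, 1]) x.

Definition levy_tail (R : realType) (Pi : {measure set R -> \bar R}) (x : R)
    : \bar R :=
  (Pi `]x, +oo[%classic + Pi `]-oo, (- x)%R[%classic)%E.

(* Main.v *)
(* Everything is read off the characteristic function. With h_n = 2^(-n kappa),
   the tail integral is finite exactly when J = \int |x|^(1/kappa) Pi(dx) is.

   (i) Centre X_s by s c_n, where c_n is the drift left after removing the jumps
   larger than h_n. Bounding an indicator by a series of 1 - cos at dyadic
   frequencies gives P(|X_s - s c_n| > eps h_n) <= C s \int U(|x| / h_n) Pi(dx)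
   with U(z) = z^2 near 0 and z^(1/(2 kappa)) at infinity. As kappa > 1/2, the
   right-hand sides for s = 2^-n sum to at most C J. If J is finite then also
   2^-n c_n = o(h_n); for kappa >= 1 this uses that the drift is 0, since then
   \int |x| Pi(dx) is finite, E|X_s| = O(s) and the paths have bounded variation.
   Ottaviani's inequality and the Borel-Cantelli lemma conclude.

   (ii) If |X_t - a(t)| <= C t^kappa for all small t, then along a fine grid every
   increment of X lies within 2 C t^kappa of a deterministic value. The increments
   are independent, so this has probability at most exp(- \sum P(|X_s| > 6 C t^kappa)),
   summed over the grid. The sum is bounded below by expectations of
   ((1 - cos z) / 2)^2, a combination of terms 1 - cos that is O(z^4) at 0; since
   E (1 - cos (theta X_s)) / s converges to \int (1 - cos (theta x)) Pi(dx), the sum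
   is unbounded as the mesh s tends to 0 when J is infinite. *)

Require Import Defs.
From HB Require Import structures.
From mathcomp Require Import all_boot all_order all_algebra.
From mathcomp Require Import all_classical all_reals all_analysis.
From mathcomp Require Import measurable_realfun.
From mathcomp Require Import ring lra.

Import Order.TTheory GRing.Theory Num.Theory.
Import numFieldNormedType.Exports.

Local Open Scope classical_set_scope.
Local Open Scope ring_scope.

(** * Elementary inequalities *)

Section elementary.
Context {R : realType}.
Implicit Types v w x y r : R.

(** The triplet is known only through the laws of the marginals, so no jump can be taken out of a
    path: centring by s c_n replaces the removal, and its effect on the integrand is to drop the
    compensator of the jumps larger than h_n. Such a jump x is then visible at every dyadic
    frequency theta with theta |x| > 1, about log(|x| / h_n) of them, and the growth of U at
    infinity pays for this logarithm. Any positive exponent below 1 / kappa and at most 1 would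
    serve; 1 / (2 kappa) is one because kappa > 1/2.

    In (ii) the obstacle is the mass of the small jumps. A kernel quadratic at 0 would charge them
    with x^2 times \sum 2^-n / h_n^2, a coefficient that grows without bound with the number of
    scales, and they would be mistaken for increments of size h_n. With a kernel of order z^4 the
    choices can be nested: a target for the sum, then finitely many scales, then a cut-off below
    which increments are absorbed, and the mesh last. The convergence of the moments is thus used at
    finitely many frequencies only, with an explicit error O(s^2). *)

Lemma sin_mean_value v : exists2 xi : R, `|xi| <= `|v| & sin v = v * cos xi.
Proof.
wlog v0 : v / 0 < v.
  move=> H; have [v0|v0|->] := ltgtP v 0.
  - have [|xi xile xiE] := H (- v); first by rewrite oppr_gt0.
    by exists xi; [rewrite normrN in xile|apply: oppr_inj; rewrite -sinN xiE mulNr].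
  - exact: H.
  - by exists 0; rewrite ?normr0// sin0 mul0r.
have [|xi] := @MVT R (@sin R) (@cos R) 0 v v0.
- by apply: continuous_subspaceT => x; exact: continuous_sin.
rewrite in_itv/= sin0 !subr0 => /andP[xi0 xiv] ->; exists xi; last by rewrite mulrC.
by rewrite !ger0_norm ?ltW.
Qed.

Lemma norm_sin_le v : `|sin v| <= `|v|.
Proof.
have [xi _ ->] := sin_mean_value v.
by rewrite normrM ler_piMr// cos_max.
Qed.

Lemma one_sub_cosE v : 1 - cos v = 2 * sin (v / 2) ^+ 2.
Proof.
rewrite {1}(_ : v = (v / 2) *+ 2); last by rewrite -mulr_natr; field.
by rewrite cos_mulr2n sin2cos2 -mulr_natr; ring.
Qed.

Lemma one_sub_cos_ge0 v : 0 <= 1 - cos v.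
Proof. by rewrite subr_ge0 cos_le1. Qed.

Lemma one_sub_cos_le2 v : 1 - cos v <= 2.
Proof. by have := cos_geN1 v; lra. Qed.

Lemma one_sub_cos_le_sqr v : 1 - cos v <= v ^+ 2 / 2.
Proof.
rewrite one_sub_cosE.
have : sin (v / 2) ^+ 2 <= (v / 2) ^+ 2.
  by rewrite -[leLHS]real_normK ?num_real// -[leRHS]real_normK ?num_real// lerXn2r ?nnegrE//
    norm_sin_le.
by rewrite expr_div_n; lra.
Qed.

Lemma one_sub_cos_le_norm v : 1 - cos v <= `|v|.
Proof.
have [v2|v2] := leP `|v| 2; last by have := cos_geN1 v; lra.
apply: le_trans (one_sub_cos_le_sqr v) _.
by rewrite -[v ^+ 2]real_normK ?num_real//; have := normr_ge0 v; nra.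
Qed.

Lemma one_sub_cos_ge_sqr v : `|v| <= 1 -> v ^+ 2 / 4 <= 1 - cos v.
Proof.
move=> v1; rewrite one_sub_cosE.
have [xi xile ->] := sin_mean_value (v / 2).
have xi1 : `|xi| <= 1 / 2.
  by apply: le_trans xile _; rewrite normrM [`|2^-1|]ger0_norm//; lra.
have c : 3 / 4 <= cos xi.
  have := one_sub_cos_le_sqr xi; rewrite -[xi ^+ 2]real_normK ?num_real//.
  by have := normr_ge0 xi; nra.
rewrite exprMn expr_div_n.
have : 1 / 2 <= cos xi ^+ 2 by nra.
have := sqr_ge0 v; nra.
Qed.

Lemma norm_sinB_le v : `|sin v - v| <= v ^+ 2.
Proof.
have [xi xile ->] := sin_mean_value v.
rewrite -{2}[v]mulr1 -mulrBr normrM distrC.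
rewrite [`|1 - _|]ger0_norm ?one_sub_cos_ge0// -[leRHS]real_normK ?num_real// expr2.
by rewrite ler_wpM2l// (le_trans (one_sub_cos_le_norm _)).
Qed.

(** Two geometric series that meet at the [n] where [r ^+ n * x] is close to 1, so the bound depends
    on neither [x] nor [N]. The later comparisons of sums over dyadic scales with |x|^(1/kappa), or
    with |x|, rest on it. *)
Lemma sum_geometric_min r x N : 1 < r -> 0 < x ->
  \sum_(n < N) Num.min (r ^+ n * x) (r ^+ n * x)^-1 <= 2 * (r + 1) / (r - 1).
Proof.
move=> r1 x0.
pose A w := w / (1 + w).
(* The sum telescopes: min w w^-1 is dominated by increments of w / (1 + w). *)
have step w : 0 < w -> Num.min w w^-1 <= 2 * (r + 1) / (r - 1) * (A (r * w) - A w).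
  move=> w0; have rw0 : 0 < r * w by rewrite mulr_gt0//; lra.
  have -> : A (r * w) - A w = (r - 1) * w / ((1 + r * w) * (1 + w)).
    by rewrite /A; field; rewrite !gt_eqF//; lra.
  have -> : 2 * (r + 1) / (r - 1) * ((r - 1) * w / ((1 + r * w) * (1 + w))) =
            2 * (r + 1) * w / ((1 + r * w) * (1 + w)).
    by field; rewrite !gt_eqF//; lra.
  have den : 0 < (1 + r * w) * (1 + w) by rewrite mulr_gt0//; lra.
  have [w1|w1] := leP w 1.
    rewrite ge_min; apply/orP; left; rewrite ler_pdivlMr//.
    have : (1 + r * w) * (1 + w) <= 2 * (r + 1) by nra.
    by nra.
  rewrite ge_min; apply/orP; right; rewrite ler_pdivlMr// mulrC ler_pdivrMr//.
  by nra.
have : \sum_(n < N) Num.min (r ^+ n * x) (r ^+ n * x)^-1 <=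
       2 * (r + 1) / (r - 1) * (A (r ^+ N * x) - A x).
  elim: N => [|N IH]; first by rewrite big_ord0 expr0 mul1r subrr mulr0.
  rewrite big_ord_recr/=.
  have := step (r ^+ N * x); rewrite mulrA -exprS => /(_ _)/[dup] h.
  have {}h := h (mulr_gt0 (exprn_gt0 _ (lt_trans ltr01 r1)) x0).
  move=> _; apply: le_trans (lerD IH h) _.
  by rewrite -mulrDr; apply: ler_wpM2l; [rewrite divr_ge0//; lra|lra].
move=> /le_trans; apply; rewrite ler_piMr//; first by rewrite divr_ge0//; lra.
have A0 : 0 <= A x by rewrite /A divr_ge0//; lra.
have rN0 : 0 < r ^+ N * x by rewrite mulr_gt0// exprn_gt0//; lra.
suff : A (r ^+ N * x) <= 1 by lra.
by rewrite /A ler_pdivrMr; lra.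
Qed.

Lemma expr2V n : (2 ^- n : R) = 2^-1 ^+ n. Proof. by rewrite exprVn. Qed.

Lemma dyadic_bracket_le1 y : 0 < y <= 1 -> exists m, 2 ^- m.+1 < y <= 2 ^- m.
Proof.
move=> /andP[y0 y1].
have [m0 m0y] : exists m, 2 ^- m < y.
  have /cvgrPdist_lt/(_ _ y0)[m _ /(_ m (leqnn _))] : (2^-1 : R) ^+ n @[n --> \oo] --> 0.
    by apply: cvg_expr; rewrite ger0_norm; lra.
  by rewrite sub0r normrN ger0_norm ?exprn_ge0// => h; exists m; rewrite expr2V.
have ex : exists m, (2 ^- m < y) by exists m0.
case: (ex_minnP ex) => -[|m] ym mmin.
  by move: ym; rewrite expr0 invr1 ltNge y1.
exists m; rewrite ym/= leNgt; apply/negP => /mmin; by rewrite ltnn.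
Qed.

Lemma dyadic_bracket_ge1 y : 1 <= y -> exists m, 2 ^+ m <= y < 2 ^+ m.+1.
Proof.
move=> y1; have y0 : 0 < y by lra.
have [|m /andP[]] := dyadic_bracket_le1 y^-1.
  by rewrite invr_gt0 y0/= invf_le1.
rewrite ltf_pV2 ?posrE ?exprn_gt0// lef_pV2 ?posrE ?exprn_gt0// => h1 h2.
by exists m; rewrite h2.
Qed.

End elementary.

(** * The characteristic exponent *)

Section levy_measure_integrals.
Context {R : realType}.
Implicit Types f g : R -> R.

Variable Pi : {measure set R -> \bar R}.
Hypothesis hPi : levy_measure Pi.

Local Notation D := (`[-1, 1]%classic : set R).

Lemma unit_itvP (x : R) : D x <-> `|x| <= 1.
Proof. by rewrite /= in_itv/= ler_norml. Qed.

Lemma levy_sqr_integrable : Pi.-integrable D (EFin \o (fun x => x ^+ 2)).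
Proof.
apply: (@integrableS _ _ _ _ setT) => //.
apply/integrableP; split.
  by apply/measurable_EFinP; exact: measurable_funX.
case: hPi => _ h; congr (_ < _)%E: h; apply: eq_integral => x _ /=.
by rewrite ger0_norm ?sqr_ge0.
Qed.

Lemma levy_integrable f (K : R) : measurable_fun D f ->
  (forall x, `|x| <= 1 -> `|f x| <= K * x ^+ 2) ->
  Pi.-integrable D (EFin \o f).
Proof.
move=> mf fK.
apply: (@le_integrable _ _ _ _ _ _ _ (EFin \o (fun x => K * x ^+ 2))) => //.
- exact/measurable_EFinP.
- move=> x /unit_itvP x1 /=; rewrite lee_fin [leRHS]ger0_norm ?fK//.
  exact: le_trans (normr_ge0 _) (fK _ x1).
- exact: (integrableZl _ _ levy_sqr_integrable).
Qed.

Lemma measurable_gt_norm (h : R) : measurable [set x : R | h < `|x|].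
Proof.
have := @normr_measurable R setT measurableT _ (measurable_itv `]h, +oo[).
by rewrite setTI; congr measurable; apply/seteqP; split => x; rewrite /= in_itv/= andbT.
Qed.

Lemma indic_gt_norm (h x : R) : \1_[set x : R | h < `|x|] x = (h < `|x|)%R%:R :> R.
Proof. by rewrite indicE; congr (nat_of_bool _)%:R; apply/idP/idP; rewrite inE. Qed.

Lemma measurable_cosM D' (theta : R) : measurable_fun D' (fun x : R => cos (theta * x)).
Proof.
apply: measurable_funTS; apply: measurableT_comp.
  by apply: continuous_measurable_fun; exact: continuous_cos.
exact: measurable_funM.
Qed.

Lemma measurable_sinM D' (theta : R) : measurable_fun D' (fun x : R => sin (theta * x)).
Proof.
apply: measurable_funTS; apply: measurableT_comp.
  by apply: continuous_measurable_fun; exact: continuous_sin.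
exact: measurable_funM.
Qed.

Lemma integrable_one_sub_cos (theta : R) :
  Pi.-integrable D (EFin \o (fun x => 1 - cos (theta * x))).
Proof.
apply: (@levy_integrable _ (theta ^+ 2 / 2)).
  by apply: measurable_funB => //; exact: measurable_cosM.
move=> x _; rewrite ger0_norm ?one_sub_cos_ge0//.
by apply: le_trans (one_sub_cos_le_sqr _) _; rewrite exprMn; lra.
Qed.

Lemma integrable_sinB (theta : R) :
  Pi.-integrable D (EFin \o (fun x => sin (theta * x) - theta * x)).
Proof.
apply: (@levy_integrable _ (theta ^+ 2)).
  apply: measurable_funB; first exact: measurable_sinM.
  exact: measurable_funM.
by move=> x _; rewrite -exprMn; exact: norm_sinB_le.
Qed.

Lemma integrable_large (h : R) : 0 < h ->
  Pi.-integrable D (EFin \o (fun x => x * \1_[set x | h < `|x|] x)).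
Proof.
move=> h0; apply: (@levy_integrable _ h^-1).
  by apply: measurable_funM => //; apply: measurable_indic; exact: measurable_gt_norm.
move=> x _; rewrite indic_gt_norm; case: ltP => /= hx.
   rewrite mulr1 ler_pdivlMl// -[leRHS]real_normK ?num_real// expr2.
  by rewrite ler_wpM2r// ltW.
by rewrite mulr0 normr0 mulr_ge0 ?sqr_ge0// invr_ge0 ltW.
Qed.

Definition levy_re (theta : R) : R := \int[Pi]_(x in D) (1 - cos (theta * x)).

(* The drift of X once its jumps larger than h are removed. *)
Definition levy_center (gamma h : R) : R :=
  gamma - \int[Pi]_(x in D) (x * \1_[set x | h < `|x|] x).

Definition levy_im (theta : R) : R := \int[Pi]_(x in D) (sin (theta * x) - theta * x).

Lemma levy_re_ge0 theta : 0 <= levy_re theta.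
Proof. by apply: Rintegral_ge0 => x _; exact: one_sub_cos_ge0. Qed.

Lemma levy_exponentE gamma theta :
  levy_exponent gamma 0 Pi theta =
  (- levy_re theta +i* (gamma * theta + levy_im theta))%C.
Proof.
rewrite /levy_exponent /levy_re /levy_im; congr (_ +i* _)%C.
rewrite !mul0r oppr0 add0r -[RHS]mulN1r -RintegralZl//.
  by apply: eq_Rintegral => x _; lra.
exact: integrable_one_sub_cos.
Qed.

Lemma integrable_compensated theta h : 0 < h ->
  Pi.-integrable D (EFin \o (fun x =>
    sin (theta * x) - theta * x * (1 - \1_[set x | h < `|x|] x))).
Proof.
move=> h0.
have mD : measurable D by exact: measurable_itv.
have := integrableD mD (integrable_sinB theta)
  (integrableZl mD theta (integrable_large _ h0)).
apply: eq_integrable => // x _ /=; rewrite -EFinD; congr EFin.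
by lra.
Qed.

(** Jumps larger than [h] lose their compensator, which is paid into the drift; centring by
    [levy_center] cancels that drift, and only the small jumps stay compensated. *)
Lemma levy_im_center gamma theta h : 0 < h ->
  gamma * theta + levy_im theta - levy_center gamma h * theta =
  \int[Pi]_(x in D) (sin (theta * x) - theta * x * (1 - \1_[set x | h < `|x|] x)).
Proof.
move=> h0; rewrite /levy_center /levy_im.
have mD : measurable D by exact: measurable_itv.
transitivity (\int[Pi]_(x in D) (sin (theta * x) - theta * x) +
    \int[Pi]_(x in D) (theta * (x * \1_[set x | h < `|x|] x))).
  by rewrite RintegralZl//; [lra|exact: integrable_large].
rewrite -RintegralD//; last 2 first.
- exact: integrable_sinB.
- exact: (integrableZl mD theta (integrable_large _ h0)).
by apply: eq_Rintegral => x _; lra.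
Qed.
End levy_measure_integrals.

(** * Expectations of 1 - cos under the marginals *)

Section characteristic_function.
Context d (T : measurableType d) (R : realType) (P : probability T R).
Variables (X : R -> {RV P >-> R}) (gamma : R) (Pi : {measure set R -> \bar R}).
Hypothesis X_triplet : levy_triplet X gamma 0 Pi.
Implicit Types s theta c : R.

Local Notation D := (`[-1, 1]%classic : set R).
Local Notation psi := (levy_re Pi).
Local Notation im := (levy_im Pi).

Lemma triplet_levy : levy_measure Pi.
Proof. by case: X_triplet. Qed.

Lemma measurable_cos_comp (Y : T -> R) :
  measurable_fun setT Y -> measurable_fun setT (fun w => cos (Y w)).
Proof.
by move=> mY; apply: measurableT_comp => //; apply: continuous_measurable_fun;
  exact: continuous_cos.
Qed.

Lemma measurable_sin_comp (Y : T -> R) :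
  measurable_fun setT Y -> measurable_fun setT (fun w => sin (Y w)).
Proof.
by move=> mY; apply: measurableT_comp => //; apply: continuous_measurable_fun;
  exact: continuous_sin.
Qed.

Lemma integrable_bounded (f : T -> R) (M : R) : measurable_fun setT f ->
  (forall w, `|f w| <= M) -> P.-integrable setT (EFin \o f).
Proof.
move=> mf fM; apply: measurable_bounded_integrable => //.
  by apply: le_lt_trans (probability_le1 P measurableT) _; rewrite ltry.
by exists M; split; [exact: num_real|move=> y My w _; exact: le_trans (fM w) (ltW My)].
Qed.

Lemma levy_char_fun s theta : 0 <= s ->
  \int[P]_w cos (theta * X s w) =
    expR (- (s * psi theta)) * cos (s * (gamma * theta + im theta)) /\
  \int[P]_w sin (theta * X s w) = expR (- (s * psi theta)) * sin (s * (gamma * theta + im theta)).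
Proof.
move=> s0; case: X_triplet => _ hPi /(_ _ theta s0).
rewrite levy_exponentE// /char_fun /cexp /=.
by rewrite !mul0r subr0 addr0 mulrN => -[-> ->].
Qed.

Lemma expectation_one_sub_cos s theta c : 0 <= s ->
  (\int[P]_w (1 - cos (theta * (X s w - s * c)))%:E)%E =
  (1 - expR (- (s * psi theta)) * cos (s * (gamma * theta + im theta - c * theta)))%:E.
Proof.
move=> s0; have [hc hs] := levy_char_fun s theta s0.
have mX : measurable_fun setT (fun w => theta * X s w) by exact: measurable_funM.
have ic : P.-integrable setT (EFin \o (fun w => cos (theta * X s w))).
  by apply: (integrable_bounded _ 1) => [|w]; [exact: measurable_cos_comp|exact: cos_max].
have is_ : P.-integrable setT (EFin \o (fun w => sin (theta * X s w))).
  by apply: (integrable_bounded _ 1) => [|w]; [exact: measurable_sin_comp|exact: sin_max].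
have i1 : P.-integrable setT (EFin \o (fun=> 1 : R)).
  by apply: (integrable_bounded _ 1) => // w; rewrite normr1.
set C := cos (theta * (s * c)); set S := sin (theta * (s * c)).
have iC := integrableZl measurableT C ic.
have iS := integrableZl measurableT S is_.
have -> : (\int[P]_w (1 - cos (theta * (X s w - s * c)))%:E)%E =
  (\int[P]_w (1 - (C * cos (theta * X s w) + S * sin (theta * X s w))))%R%:E.
  rewrite /Rintegral fineK.
    by apply: eq_integral => w _; rewrite mulrBr cosB /C /S; congr EFin; ring.
  apply: integrable_fin_num => //.
  exact: (integrableB measurableT i1 (integrableD measurableT iC iS)).
congr EFin.
rewrite (@RintegralB _ _ _ _ _ (fun=> 1) (fun w =>
  C * cos (theta * X s w) + S * sin (theta * X s w)))//; last first.
  exact: (integrableD measurableT iC iS).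
have -> : \int[P]__ (1 : R) = 1.
  rewrite (Rintegral_cst P measurableT 1) mul1r.
  exact: (congr1 fine (probability_setT P)).
rewrite RintegralD// !RintegralZl// hc hs.
rewrite mulrBr cosB (_ : s * (c * theta) = theta * (s * c)); last by ring.
by rewrite -/C -/S; ring.
Qed.

(** With E = exp(-s psi) and B the centred imaginary part, 1 - E cos(s B) = (1 - E) + E (1 - cos(s
    B)), which is at most s psi + s |B|. The bound is linear in s, like the expected number of jumps
    up to time s. *)
Lemma expectation_one_sub_cos_le s theta h : 0 <= s -> 0 < h ->
  (\int[P]_w (1 - cos (theta * (X s w - s * levy_center Pi gamma h)))%:E <=
   s%:E * \int[Pi]_(x in D) (1 - cos (theta * x) +
      `|sin (theta * x) - theta * x * (1 - \1_[set x | h < `|x|]%R x)|)%:E)%E.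
Proof.
move=> s0 h0; rewrite expectation_one_sub_cos// levy_im_center//; last exact: triplet_levy.
have hPi := triplet_levy.
have mD : measurable D by exact: measurable_itv.
set B := Rintegral _ _ _.
have ic := integrable_compensated _ hPi theta h h0.
have ip := integrable_one_sub_cos _ hPi theta.
have -> : (\int[Pi]_(x in D) (1 - cos (theta * x) +
      `|sin (theta * x) - theta * x * (1 - \1_[set x | h < `|x|]%R x)|)%:E)%E =
  (psi theta + \int[Pi]_(x in D)
    `|sin (theta * x) - theta * x * (1 - \1_[set x | h < `|x|]%R x)|)%R%:E.
  rewrite /levy_re -RintegralD//; last by apply: integrable_norm.
  rewrite /Rintegral fineK//; apply: integrable_fin_num => //.
  exact: (integrableD mD ip (integrable_norm ic)).
rewrite -EFinM lee_fin mulrDr.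
have : `|B| <= \int[Pi]_(x in D) `|sin (theta * x) - theta * x * (1 - \1_[set x | h < `|x|]%R x)|.
  exact: le_normr_Rintegral.
move=> /(ler_wpM2l s0) BB.
apply: le_trans (lerD (lexx _) BB).
set E := expR _.
have E1 : 1 - E <= s * psi theta.
  by have := expR_ge1Dx (- (s * psi theta)); rewrite -/E; lra.
have E0 : 0 <= E by exact: expR_ge0.
have El : E <= 1.
  by rewrite /E -expR0 ler_expR oppr_le0 mulr_ge0// levy_re_ge0.
have := one_sub_cos_le_norm (s * B); rewrite normrM (ger0_norm s0).
have := one_sub_cos_ge0 (s * B); nra.
Qed.

End characteristic_function.

(** * Powers, series and geometric sums *)

Section series.
Context {R : realType}.
Implicit Types q : R.

Lemma powR_le1 (z p : R) : 0 <= z <= 1 -> 0 <= p -> z `^ p <= 1.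
Proof.
move=> /andP[z0 z1] p0; have := ge0_ler_powR p0 z0 ler01 z1.
by rewrite powR1.
Qed.

Lemma powR_lt1 (z p : R) : 0 <= z < 1 -> 0 < p -> z `^ p < 1.
Proof.
move=> /andP[z0 z1] p0; have := gt0_ltr_powR p0 z0 ler01 z1.
by rewrite powR1.
Qed.

Lemma powR_ge1 (z p : R) : 1 <= z -> 0 <= p -> 1 <= z `^ p.
Proof.
move=> z1 p0; have := ge0_ler_powR p0 ler01 (le_trans ler01 z1) z1.
by rewrite powR1.
Qed.

Lemma exp2V_gt0 n : 0 < 2 ^- n :> R.
Proof. by rewrite invr_gt0 exprn_gt0. Qed.

Lemma nneseries_le_fin (f : nat -> R) (M : R) : (forall k, 0 <= f k) ->
  (forall n, \sum_(k < n) f k <= M) -> (\sum_(k <oo) (f k)%:E <= M%:E)%E.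
Proof.
move=> f0 fM; apply: lime_le.
  by apply: is_cvg_nneseries => k _ _; rewrite lee_fin.
apply: nearW => n; rewrite big_mkord sumEFin lee_fin; exact: fM.
Qed.

Lemma sum_geometric_le q n : 0 <= q < 1 -> \sum_(k < n) q ^+ k <= (1 - q)^-1.
Proof.
move=> /andP[q0 q1]; have q1' : 0 < 1 - q by rewrite subr_gt0.
rewrite -[leRHS]mul1r ler_pdivlMr// mulrC.
have -> : (1 - q) * \sum_(k < n) q ^+ k = 1 - q ^+ n.
  elim: n => [|n IH]; first by rewrite big_ord0 mulr0 expr0 subrr.
  by rewrite big_ord_recr/= mulrDr IH exprS; ring.
by rewrite gerBl exprn_ge0.
Qed.

End series.

(** * Tails of the marginals *)

Section tail.
Context {R : realType}.

(* Summing over dyadic frequencies plays the role of averaging 1 - cos (theta y)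
   over theta. *)
Lemma one_sub_cos_detects (a y : R) : 0 < a -> a < `|y| ->
  exists k, 1 / 16 <= 1 - cos (2 ^- k / a * y).
Proof.
move=> a0 ay; have y1 : 1 <= `|y| / a by rewrite ler_pdivlMr// mul1r ltW.
have [m /andP[m1 m2]] := dyadic_bracket_ge1 _ y1.
(* This frequency brings its product with [y] into [1/2, 1] in absolute value, where 1 - cos is at
   least (1/2)^2 / 4 = 1/16. *)
exists m.+1; set v := _ * y.
have vE : `|v| = 2 ^- m.+1 * (`|y| / a).
  by rewrite /v !normrM !normfV (gtr0_norm a0) normrX normr_nat; ring.
have v1 : `|v| <= 1.
  by rewrite vE mulrC ler_pdivrMr ?exprn_gt0// mul1r ltW.
have v2 : 1 / 2 <= `|v|.
  by rewrite vE [leRHS]mulrC ler_pdivlMr ?exprn_gt0// exprS; lra.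
apply: le_trans (one_sub_cos_ge_sqr _ v1).
rewrite -[v ^+ 2]real_normK ?num_real//; nra.
Qed.

Lemma measure_gt_norm_le_cos d (T : measurableType d) (mu : {measure set T -> \bar R})
    (Y : T -> R) (a : R) : measurable_fun setT Y -> 0 < a ->
  (mu [set w | (a < `|Y w|)%R] <=
   \sum_(k <oo) 16%:E * \int[mu]_w (1 - cos (2 ^- k / a * Y w))%:E)%E.
Proof.
move=> mY a0.
have mA : measurable [set w | a < `|Y w|].
  by have := mY measurableT _ (measurable_gt_norm a); rewrite setTI.
have mc k : measurable_fun setT (fun w => (1 - cos (2 ^- k / a * Y w))%:E).
  apply/measurable_EFinP; apply: measurable_funB => //.
  by apply: measurable_cos_comp; exact: measurable_funM.
have c0 k w : (0 <= (1 - cos (2 ^- k / a * Y w))%:E)%E.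
  by rewrite lee_fin one_sub_cos_ge0.
rewrite -[X in mu X]setIT -integral_indic//.
under [X in (_ <= X)%E]eq_eseriesr do rewrite -ge0_integralZl_EFin//.
rewrite -integral_nneseries//; last by move=> k; exact: measurable_funeM.
apply: ge0_le_integral => //.
- by apply/measurable_EFinP; exact: measurable_indic.
- apply: ge0_emeasurable_sum => [k w _ _|k _]; first by rewrite mule_ge0.
  exact: measurable_funeM.
move=> w _; rewrite indicE; case: (boolP (w \in _)) => [|_]; last first.
  by apply: nneseries_ge0 => k _ _; rewrite mule_ge0.
rewrite inE/= => /(one_sub_cos_detects _ _ a0)[k hk].
rewrite (@nneseriesD1 _ (fun k => (16%:E * (1 - cos (2 ^- k / a * Y w))%:E)%E) k)//.
apply: (@le_trans _ _ (16%:E * (1 - cos (2 ^- k / a * Y w))%:E)%E).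
  by rewrite -EFinM lee_fin; lra.
rewrite leeDl//; apply: nneseries_ge0 => i _ _; rewrite mule_ge0//.
Qed.

(** The function U, with its exponent at infinity left free: (2 kappa)^-1 for the small-time
    estimate, and 1 in [tail_prob_small], where only the quadratic branch is met. *)
Definition tail_weight (eta z : R) : R := if z <= 1 then z ^+ 2 else z `^ eta.

Lemma tail_weight_ge0 eta z : 0 <= tail_weight eta z.
Proof. by rewrite /tail_weight; case: ifP; rewrite ?sqr_ge0 ?powR_ge0. Qed.

Lemma measurable_tail_weight eta : measurable_fun setT (tail_weight eta).
Proof.
apply: measurable_fun_ifT.
- exact: measurable_fun_ler.
- exact: measurable_funX.
- exact: measurable_powR.
Qed.

Definition compensated (h theta x : R) : R :=
  1 - cos (theta * x) + `|sin (theta * x) - theta * x * (1 - \1_[set x | h < `|x|] x)|.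

Lemma compensated_ge0 h theta x : 0 <= compensated h theta x.
Proof. by rewrite addr_ge0// one_sub_cos_ge0. Qed.

Lemma measurable_compensated h theta : measurable_fun setT (compensated h theta).
Proof.
apply: measurable_funD.
  by apply: measurable_funB => //; exact: measurable_cosM.
apply: measurableT_comp => //; apply: measurable_funB; first exact: measurable_sinM.
apply: measurable_funM; first exact: measurable_funM.
by apply: measurable_funB => //; apply: measurable_indic; exact: measurable_gt_norm.
Qed.

Definition tail_const (eps eta : R) : R :=
  3 / eps ^+ 2 + 3 * eps^-1 `^ eta / (1 - 2^-1 `^ eta).

Lemma tail_const_ge0 eps eta : 0 < eps -> 0 < eta -> 0 <= tail_const eps eta.
Proof.
move=> e0 eta0; have : 2^-1 `^ eta <= 1 :> R.
  by apply: powR_le1; lra.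
by move=> h; rewrite addr_ge0 ?divr_ge0 ?mulr_ge0 ?powR_ge0 ?exprn_ge0//; lra.
Qed.

(** For |x| <= [h] the terms are quadratic in the frequency and sum with ratio 1/4, which gives 3 /
    eps^2. For |x| > [h], with v the frequency times x, each term is at most 3 min(|v|, 1) <= 3
    |v|^eta, and the series has ratio 2^(-eta): the power replaces a long run of terms of order 1 by
    a convergent series. *)
Lemma sum_compensated_le (eps eta h x : R) N : 0 < eps -> 0 < eta <= 1 -> 0 < h ->
  \sum_(k < N) compensated h (2 ^- k / (eps * h)) x <=
  tail_const eps eta * tail_weight eta (`|x| / h).
Proof.
move=> e0 /andP[eta0 eta1] h0.
set z := `|x| / h.
have z0 : 0 <= z by rewrite divr_ge0// ltW.
have ez0 : 0 <= eps^-1 * z by rewrite mulr_ge0// invr_ge0 ltW.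
have vE k : `|2 ^- k / (eps * h) * x| = 2 ^- k * (eps^-1 * z).
  rewrite !normrM !normfV !normrM (ger0_norm (ltW e0)) (ger0_norm (ltW h0)).
  rewrite normrX normr_nat /z; field; rewrite expf_neq0 ?gt_eqF//.
have q1 : 2^-1 `^ eta < 1 :> R.
  by apply: powR_lt1; lra.
have c1 : 0 <= 3 / eps ^+ 2 by rewrite divr_ge0// exprn_ge0// ltW.
have c2 : 0 <= 3 * eps^-1 `^ eta / (1 - 2^-1 `^ eta).
  by rewrite divr_ge0 ?mulr_ge0 ?powR_ge0//; lra.
rewrite /tail_weight; case: ifPn => z1.
  have xh : `|x| <= h by move: z1; rewrite /z ler_pdivrMr// mul1r.
  apply: (@le_trans _ _ (\sum_(k < N) (4^-1 ^+ k * (3 / 2 * (eps^-1 * z) ^+ 2)))).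
    apply: ler_sum => k _; rewrite /compensated indic_gt_norm ltNge xh/= subr0 mulr1.
    have := one_sub_cos_le_sqr (2 ^- k / (eps * h) * x).
    have := norm_sinB_le (2 ^- k / (eps * h) * x).
    rewrite -[(2 ^- k / (eps * h) * x) ^+ 2]real_normK ?num_real// vE exprMn.
    have -> : (2 ^- k : R) ^+ 2 = 4^-1 ^+ k.
      by rewrite expr2V -exprM mulnC exprM; congr (_ ^+ _); rewrite expr2; field.
    lra.
  rewrite -mulr_suml.
  have g : \sum_(k < N) (4^-1 : R) ^+ k <= 2.
    have q : 0 <= (4^-1 : R) < 1 by lra.
    have := sum_geometric_le 4^-1 N q.
    by rewrite (_ : (1 - 4^-1)^-1 = 4 / 3 :> R); [lra|field].
  apply: (@le_trans _ _ (3 * (eps^-1 * z) ^+ 2)).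
    by have := sqr_ge0 (eps^-1 * z); nra.
  rewrite exprMn exprVn mulrA ler_wpM2r ?sqr_ge0// /tail_const; lra.
apply: (@le_trans _ _ (\sum_(k < N) ((2^-1 `^ eta) ^+ k * (3 * (eps^-1 * z) `^ eta)))).
  apply: ler_sum => k _.
  have xh : h < `|x| by move: z1; rewrite -ltNge /z ltr_pdivlMr// mul1r.
  rewrite /compensated indic_gt_norm xh/= subrr mulr0 subr0.
  set v := _ * x.
  have -> : (2^-1 `^ eta) ^+ k * (3 * (eps^-1 * z) `^ eta) = 3 * `|v| `^ eta.
    rewrite vE [in RHS]powRM ?(ltW (exp2V_gt0 _))//.
    rewrite expr2V -!powR_mulrn ?powR_ge0// -!powRrM [eta * _]mulrC; ring.
  have [v1|v1] := leP `|v| 1.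
    have : `|v| <= `|v| `^ eta.
      have [->|v0] := eqVneq `|v| 0; first exact: powR_ge0.
      rewrite -{1}[`|v|]powRr1// ger_powR// v1 andbT lt_neqAle eq_sym v0/=//.
    have := one_sub_cos_le_norm v; have := norm_sin_le v; have := normr_ge0 v; lra.
  have : 1 <= `|v| `^ eta.
    by apply: powR_ge1; lra.
  have := one_sub_cos_le2 v; have := sin_max v; lra.
rewrite -mulr_suml.
apply: (@le_trans _ _ ((1 - 2^-1 `^ eta)^-1 * (3 * (eps^-1 * z) `^ eta))).
  rewrite ler_wpM2r ?mulr_ge0 ?powR_ge0// sum_geometric_le// powR_ge0//.
rewrite powRM// ?invr_ge0 ?(ltW e0)//.
apply: (@le_trans _ _ (3 * eps^-1 `^ eta / (1 - 2^-1 `^ eta) * z `^ eta)); first lra.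
by rewrite ler_wpM2r ?powR_ge0// /tail_const; lra.
Qed.

End tail.

Section tail_bound.
Context d (T : measurableType d) (R : realType) (P : probability T R).
Variables (X : R -> {RV P >-> R}) (gamma : R) (Pi : {measure set R -> \bar R}).
Hypothesis X_triplet : levy_triplet X gamma 0 Pi.
Local Notation D := (`[-1, 1]%classic : set R).

Lemma levy_tail_bound (s h eps eta : R) : 0 <= s -> 0 < h -> 0 < eps -> 0 < eta <= 1 ->
  (P [set w | (eps * h < `|X s w - s * levy_center Pi gamma h|)%R] <=
   (16 * s * tail_const eps eta)%:E *
     \int[Pi]_(x in D) (tail_weight eta (`|x| / h))%:E)%E.
Proof.
move=> s0 h0 e0 eta01; have eh0 : 0 < eps * h by rewrite mulr_gt0.
have mD : measurable D by exact: measurable_itv.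
have mY : measurable_fun setT (fun w => X s w - s * levy_center Pi gamma h).
  exact: measurable_funB.
apply: (le_trans (measure_gt_norm_le_cos _ _ P _ _ mY eh0)).
have c0 k x : (0 <= (compensated h (2 ^- k / (eps * h)) x)%:E)%E.
  by rewrite lee_fin compensated_ge0.
have mc k : measurable_fun D (fun x => (compensated h (2 ^- k / (eps * h)) x)%:E).
  by apply/measurable_EFinP; apply: measurable_funTS; exact: measurable_compensated.
have k0 : 0 <= 16 * s by rewrite mulr_ge0.
apply: (@le_trans _ _ (\sum_(k <oo) (16 * s)%:E *
    \int[Pi]_(x in D) (compensated h (2 ^- k / (eps * h)) x)%:E)%E).
  apply: lee_nneseries => [k _|k _].
    by rewrite mule_ge0// integral_ge0// => w _; rewrite lee_fin one_sub_cos_ge0.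
  by rewrite EFinM -muleA lee_wpmul2l//; exact: expectation_one_sub_cos_le.
under eq_eseriesr do rewrite -ge0_integralZl_EFin//.
rewrite -integral_nneseries//; last 2 first.
- by move=> k; exact: measurable_funeM.
- by move=> k x _; rewrite mule_ge0.
have mU : measurable_fun D (fun x => tail_weight eta (`|x| / h)).
  apply: measurable_funTS; apply: measurableT_comp; first exact: measurable_tail_weight.
  exact: measurable_funM.
have tc := tail_const_ge0 _ _ e0 (andP eta01).1.
rewrite -ge0_integralZl_EFin//; last 3 first.
- by move=> x _; rewrite lee_fin tail_weight_ge0.
- exact/measurable_EFinP.
- by rewrite mulr_ge0.
apply: ge0_le_integral => //.
- by move=> x _; apply: nneseries_ge0 => k _ _; rewrite mule_ge0.
- apply: ge0_emeasurable_sum => [k w _ _|k _]; first by rewrite mule_ge0.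
  exact: measurable_funeM.
- by apply: measurable_funeM; exact/measurable_EFinP.
move=> x _; under eq_eseriesr do rewrite -EFinM.
rewrite -EFinM; apply: nneseries_le_fin => [k|N].
  by rewrite mulr_ge0// compensated_ge0.
by rewrite -mulr_sumr -[leRHS]mulrA ler_wpM2l// sum_compensated_le.
Qed.

End tail_bound.

(** * The scales 2^(-n kappa) *)

Section power_scales.
Context {R : realType}.
Variable kappa : R.
Hypothesis kappa_gt : 1 / 2 < kappa.

Let k0 : 0 < kappa. Proof. by move: kappa_gt; lra. Qed.

Definition scale (n : nat) : R := (2 ^- n) `^ kappa.

Lemma scale_gt0 n : 0 < scale n.
Proof. by rewrite powR_gt0// exp2V_gt0. Qed.

Lemma powRVK (x : R) : 0 <= x -> (x `^ kappa^-1) `^ kappa = x.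
Proof. by move=> x0; rewrite -powRrM mulVf ?powRr1// gt_eqF. Qed.

(** In terms of y = x^(1/kappa) and w = 2^n y, comparing x with h_n is comparing w with 1, while the
    weight 2^-n is y / w. This change of variable reduces the sums over scales to
    [sum_geometric_min]. *)
Lemma div_scale (x : R) n : 0 <= x -> x / scale n = (2 ^+ n * x `^ kappa^-1) `^ kappa.
Proof.
move=> x0; rewrite powRM ?exprn_ge0 ?powR_ge0// powRVK// mulrC; congr (_ * _).
rewrite /scale -powRN -powR_inv1 ?exprn_ge0// -powRrM mulN1r.
by rewrite opprK.
Qed.

Lemma powR_gt1 (w : R) : 0 <= w -> (1 < w `^ kappa) = (1 < w).
Proof.
move=> w0; apply/idP/idP => w1.
  rewrite ltNge; apply/negP => w1'.
  by move: w1; rewrite ltNge powR_le1 ?w0 ?w1' ?ltW.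
by have := gt0_ltr_powR k0 ler01 w0 w1; rewrite powR1.
Qed.

Lemma scale_lt (x : R) n : 0 <= x -> (scale n < x) = (1 < 2 ^+ n * x `^ kappa^-1).
Proof.
move=> x0; rewrite -powR_gt1 ?mulr_ge0 ?powR_ge0 ?exprn_ge0// -div_scale//.
by rewrite ltr_pdivlMr ?scale_gt0// mul1r.
Qed.

(** With w = 2^n x^(1/kappa), the n-th term of [sum_tail_weight_le] is x^(1/kappa) times w^(2 kappa
    - 1) if w <= 1, and times w^(-1/2) otherwise. With this exponent a, both factors are at most
    min(w^a, w^(-a)); a > 0 is where kappa > 1/2 enters. [scale_const] is the bound of
    [sum_geometric_min] at ratio 2^a. *)
Definition scale_exponent : R := Num.min (2 * kappa - 1) (1 / 2).

Definition scale_const : R := 2 * (2 `^ scale_exponent + 1) / (2 `^ scale_exponent - 1).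

Lemma scale_exponent_gt0 : 0 < scale_exponent.
Proof. by move: kappa_gt => k; rewrite lt_min; apply/andP; split; lra. Qed.

Lemma scale_ratio_gt1 : 1 < 2 `^ scale_exponent.
Proof.
by have := @gt0_ltr_powR R _ scale_exponent_gt0 1 2; rewrite !nnegrE powR1; apply; lra.
Qed.

Lemma scale_const_ge0 : 0 <= scale_const.
Proof.
have := scale_ratio_gt1 => r1.
by rewrite /scale_const divr_ge0//; lra.
Qed.

Lemma sum_tail_weight_le (x : R) N : 0 <= x ->
  \sum_(n < N) 2 ^- n * tail_weight (2 * kappa)^-1 (x / scale n) <=
  scale_const * x `^ kappa^-1.
Proof.
move=> x0; set a := scale_exponent.
have a0 : 0 < a by exact: scale_exponent_gt0.
have a1 : a <= 2 * kappa - 1 by rewrite ge_min lexx.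
have a2 : a <= 1 / 2 by rewrite ge_min lexx orbT.
have r1 : 1 < 2 `^ a :> R by exact: scale_ratio_gt1.
have [->|xn0] := eqVneq x 0.
  rewrite powR0 ?invr_eq0 ?gt_eqF// mulr0 big1// => n _.
  by rewrite mul0r /tail_weight ler01 expr0n mulr0.
set y := x `^ kappa^-1.
have y0 : 0 < y by rewrite powR_gt0// lt_def xn0.
apply: (@le_trans _ _ (y * \sum_(n < N)
  Num.min ((2 `^ a) ^+ n * y `^ a) ((2 `^ a) ^+ n * y `^ a)^-1)).
  rewrite mulr_sumr; apply: ler_sum => n _.
  rewrite div_scale// -/y; set w := 2 ^+ n * y.
  have w0 : 0 < w by rewrite mulr_gt0// exprn_gt0.
  have -> : (2 `^ a) ^+ n * y `^ a = w `^ a.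
    rewrite powRM ?exprn_ge0 ?(ltW y0)//; congr (_ * _).
    by rewrite -powR_mulrn ?powR_ge0// -powRrM mulrC powRrM powR_mulrn.
  have -> : 2 ^- n = y / w :> R.
    by rewrite /w invfM mulrCA divff ?mulr1// gt_eqF.
  rewrite -mulrA ler_wpM2l ?(ltW y0)// mulrC ler_pdivrMr// -powRN.
  have wE p : w `^ p * w = w `^ (p + 1).
    by rewrite powRD ?powRr1 ?(ltW w0)//; apply/implyP => _; rewrite gt_eqF.
  rewrite /tail_weight; case: ifPn => [|]; last rewrite -ltNge.
    rewrite leNgt powR_gt1 ?(ltW w0)// -leNgt => w1.
    rewrite -powR_mulrn ?powR_ge0// -powRrM.
    rewrite minr_pMl ?(ltW w0)// !wE le_min; apply/andP; split.
      by rewrite ger_powR ?w0//; lra.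
    by rewrite ger_powR ?w0//; lra.
  rewrite powR_gt1 ?(ltW w0)// => w1.
  rewrite -powRrM (_ : kappa * (2 * kappa)^-1 = 1 / 2); last first.
    by field; rewrite gt_eqF.
  rewrite minr_pMl ?(ltW w0)// !wE le_min; apply/andP; split.
    by rewrite ler_powR ?(ltW w1)//; lra.
  by rewrite ler_powR ?(ltW w1)//; lra.
rewrite mulrC ler_wpM2r ?(ltW y0)//.
by apply: sum_geometric_min => //; rewrite powR_gt0.
Qed.

End power_scales.

(** The integral of a nonnegative function is a supremum over the simple functions below it, so a
    pointwise comparison passes to integrals of arbitrary functions, such as the one of x |->
    [levy_tail] at x^kappa. *)
Lemma ge0_subfun_integral d (T : measurableType d) (R : realType)
    (mu : {measure set T -> \bar R}) (D : set T) (f g : T -> \bar R) :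
  (forall x, D x -> (0 <= f x)%E) -> (forall x, D x -> (f x <= g x)%E) ->
  (\int[mu]_(x in D) f x <= \int[mu]_(x in D) g x)%E.
Proof.
move=> f0 fg; rewrite integral_mkcond [leRHS]integral_mkcond.
have f0' x : (0 <= (f \_ D) x)%E by rewrite patchE; case: ifPn => //; rewrite inE => /f0.
have fg' x : ((f \_ D) x <= (g \_ D) x)%E by apply: lee_restrict.
rewrite !ge0_integralTE//; last by move=> x; exact: le_trans (fg' x).
apply: le_ereal_sup => _ [h hf <-]; exists h => //= x; exact: le_trans (hf x) (fg' x).
Qed.

Lemma measurable_gt_normR {R : realType} (E : set R) (h : R) :
  measurable_fun E (fun x : R => (h < `|x|)%R%:R : R).
Proof.
rewrite (_ : (fun x => _) = \1_[set x : R | h < `|x|]).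
  by apply: measurable_indic; exact: measurable_gt_norm.
by apply/funext => x; rewrite indic_gt_norm.
Qed.

(** * The tail integral and the integral of |x|^(1/kappa) *)

Section tail_integral.
Context {R : realType}.
Variables (Pi : {measure set R -> \bar R}) (kappa : R).
Hypothesis hPi : levy_measure Pi.
Hypothesis kappa_gt : 1 / 2 < kappa.
Local Notation D := (`[-1, 1]%classic : set R).
Local Notation h := (scale kappa).

Let k0 : 0 < kappa. Proof. by move: kappa_gt; lra. Qed.

Let mD : measurable D. Proof. exact: measurable_itv. Qed.

Lemma levy_tailE (h : R) : 0 <= h ->
  levy_tail Pi h = (\int[Pi]_(x in D) (\1_[set x | (h < `|x|)%R] x)%:E)%E.
Proof.
move=> h0; rewrite /levy_tail.
have mA := measurable_gt_norm h.
have disj : `]h, +oo[%classic `&` `]-oo, (- h)%R[%classic = set0 :> set R.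
  by apply/seteqP; split => // x []; rewrite /= !in_itv/= andbT; lra.
have -> : (Pi `]h, +oo[%classic + Pi `]-oo, (- h)%R[%classic)%E = Pi [set x : R | h < `|x|].
  rewrite -measureU//; congr (Pi _).
  apply/seteqP; split => x /=; rewrite !in_itv/= andbT ltrNr.
    by case=> hx; rewrite ltr_normr hx// orbT.
  by rewrite ltr_normr => /orP.
rewrite integral_indic// (measureDI Pi mA mD).
rewrite [X in (X + _)%E](_ : _ = 0%E) ?add0e//.
apply: (@subset_measure0 _ _ _ _ _ (~` (D `\ 0))).
- exact: measurableD.
- by apply: measurableC; apply: measurableD => //.
- by move=> x [_ xD] [].
- by case: hPi.
Qed.

Lemma levy_tail_ge0 (h : R) : (0 <= levy_tail Pi h)%E.
Proof. by rewrite adde_ge0. Qed.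

Lemma levy_tail_le (h h' : R) : h <= h' -> (levy_tail Pi h' <= levy_tail Pi h)%E.
Proof.
move=> hh; apply: leeD; apply: le_measure; rewrite ?inE//.
- by apply: subset_itvr; rewrite bnd_simp.
- by apply: subset_itvl; rewrite bnd_simp lerN2.
Qed.

Lemma measurable_levy_power : measurable_fun D (fun x : R => `|x| `^ kappa^-1).
Proof.
apply: measurable_funTS.
by apply: (measurableT_comp (measurable_powR _)) => //.
Qed.

(** The index is shifted by one because the block [2^-(n+1), 2^-n) has length 2^-(n+1) and u^kappa
    >= h_(n+1) on it. The constant 6 is that of [sum_geometric_min] at ratio 2. *)
Lemma sum_indic_scale_le (x : R) N : 0 <= x ->
  \sum_(n < N) 2 ^- n.+1 * (h n.+1 < x)%R%:R <= 6 * x `^ kappa^-1 :> R.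
Proof.
move=> x0.
have [->|xn0] := eqVneq x 0.
  rewrite powR0 ?invr_eq0 ?gt_eqF// mulr0 big1// => n _.
  by rewrite ltNge ltW ?scale_gt0// mulr0.
set y := x `^ kappa^-1.
have y0 : 0 < y by rewrite powR_gt0// lt_def xn0.
apply: (@le_trans _ _ (y * \sum_(n < N) Num.min (2 ^+ n * (2 * y)) (2 ^+ n * (2 * y))^-1)).
  rewrite mulr_sumr; apply: ler_sum => n _.
  rewrite scale_lt// -/y mulrA -exprSr; set w := 2 ^+ n.+1 * y.
  have w0 : 0 < w by rewrite mulr_gt0// exprn_gt0.
  have wi : 0 <= w^-1 by rewrite invr_ge0 ltW.
  have -> : 2 ^- n.+1 = y / w :> R.
    by rewrite /w invfM mulrCA divff ?mulr1// gt_eqF.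
  rewrite -mulrA ler_wpM2l ?(ltW y0)// le_min.
  case: (ltP 1 w) => w1 /=; last by rewrite mulr0 wi ltW.
  by rewrite mulr1 lexx andbT (le_trans _ (ltW w1))// invf_le1// ltW.
rewrite mulrC ler_wpM2r ?(ltW y0)//.
have := @sum_geometric_min R 2 (2 * y) N; rewrite (_ : 2 * (2 + 1) / (2 - 1) = 6 :> R).
  by apply; rewrite ?mulr_gt0//; lra.
by field.
Qed.

(* Together with sum_indic_scale_le: x^(1/kappa) is comparable with the dyadic
   discretisation of \int_0^1 1_(x > u^kappa) du. *)
Lemma power_le_indic_scale (x : R) : 0 <= x <= 1 ->
  exists n, x `^ kappa^-1 <= 2 * (2 ^- n * (h n < x)%R%:R) :> R.
Proof.
move=> /andP[x0 x1]; have [->|xn0] := eqVneq x 0.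
  by exists 0%N; rewrite powR0 ?invr_eq0 ?gt_eqF// mulr_ge0// mulr_ge0// invr_ge0 exprn_ge0.
have y01 : 0 < x `^ kappa^-1 <= 1.
  by rewrite powR_gt0 ?lt_def ?xn0//= powR_le1 ?x0// invr_ge0 ltW.
have [m /andP[m1 m2]] := dyadic_bracket_le1 _ y01.
exists m.+1; rewrite scale_lt// mulrC -ltr_pdivrMr ?(andP y01).1// div1r.
rewrite (_ : (_ < _) = true)/= ?mulr1; last first.
  by rewrite invf_plt ?posrE ?(andP y01).1 ?exprn_gt0.
apply: (le_trans m2); rewrite exprSr invfM; lra.
Qed.

Definition dyadic_block (n : nat) : set R := `[(2 ^- n.+1), (2 ^- n)[%classic.

Lemma measurable_dyadic_block n : measurable (dyadic_block n).
Proof. exact: measurable_itv. Qed.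

Lemma lebesgue_dyadic_block n :
  lebesgue_measure (dyadic_block n) = (2 ^- n.+1)%:E.
Proof.
rewrite /dyadic_block lebesgue_measure_itv/= lte_fin.
have h : 2 ^- n = 2 * 2 ^- n.+1 :> R by rewrite exprSr invfM; lra.
have := exp2V_gt0 n.+1 (R := R) => h0.
by rewrite ifT; [rewrite -EFinB h; congr EFin; lra|lra].
Qed.

Lemma le_exp2V m n : (m <= n)%N -> 2 ^- n <= 2 ^- m :> R.
Proof. by move=> mn; rewrite lef_pV2 ?posrE ?exprn_gt0// ler_eXn2l//; lra. Qed.

Lemma dyadic_block_cover (x : R) : 0 < x < 1 -> exists m, dyadic_block m x.
Proof.
move=> /andP[x0 x1]; have [|[|m] /andP[]] := dyadic_bracket_le1 x; first by rewrite x0 ltW.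
  by move=> h _; exists 0%N; rewrite /dyadic_block/= in_itv/= expr0 invr1 x1 ltW.
rewrite le_eqVlt => h1 /predU1P[->|h2]; last first.
  by exists m.+1; rewrite /dyadic_block/= in_itv/= h2 ltW.
(* The bracket is closed above and open below, the block the other way round: the end point 2^-(m+1)
   belongs to the preceding block. *)
exists m; rewrite /dyadic_block/= in_itv/= lexx/=.
by rewrite ltf_pV2 ?posrE ?exprn_gt0// ltr_eXn2l//; lra.
Qed.

Lemma dyadic_block_uniq (x : R) m n : dyadic_block m x -> dyadic_block n x -> m = n.
Proof.
wlog mn : m n / (m < n)%N.
  by move=> H hm hn; have [/H|/H|//] := ltngtP m n; [exact|move=> /(_ hn hm)].
rewrite /dyadic_block/= !in_itv/= => /andP[h1 h2] /andP[h3 h4].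
by have := lt_le_trans h4 (le_exp2V _ _ mn); rewrite ltNge h1.
Qed.

Lemma dyadic_step_eq (c : nat -> \bar R) (x : R) m : (forall n, (0 <= c n)%E) ->
  dyadic_block m x -> (\sum_(n <oo) c n * (\1_(dyadic_block n) x)%:E)%E = c m.
Proof.
move=> c0 xm; rewrite (@nneseriesD1 _ (fun n => (c n * (\1_(dyadic_block n) x)%:E)%E) m)//;
  last first.
  by move=> n _; rewrite mule_ge0// lee_fin.
rewrite eseries0 ?adde0; first by rewrite indicE mem_set// mule1.
move=> n _ /andP[_ nm]; rewrite indicE memNset ?mule0// => xn.
by rewrite (dyadic_block_uniq _ _ _ xm xn) eqxx in nm.
Qed.

Lemma integral_dyadic_step (c : nat -> \bar R) : (forall n, (0 <= c n)%E) ->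
  (\int[lebesgue_measure]_(x in `]0%R, 1%R[) \sum_(n <oo) c n * (\1_(dyadic_block n) x)%:E)%E =
  (\sum_(n <oo) c n * (2 ^- n.+1)%:E)%E.
Proof.
move=> c0.
have mI n : measurable_fun (`]0, 1[%classic : set R) (fun x : R =>
  (\1_(dyadic_block n) x : R)%:E).
  by apply/measurable_EFinP; apply: measurable_indic; exact: measurable_dyadic_block.
rewrite integral_nneseries//; last 2 first.
- by move=> n; exact: (measurable_funeM (c n) (mI n)).
- by move=> n x _; rewrite mule_ge0// lee_fin.
apply: eq_eseriesr => n _; rewrite ge0_integralZl//; last exact: mI.
rewrite integral_indic//; last exact: measurable_dyadic_block.
rewrite -lebesgue_dyadic_block; congr (_ * lebesgue_measure _)%E.
apply/setIidPl => x; rewrite /dyadic_block/= !in_itv/= => /andP[h1 h2].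
rewrite (lt_le_trans (exp2V_gt0 _) h1)/= (lt_le_trans h2)//.
by have := le_exp2V 0 n (leq0n n); rewrite expr0 invr1.
Qed.

Lemma powR_dyadic_block n (x : R) : dyadic_block n x ->
  h n.+1 <= x `^ kappa <= h n.
Proof.
rewrite /dyadic_block/= in_itv/= => /andP[h1 h2].
have x0 : 0 <= x by rewrite (le_trans _ h1)// ltW// exp2V_gt0.
have i0 m : 2 ^- m \in Num.nneg by rewrite nnegrE ltW// exp2V_gt0.
by rewrite !ge0_ler_powR ?nnegrE// ltW.
Qed.

Lemma levy_tail_scale_series :
  (\sum_(n <oo) (2 ^- n)%:E * levy_tail Pi (h n))%E =
  (\int[Pi]_(x in D) \sum_(n <oo) (2 ^- n * (h n < `|x|)%R%:R : R)%:E)%E.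
Proof.
rewrite integral_nneseries//; last first.
  move=> n; apply/measurable_EFinP; apply: measurable_funM => //.
  exact: measurable_gt_normR.
apply: eq_eseriesr => n _.
rewrite levy_tailE ?ltW ?scale_gt0// -ge0_integralZl_EFin//.
- by apply: eq_integral => x _; rewrite -EFinM indic_gt_norm.
- by apply/measurable_EFinP; apply: measurable_indic; exact: measurable_gt_norm.
Qed.

(** On the n-th block the tail at u^kappa is at least the tail at h_n. One factor 2 comes from
    [power_le_indic_scale], the other from the block having length 2^-(n+1) where the series has the
    weight 2^-n. *)
Lemma levy_tail_integral_ge :
  (\int[Pi]_(x in D) (`|x| `^ kappa^-1)%:E <=
   4%:E * \int[lebesgue_measure]_(x in `]0%R, 1%R[) levy_tail Pi (x `^ kappa))%E.
Proof.
pose S (x : R) := (\sum_(n <oo) (2 ^- n * (h n < `|x|)%R%:R : R)%:E)%E.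
have t0 n (x : R) : (0 <= (2 ^- n * (h n < `|x|)%R%:R : R)%:E)%E.
  by rewrite lee_fin mulr_ge0// ltW// exp2V_gt0.
have S0 x : (0 <= S x)%E by apply: nneseries_ge0 => n _ _; exact: t0.
apply: (@le_trans _ _ (\int[Pi]_(x in D) (2%:E * S x))%E).
  apply: ge0_subfun_integral => x /unit_itvP x1; first by rewrite lee_fin powR_ge0.
  have [|n hn] := power_le_indic_scale `|x|; first by rewrite normr_ge0.
  apply: (@le_trans _ _ (2%:E * (2 ^- n * (h n < `|x|)%R%:R : R)%:E)%E).
    by rewrite -EFinM lee_fin.
  rewrite lee_wpmul2l// /S (@nneseriesD1 _ (fun n => (2 ^- n * (h n < `|x|)%R%:R : R)%:E) n)//.
  by rewrite leeDl// nneseries_ge0.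
rewrite ge0_integralZl//; last first.
  apply: ge0_emeasurable_sum => [k w _ _|k _]; first exact: t0.
  apply/measurable_EFinP; apply: measurable_funM => //.
  exact: measurable_gt_normR.
rewrite -levy_tail_scale_series (_ : 4%:E = 2%:E * 2%:E)%E; last first.
  by rewrite -EFinM; congr EFin; lra.
rewrite -muleA lee_wpmul2l//.
apply: (@le_trans _ _ (2%:E * \int[lebesgue_measure]_(x in `]0%R, 1%R[)
    \sum_(n <oo) levy_tail Pi (h n) * (\1_(dyadic_block n) x)%:E)%E).
  rewrite integral_dyadic_step; last by move=> n; exact: levy_tail_ge0.
  rewrite -nneseriesZl//; last first.
    by move=> n _; rewrite mule_ge0 ?levy_tail_ge0// lee_fin ltW// exp2V_gt0.
  apply: lee_nneseries => n _; first by rewrite mule_ge0 ?levy_tail_ge0// lee_fin ltW// exp2V_gt0.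
  rewrite [(levy_tail _ _ * _)%E]muleC muleA -EFinM exprSr invfM mulrCA divff// mulr1//.
rewrite lee_wpmul2l//; apply: ge0_subfun_integral => x xE.
  by apply: nneseries_ge0 => n _ _; rewrite mule_ge0 ?levy_tail_ge0// lee_fin.
have [|m xm] := dyadic_block_cover x; first by move: xE; rewrite /= in_itv.
rewrite (dyadic_step_eq _ _ m)//; last by move=> n; exact: levy_tail_ge0.
by apply: levy_tail_le; case/andP: (powR_dyadic_block _ _ xm).
Qed.

Lemma levy_tail_integral_le :
  (\int[lebesgue_measure]_(x in `]0%R, 1%R[) levy_tail Pi (x `^ kappa) <=
   6%:E * \int[Pi]_(x in D) (`|x| `^ kappa^-1)%:E)%E.
Proof.
apply: (@le_trans _ _ (\int[lebesgue_measure]_(x in `]0%R, 1%R[)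
    \sum_(n <oo) levy_tail Pi (h n.+1) * (\1_(dyadic_block n) x)%:E)%E).
  apply: ge0_subfun_integral => x xE; first exact: levy_tail_ge0.
  have [|m xm] := dyadic_block_cover x; first by move: xE; rewrite /= in_itv.
  rewrite (dyadic_step_eq (fun n => levy_tail Pi (h n.+1)) _ m)//; last first.
    by move=> n; exact: levy_tail_ge0.
  by apply: levy_tail_le; case/andP: (powR_dyadic_block _ _ xm).
rewrite (integral_dyadic_step (fun n => levy_tail Pi (h n.+1))); last first.
  by move=> n; exact: levy_tail_ge0.
have t0 n (x : R) : (0 <= (2 ^- n.+1 * (h n.+1 < `|x|)%R%:R : R)%:E)%E.
  by rewrite lee_fin mulr_ge0// ltW// exp2V_gt0.
have mI n : measurable_fun D (fun x : R => ((h n.+1 < `|x|)%R%:R : R)%:E).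
  by apply/measurable_EFinP; exact: measurable_gt_normR.
apply: (@le_trans _ _ (\int[Pi]_(x in D) \sum_(n <oo)
  (2 ^- n.+1 * (h n.+1 < `|x|)%R%:R : R)%:E)%E).
  rewrite integral_nneseries//; last by move=> n; exact: (measurable_funeM (2 ^- n.+1)%:E (mI n)).
  rewrite le_eqVlt; apply/orP; left; apply/eqP; apply: eq_eseriesr => n _.
  under eq_integral do rewrite EFinM.
  rewrite ge0_integralZl//.
  rewrite levy_tailE ?ltW ?scale_gt0// muleC; congr (_ * _)%E.
  by apply: eq_integral => x _; rewrite indic_gt_norm.
rewrite -ge0_integralZl_EFin//; last first.
  by apply/measurable_EFinP; exact: measurable_levy_power.
apply: ge0_subfun_integral => x _; first by apply: nneseries_ge0.
rewrite -EFinM; apply: nneseries_le_fin => [n|N]; first by rewrite -lee_fin t0.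
exact: sum_indic_scale_le.
Qed.

End tail_integral.

(** * Ottaviani's inequality *)

Section ottaviani.
Context d (T : measurableType d) (R : realType) (P : probability T R).
Variable X : R -> {RV P >-> R}.
Hypothesis X_levy : levy_process X.
Implicit Types u v a : R.

Definition increment u (i : nat) (w : T) : R := X (i.+1%:R * u) w - X (i%:R * u) w.

(** Rectangles in the first [j] increments: the events on which [levy_process] gives independence
    directly, and a pi-system generating the past up to step [j]. *)
Definition increment_boxes u (j : nat) : set (set T) :=
  [set A | exists2 B : nat -> set R, (forall i, measurable (B i)) &
    A = \bigcap_(i in `I_j) (increment u i @^-1` B i)].

Lemma measurable_increment u i : measurable_fun setT (increment u i).
Proof. exact: measurable_funB. Qed.

Lemma increment_boxes_measurable u j : increment_boxes u j `<=` measurable.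
Proof.
move=> _ [B mB ->]; apply: bigcap_measurableType => // i _.
by rewrite -[X in measurable X]setTI; exact: measurable_increment.
Qed.

Lemma bigcap_ordE j (F : nat -> set T) :
  \bigcap_(i in `I_j) F i = \bigcap_(i in [set: 'I_j]) F i.
Proof.
apply/seteqP; split => w h i; first by move=> _; apply: h => /=.
by move=> ij; exact: (h (Ordinal ij)).
Qed.

Lemma boxes_independent u v j (A : set T) (C : set R) : 0 <= u -> j%:R * u <= v ->
  measurable C -> increment_boxes u j A ->
  P (A `&` (fun w => X v w - X (j%:R * u) w) @^-1` C) =
  (P A * P ((fun w => X v w - X (j%:R * u) w)%R @^-1` C))%E.
Proof.
move=> u0 jv mC [B mB ->].
(* The grid up to step [j], then [v] for ever: the first [j] increments along [t] are those of the
   grid, and the next one is [X v - X (j u)]. *)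
pose t i := if (i <= j)%N then i%:R * u else v.
have t0 : 0 <= t 0%N by rewrite /t mul0r.
have tle i : t i <= t i.+1.
  rewrite /t; case: (leqP i.+1 j) => ij.
    by rewrite (ltnW ij) ler_wpM2r// ler_nat.
  case: (leqP i j) => // ij'; suff -> : i = j by [].
  by apply/eqP; rewrite eqn_leq ij' -ltnS ij.
have ind n := @levy_indep _ _ _ _ _ X_levy n t t0 (fun i _ => tle i).
have Pj : P (\bigcap_(i in `I_j) (increment u i @^-1` B i)) =
    (\prod_(i < j) P (increment u i @^-1` B i))%E.
  rewrite bigcap_ordE; transitivity (P (\bigcap_(i in [set: 'I_j])
    ((fun w => X (t i.+1) w - X (t i) w) @^-1` B i))).
    congr (P _); apply: eq_bigcapr => i _; rewrite /increment /t.
    by rewrite ltn_ord (ltnW (ltn_ord i)).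
  rewrite (ind j (fun i => B i) (fun i => mB i)); apply: eq_bigr => i _.
  by congr (P _); rewrite /increment /t ltn_ord (ltnW (ltn_ord i)).
rewrite Pj.
pose B' (i : nat) := if (i < j)%N then B i else C.
have mB' i : measurable (B' i) by rewrite /B'; case: ifP.
transitivity (P (\bigcap_(i in [set: 'I_j.+1]) ((fun w => X (t i.+1) w - X (t i) w) @^-1` B' i))).
  congr (P _); rewrite -(bigcap_ordE j.+1
    (fun i => (fun w => X (t i.+1) w - X (t i) w) @^-1` B' i)).
  apply/seteqP; split => w /=.
    move=> [wB wC] i /=; rewrite ltnS leq_eqVlt /B' /t => /predU1P[->|ij].
      by rewrite ltnn leqnn.
    by rewrite ij (ltnW ij); exact: (wB i ij).
  move=> h; split => [i /= ij|].
    by have := h i (ltnW ij : (i < j.+1)%N); rewrite /B' /t/= ij (ltnW ij).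
  by have := h j (ltnSn j); rewrite /B' /t/= ltnn leqnn.
rewrite (ind j.+1 (fun i => B' i) (fun i => mB' i)) big_ord_recr/=; congr (_ * _)%E.
  apply: eq_bigr => i _; rewrite /B' /t ltn_ord (ltnW (ltn_ord i)) //.
by rewrite /B' /t ltnn leqnn.
Qed.

Lemma increment_boxes_setI u j : setI_closed (increment_boxes u j).
Proof.
move=> _ _ [B mB ->] [C mC ->]; exists (fun i => B i `&` C i).
  by move=> i; exact: measurableI.
by apply/seteqP; split => w /= => [[h1 h2] i ij|h]; [split; [exact: h1|exact: h2]|
  split => i ij; have [] := h i ij].
Qed.

(** For a fixed event E of the later increment, the finite measures A |-> P(A and E) and A |-> P(A)
    P(E) agree on the rectangles, hence on the sigma-algebra these generate. *)
Lemma sigma_boxes_independent u v j (A : set T) (C : set R) : 0 <= u -> j%:R * u <= v ->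
  measurable C -> <<s increment_boxes u j >> A ->
  P (A `&` (fun w => X v w - X (j%:R * u) w) @^-1` C) =
  (P A * P ((fun w => X v w - X (j%:R * u) w)%R @^-1` C))%E.
Proof.
move=> u0 jv mC sA; set E := _ @^-1` C.
have mE : measurable E.
  by rewrite -[X in measurable X]setTI; apply: measurable_funB.
have PEf : P E \is a fin_num by exact: fin_num_measure.
have p0 : 0 <= fine (P E) by rewrite fine_ge0.
pose m1 : {measure set T -> \bar R} := mrestr P mE.
pose m2 : {measure set T -> \bar R} := mscale (NngNum p0) P.
have m2E B : m2 B = (P B * P E)%E by rewrite /m2 /= /mscale/= fineK// muleC.
have HG : [set Y | increment_boxes u j Y /\ Y `<=` setT] = increment_boxes u j.
  by apply/seteqP; split => [Y []//|Y hY]; split.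
suff : m1 A = m2 A by rewrite m2E.
have gT : increment_boxes u j setT.
  by exists (fun=> setT) => //; apply/seteqP; split.
apply: (@g_sigma_algebra_measure_unique_trace _ _ _ (increment_boxes u j) setT measurableT);
  rewrite ?HG.
- exact: increment_boxes_measurable.
- exact: increment_boxes_setI.
- by rewrite m2E; exact: boxes_independent.
- by move=> B hB; rewrite m2E; exact: boxes_independent.
- by rewrite /m1/= /mrestr setTI ltey_eq PEf.
- by [].
- by [].
Qed.

Lemma measurable_increment_boxes u i j : (i < j)%N ->
  @measurable_fun _ _ (g_sigma_algebraType (increment_boxes u j)) R setT (increment u i).
Proof.
move=> ij _ B mB; rewrite setTI; apply: sub_gen_smallest.
exists (fun k => if k == i then B else setT).
  by move=> k; case: ifP.
apply/seteqP; split => w /=.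
  by move=> wB k kj /=; case: ifP => // /eqP ->.
by move=> /(_ i ij); rewrite /= eqxx.
Qed.

Lemma measurable_walk_boxes u i j : (i <= j)%N ->
  @measurable_fun _ _ (g_sigma_algebraType (increment_boxes u j)) R setT
    (fun w => X (i%:R * u) w - X 0 w).
Proof.
elim: i => [|i IH] ij.
  by rewrite (_ : (fun w => _) = fun=> 0)//; apply/funext => w; rewrite mul0r subrr.
rewrite (_ : (fun w => _) = (fun w => (X (i%:R * u) w - X 0 w) + increment u i w)).
  by apply: measurable_funD; [apply: IH; exact: ltnW|exact: measurable_increment_boxes].
by apply/funext => w; rewrite /increment; ring.
Qed.

Lemma levy_increment_law (s t : R) (B : set R) : 0 <= s -> s <= t -> measurable B ->
  P ((fun w => X t w - X s w) @^-1` B) = P (X (t - s) @^-1` B).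
Proof. by move=> s0 st mB; exact: (levy_stationary X_levy). Qed.

(** The union is split according to the first index m at which 2a is exceeded. That event belongs to
    the past of step m, so it is independent of the increment from m to n, which stays within a with
    probability at least 1/2; on both events the walk is beyond a at step n. The walk is measured
    from [X 0], because the past is generated by increments. *)
Lemma ottaviani u a n : 0 <= u ->
  (forall i, (i <= n)%N -> (P [set w | (a < `|X (i%:R * u) w|)%R] <= (2^-1)%:E)%E) ->
  (P (\bigcup_(i in `I_n.+1) [set w | (2 * a < `|X (i%:R * u) w - X 0 w|)%R]) <=
   2%:E * P [set w | (a < `|X (n%:R * u) w|)%R])%E.
Proof.
move=> u0 hP.
pose F i := [set w | 2 * a < `|X (i%:R * u) w - X 0 w|].
pose G := [set x : R | a < `|x|].
have mG : measurable G by exact: measurable_gt_norm.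
pose En := (fun w => X (n%:R * u) w - X 0 w) @^-1` G.
have mF i : measurable (F i).
  rewrite -[X in measurable X]setTI.
  have : measurable_fun setT (fun w => X (i%:R * u) w - X 0 w) by exact: measurable_funB.
  by move=> /(_ measurableT _ (measurable_gt_norm (2 * a))).
have mEn : measurable En.
  by rewrite -[X in measurable X]setTI; apply: measurable_funB.
have sF i j : (i <= j)%N -> <<s increment_boxes u j >> (F i).
  move=> ij; have := measurable_walk_boxes u _ _ ij.
  move=> /(_ measurableT _ (measurable_gt_norm (2 * a))).
  by rewrite setTI.
have mU m : measurable (\big[setU/set0]_(i < m) F i) by apply: bigsetU_measurable.
have key m : (m <= n.+1)%N ->
    (P (\big[setU/set0]_(i < m) F i) <= 2%:E * P (\big[setU/set0]_(i < m) F i `&` En))%E.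
  elim: m => [|m IH] mn; first by rewrite big_ord0 measure0 mule_ge0.
  rewrite big_ord_recr/=; set U := \big[setU/set0]_(i < m) F i.
  have -> : U `|` F m = U `|` (F m `\` U).
    by apply/seteqP; split => w /=; have [?|?] := pselect (U w); tauto.
  have mD : d.-measurable (F m `\` U) by exact: (measurableD (mF m) (mU m)).
  have dis : U `&` (F m `\` U) = set0 by apply/seteqP; split => w //= [? []].
  have e1 : P (U `|` F m `\` U) = (P U + P (F m `\` U))%E by apply: measureU => //; exact: mU.
  have e2 : P ((U `|` F m `\` U) `&` En) = (P (U `&` En) + P ((F m `\` U) `&` En))%E.
    rewrite setIUl; apply: measureU.
    - exact: (measurableI _ _ (mU m) mEn).
    - exact: (measurableI _ _ mD mEn).
    - by apply/seteqP; split => w //= [[? _] [[]]].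
  rewrite e1 e2.
  rewrite ge0_muleDr//; apply: leeD; first exact/IH/ltnW.
  have sD : <<s increment_boxes u m >> (F m `\` U).
    have : @measurable _ (g_sigma_algebraType (increment_boxes u m)) (F m `\` U).
      apply: measurableD; first exact: sF.
      by apply: bigsetU_measurable => i _; apply: sF; exact: ltnW.
    by [].
  pose H := (fun w => X (n%:R * u) w - X (m%:R * u) w) @^-1` [set x | `|x| <= a].
  have mC : measurable [set x : R | `|x| <= a].
    rewrite (_ : [set x | _] = ~` G); first exact: measurableC.
    by apply/seteqP; split => x /=; rewrite /G/= leNgt => /negP.
  have mH : measurable H by rewrite -[X in measurable X]setTI; apply: measurable_funB.
  have mnu : m%:R * u <= n%:R * u by rewrite ler_wpM2r// ler_nat -ltnS.
  have PH : ((2^-1)%:E <= P H)%E.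
    rewrite /H levy_increment_law ?mulr_ge0// -mulrBl -natrB//.
    have mX : measurable (X ((n - m)%:R * u) @^-1` G).
      by rewrite -[X in measurable X]setTI; exact: measurable_funP.
    rewrite (_ : _ @^-1` _ = ~` (X ((n - m)%:R * u) @^-1` G)); last first.
      by apply/seteqP; split => w /=; rewrite /G/= leNgt => /negP.
    rewrite probability_setC// leeBrDl ?fin_num_measure//.
    apply: (@le_trans _ _ ((2^-1)%:E + (2^-1)%:E)%E).
      by rewrite leeD2r//; apply: hP; exact: leq_subr.
    by rewrite -EFinD lee_fin; lra.
  have : (P ((F m `\` U) `&` H) <= P ((F m `\` U) `&` En))%E.
    apply: le_measure; rewrite ?inE; [exact: measurableI..|].
    move=> w [[Fm nU] Hw]; split; first by split.
    rewrite /En /G /=; move: Fm Hw; rewrite /F /H /= => h1 h2.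
    have : `|X (m%:R * u) w - X 0 w| <=
        `|X (n%:R * u) w - X 0 w| + `|X (n%:R * u) w - X (m%:R * u) w|.
      rewrite -[X in _ <= _ + X]normrN; apply: le_trans (ler_normD _ _).
      by rewrite le_eqVlt; apply/orP; left; apply/eqP; congr (`|_|); ring.
    by lra.
  rewrite (sigma_boxes_independent u _ m)//.
  move=> h; apply: le_trans (lee_wpmul2l _ h) => //.
  rewrite muleCA -[leLHS]mule1 lee_wpmul2l//.
  apply: (@le_trans _ _ (2%:E * (2^-1)%:E)%E); first by rewrite -EFinM lee_fin; lra.
  by rewrite lee_wpmul2l.
rewrite bigcup_mkord; apply: (le_trans (key n.+1 (leqnn _))).
rewrite lee_wpmul2l//.
have -> : P [set w | a < `|X (n%:R * u) w|] = P En.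
  have nu : 0 <= n%:R * u by rewrite mulr_ge0.
  by rewrite /En levy_increment_law// subr0.
by apply: le_measure; rewrite ?inE//; exact: measurableI.
Qed.

End ottaviani.

(** * Small-time convergence *)

Section paths.
Context {R : realType}.
Implicit Types (f : R -> R) (t b : R).

(** If |f t| > [b], right continuity keeps the inequality just to the right of [t], where a fine
    enough dyadic point lies; [t] < 2^-n leaves room for that point within [0, 2^-n]. *)
Lemma right_dyadic_bound f t b n : f s @[s --> t^'+] --> f t -> 0 <= t < 2 ^- n ->
  (forall k i, (i <= 2 ^ k)%N -> `|f (i%:R * 2 ^- (n + k))| <= b) -> `|f t| <= b.
Proof.
move=> ft /andP[t0 tn] fb; rewrite leNgt; apply/negP => bf.
have : \forall s \near t^'+, b < `|f s|.
  have /cvg_norm := ft => ft'.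
  by have := cvgr_gt _ ft' _ bf; apply.
rewrite near_withinE => /nbhs_ballP[e /= e0 he].
have [K Ke] : exists K, 2 ^- K < e.
  have e1 : 0 < Num.min e 1 <= 1 by rewrite lt_min e0 ltr01 ge_min lexx orbT.
  have [K /andP[hK _]] := dyadic_bracket_le1 _ e1.
  by exists K.+1; apply: (lt_le_trans hK); rewrite ge_min lexx.
pose i := (Num.truncn (t * 2 ^+ (n + K))).+1.
have p0 : 0 < 2 ^+ (n + K) :> R by rewrite exprn_gt0.
have /andP[h1 h2] : (Num.truncn (t * 2 ^+ (n + K)))%:R <= t * 2 ^+ (n + K) < i%:R.
  by apply: truncn_itv; rewrite mulr_ge0// ltW.
have ile : (i <= 2 ^ K)%N.
  rewrite /i -(@ltr_nat R) (le_lt_trans h1)//.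
  rewrite exprD mulrA natrX -[ltRHS]mul1r ltr_pM2r ?exprn_gt0//.
  by rewrite -ltr_pdivlMr ?exprn_gt0// div1r.
have := fb K i ile; apply/negP; rewrite -ltNge.
have ti : t < i%:R * 2 ^- (n + K) by rewrite ltr_pdivlMr.
apply: he => //=; rewrite /ball/= ltr_distlC; apply/andP; split; first lra.
have : i%:R * 2 ^- (n + K) <= t + 2 ^- (n + K).
  by rewrite ler_pdivrMr// mulrDl mulVf ?gt_eqF// /i -natr1 lerD2r.
have : 2 ^- (n + K) <= 2 ^- K :> R.
  by rewrite lef_pV2 ?posrE ?exprn_gt0// ler_eXn2l ?leq_addl//; lra.
lra.
Qed.

(** On the block [2^-(n+1), 2^-n) the denominator t^kappa is at least h_(n+1), so passing from h_n
    to t^kappa costs a factor 2^kappa. *)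
Lemma powR_cvg0_from_dyadic (kappa : R) f : 0 < kappa ->
  (forall t, 0 <= t -> f s @[s --> t^'+] --> f t) ->
  (forall j : nat, \forall n \near \oo, forall k i, (i <= 2 ^ k)%N ->
     `|f (i%:R * 2 ^- (n + k))| <= j.+1%:R^-1 * scale kappa n) ->
  f t / t `^ kappa @[t --> 0^'+] --> (0 : R).
Proof.
move=> k0 fr fb; apply/cvgrPdist_le => e e0.
have c0 : 0 < 2 `^ kappa by rewrite powR_gt0.
have [j hj] : exists j : nat, j.+1%:R^-1 * 2 `^ kappa <= e.
  exists (Num.truncn (2 `^ kappa / e)).
  rewrite mulrC ler_pdivrMr ?ltr0n// mulrC -ler_pdivrMr// ltW//.
  by case/andP: (truncn_itv (ltW (divr_gt0 c0 e0))).
have [n0 _ hn0] := fb j.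
near=> t.
have t0 : 0 < t by near: t; exact: nbhs_right_gt.
have t1 : t < 2 ^- n0 by near: t; apply: nbhs_right_lt; rewrite exp2V_gt0.
have tlt1 : 0 < t < 1.
  by rewrite t0 (lt_le_trans t1)//; have := @le_exp2V R 0 n0 (leq0n _); rewrite expr0 invr1.
have [n tn] := dyadic_block_cover t tlt1.
have n0n : (n0 <= n)%N.
  rewrite leqNgt; apply/negP => nn0; move: tn; rewrite /dyadic_block/= in_itv/= => /andP[tn _].
  by have := le_trans (@le_exp2V R _ _ nn0) tn; rewrite leNgt t1.
move: (tn); rewrite /dyadic_block/= in_itv/= => /andP[tn1 tn2].
have ft : `|f t| <= j.+1%:R^-1 * scale kappa n.
  apply: (@right_dyadic_bound f t _ n); first by apply: fr; exact: ltW.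
    by rewrite ltW.
  by move=> k i ik; exact: hn0.
have tk0 : 0 < t `^ kappa by rewrite powR_gt0.
rewrite sub0r normrN normrM normfV (gtr0_norm tk0) ler_pdivrMr//.
apply: (le_trans ft).
have : scale kappa n = 2 `^ kappa * scale kappa n.+1.
  rewrite /scale -powRM//.
  by rewrite exprS invfM mulrA divff ?mul1r.
move=> ->; rewrite mulrA.
have : scale kappa n.+1 <= t `^ kappa.
  by rewrite ge0_ler_powR ?nnegrE// ?ltW// exp2V_gt0.
have s0 := @scale_gt0 R kappa n.+1.
have j0 : 0 <= j.+1%:R^-1 * 2 `^ kappa by rewrite mulr_ge0// ltW.
by move=> h; apply: ler_pM => //; exact: ltW.
Unshelve. all: by end_near. Qed.

End paths.

Lemma nneseries_near_le {R : realType} (f : nat -> \bar R) (e : R) :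
  (forall n, (0 <= f n)%E) -> (\sum_(n <oo) f n < +oo)%E -> 0 < e ->
  \forall n \near \oo, (f n <= e%:E)%E.
Proof.
move=> f0 fs e0.
have /fine_cvgP[fin cv] := nneseries_tail_cvg fs (fun k _ => f0 k).
have cv' : \forall n \near \oo, fine (\sum_(n <= k <oo) f k)%E < e by exact: (cvgr_lt _ cv).
near=> n.
apply: (@le_trans _ _ (\sum_(n <= k <oo) f k)%E).
  have := @nneseries_lim_ge R f xpredT n n.+1 (fun k _ _ => f0 k).
  by rewrite big_nat1.
rewrite -(@fineK _ (\sum_(n <= k <oo) f k)%E); last by near: n.
by rewrite lee_fin ltW//; near: n.
Unshelve. all: by end_near. Qed.

Lemma nneseries_shift_lty {R : realType} (f : nat -> \bar R) (c : R) N : 0 <= c ->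
  (forall n, (0 <= f n)%E) -> (\sum_(n <oo) f n < +oo)%E ->
  (\sum_(n <oo) c%:E * f (n + N)%N < +oo)%E.
Proof.
move=> c0 f0 fs.
rewrite (@nneseriesZl R (fun n => f (n + N)%N) xpredT c 0)//.
rewrite lte_mul_pinfty// (nneseries_addn N f0).
apply: le_lt_trans fs.
rewrite [leRHS](@nneseries_split _ f 0 N)// add0n leeDr//.
exact: sume_ge0.
Qed.

Section small_time.
Context d (T : measurableType d) (R : realType) (P : probability T R).
Variables (X : R -> {RV P >-> R}) (gamma : R) (Pi : {measure set R -> \bar R}) (kappa : R).
Hypothesis X_levy : levy_process X.
Hypothesis X_triplet : levy_triplet X gamma 0 Pi.
Hypothesis kappa_gt : 1 / 2 < kappa.
Local Notation D := (`[-1, 1]%classic : set R).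
Local Notation h := (scale kappa).
Local Notation eta := ((2 * kappa)^-1).
Hypothesis J_fin : (\int[Pi]_(x in D) (`|x| `^ kappa^-1)%:E < +oo)%E.
(** Isolated because kappa < 1 and kappa >= 1 reach it by different arguments; the rest of the proof
    of convergence is common to both. *)
Hypothesis center_small : forall e, 0 < e ->
  \forall n \near \oo, 2 ^- n * `|levy_center Pi gamma (h n)| <= e * h n.

Let k0 : 0 < kappa. Proof. by move: kappa_gt; lra. Qed.

Let eta01 : 0 < eta <= 1.
Proof.
move: kappa_gt => k; rewrite invr_gt0 mulr_gt0//= invf_le1 ?mulr_gt0//; lra.
Qed.

Let mD : measurable D. Proof. exact: measurable_itv. Qed.

Definition tail_mass n : \bar R := (\int[Pi]_(x in D) (tail_weight eta (`|x| / h n))%:E)%E.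

Lemma tail_mass_ge0 n : (0 <= tail_mass n)%E.
Proof. by apply: integral_ge0 => x _; rewrite lee_fin tail_weight_ge0. Qed.

Lemma tail_mass_series : (\sum_(n <oo) (2 ^- n)%:E * tail_mass n < +oo)%E.
Proof.
have mU n : measurable_fun D (fun x => tail_weight eta (`|x| / h n)).
  apply: measurable_funTS; apply: measurableT_comp; first exact: measurable_tail_weight.
  exact: measurable_funM.
apply: (@le_lt_trans _ _ ((scale_const kappa)%:E * \int[Pi]_(x in D) (`|x| `^ kappa^-1)%:E)%E).
  under eq_eseriesr.
    move=> n _; rewrite -ge0_integralZl_EFin ?(ltW (exp2V_gt0 n))//; last 2 first.
    - by move=> x _; rewrite lee_fin tail_weight_ge0.
    - exact/measurable_EFinP.
    over.
  rewrite -integral_nneseries//; last 2 first.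
  - by move=> n; apply: measurable_funeM; exact/measurable_EFinP.
  - by move=> n x _; rewrite mule_ge0 ?lee_fin ?tail_weight_ge0// ltW// exp2V_gt0.
  have C0 := scale_const_ge0 _ kappa_gt.
  rewrite -ge0_integralZl_EFin//; last first.
    by apply/measurable_EFinP; exact: measurable_levy_power.
  apply: ge0_subfun_integral => x _.
    by apply: nneseries_ge0 => n _ _;
      rewrite mule_ge0 ?lee_fin ?tail_weight_ge0// ltW// exp2V_gt0.
  under eq_eseriesr do rewrite -EFinM.
  rewrite -EFinM; apply: nneseries_le_fin => [n|N].
    by rewrite mulr_ge0 ?tail_weight_ge0// ltW// exp2V_gt0.
  exact: sum_tail_weight_le.
by rewrite lte_mul_pinfty// lee_fin scale_const_ge0.
Qed.

Section eps.
Variable eps : R.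
Hypothesis eps0 : 0 < eps.

Let bound n : \bar R := ((16 * tail_const eps eta)%:E * ((2 ^- n)%:E * tail_mass n))%E.

Let tc0 : 0 <= tail_const eps eta.
Proof. by apply: tail_const_ge0 => //; case/andP: eta01. Qed.

(** One [eps] pays for the fluctuation around s c_n, the other for s c_n itself, which is at most
    2^-n |c_n| in absolute value. *)
Lemma small_time_bound_near : \forall n \near \oo, forall s, 0 <= s <= 2 ^- n ->
  (P [set w | (2 * eps * h n < `|X s w|)%R] <= bound n)%E.
Proof.
near=> n => s /andP[s0 sn].
have hn0 := @scale_gt0 R kappa n.
have cs : 2 ^- n * `|levy_center Pi gamma (h n)| <= eps * h n.
  by near: n; exact: center_small.
have mA c a : measurable [set w | a < `|X s w - c|].
  rewrite -[X in measurable X]setTI.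
  have : measurable_fun setT (fun w => X s w - c) by exact: measurable_funB.
  by move=> /(_ measurableT _ (measurable_gt_norm a)).
apply: (@le_trans _ _ (P [set w | (eps * h n < `|X s w - s * levy_center Pi gamma (h n)|)%R])).
  apply: le_measure; rewrite ?inE; [|exact: mA|].
    by have := mA 0 (2 * eps * h n); under eq_set do rewrite subr0.
  move=> w /=.
  have : `|X s w| <=
      `|X s w - s * levy_center Pi gamma (h n)| + `|s * levy_center Pi gamma (h n)|.
    by rewrite -{1}(subrK (s * levy_center Pi gamma (h n)) (X s w)) ler_normD.
  have : `|s * levy_center Pi gamma (h n)| <= eps * h n.
    by rewrite normrM (ger0_norm s0) (le_trans _ cs)// ler_wpM2r.
  lra.
apply: (le_trans (@levy_tail_bound _ _ _ _ _ _ _ X_triplet s (h n) eps eta s0 hn0 eps0 eta01)).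
rewrite /bound muleA -EFinM lee_wpmul2r ?tail_mass_ge0// lee_fin.
by rewrite mulrAC ler_wpM2l// mulr_ge0.
Unshelve. all: by end_near. Qed.

(** Exceedance at some dyadic time of [0, 2^-n], level by level. The factor 4 is the 2 of
    [small_time_bound_near] times the 2 of Ottaviani's inequality. *)
Definition exceedance n : set T := \bigcup_k \bigcup_(i in `I_(2 ^ k).+1)
  [set w | 4 * eps * h n < `|X (i%:R * 2 ^- (n + k)) w - X 0 w|].

Let mX s a : measurable [set w | a < `|X s w - X 0 w|].
Proof.
rewrite -[X in measurable X]setTI.
have : measurable_fun setT (fun w => X s w - X 0 w) by exact: measurable_funB.
by move=> /(_ measurableT _ (measurable_gt_norm a)).
Qed.

Lemma measurable_exceedance n : measurable (exceedance n).
Proof.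
by apply: bigcupT_measurable => k; apply: bigcup_measurable => i _; exact: mX.
Qed.

Let b0 n : (0 <= bound n)%E.
Proof.
by rewrite mule_ge0// ?mule_ge0 ?tail_mass_ge0// lee_fin ?mulr_ge0// ltW// exp2V_gt0.
Qed.

Let bs : (\sum_(n <oo) bound n < +oo)%E.
Proof.
rewrite nneseriesZl//; last first.
  by move=> n _; rewrite mule_ge0 ?tail_mass_ge0// lee_fin ltW// exp2V_gt0.
by rewrite lte_mul_pinfty ?tail_mass_series// lee_fin mulr_ge0.
Qed.

(** Ottaviani's inequality bounds each level by a quantity free of the level, and the levels are
    nested, so the bound survives their union. Its condition, marginal probabilities of at most 1/2,
    holds for large n because the terms of a convergent series tend to 0. *)
Lemma exceedance_bound_near :
  \forall n \near \oo, (P (exceedance n) <= 2%:E * bound n)%E.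
Proof.
have bsmall : \forall n \near \oo, (bound n <= (2^-1)%:E)%E.
  by apply: nneseries_near_le => //; rewrite invr_gt0.
near=> n.
have hb : forall s, 0 <= s <= 2 ^- n ->
  (P [set w | (2 * eps * h n < `|X s w|)%R] <= bound n)%E.
  by near: n; exact: small_time_bound_near.
have b12 : (bound n <= (2^-1)%:E)%E by near: n.
pose A k := \bigcup_(i in `I_(2 ^ k).+1)
  [set w | 4 * eps * h n < `|X (i%:R * 2 ^- (n + k)) w - X 0 w|].
have mA k : measurable (A k) by apply: bigcup_measurable => i _; exact: mX.
have Ale k : (P (A k) <= 2%:E * bound n)%E.
  have u0 : 0 <= 2 ^- (n + k) :> R by rewrite ltW// exp2V_gt0.
  have iu i : (i <= 2 ^ k)%N -> 0 <= (i%:R : R) * 2 ^- (n + k) <= 2 ^- n.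
    move=> ik; rewrite mulr_ge0//= exprD invfM mulrCA ler_piMr ?(ltW (exp2V_gt0 _))//.
    by rewrite ler_pdivrMr ?exprn_gt0// mul1r -natrX ler_nat.
  have := @ottaviani _ _ _ _ _ X_levy (2 ^- (n + k)) (2 * eps * h n) (2 ^ k) u0.
  rewrite (_ : 2 * (2 * eps * h n) = 4 * eps * h n); last by ring.
  move=> /(_ _)/le_trans; apply.
    by move=> i ik; apply: (le_trans (hb _ (iu _ ik))).
  by rewrite lee_wpmul2l//; apply: hb; exact: iu.
have ndA : nondecreasing_seq A.
  apply/nondecreasing_seqP => k; apply/subsetPset => w [i /= ik Xw].
  exists (2 * i)%N => /=; first by rewrite ltnS expnS leq_mul2l/= -ltnS.
  rewrite (_ : (2 * i)%:R * 2 ^- (n + k.+1) = i%:R * 2 ^- (n + k))//.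
  by rewrite addnS exprS natrM; field; rewrite expf_neq0.
have cvA : P (A k) @[k --> \oo] --> P (exceedance n).
  apply: nondecreasing_cvg_mu => //; exact: measurable_exceedance.
rewrite -(cvg_lim _ cvA)//; apply: lime_le.
  by apply/cvg_ex; eexists; exact: cvA.
exact: nearW.
Unshelve. all: by end_near. Qed.

Lemma exceedance_finite_ae :
  {ae P, forall w, \forall n \near \oo, ~ exceedance n w}.
Proof.
have [N _ hN] := exceedance_bound_near.
pose F m := exceedance (m + N).
have mF m : measurable (F m) by exact: measurable_exceedance.
have Fs : (\sum_(m <oo) P (F m) < +oo)%E.
  apply: (@le_lt_trans _ _ (\sum_(m <oo) 2%:E * bound (m + N)%N)%E).
    by apply: lee_nneseries => // m _; apply: hN => /=; exact: leq_addl.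
  exact: nneseries_shift_lty.
have := lim_sup_set_cvg0 mF Fs => L0.
exists (lim_sup_set F); split => //.
  by apply: bigcapT_measurable => n; apply: bigcup_measurable.
move=> w /= nE; apply: contrapT => nL; apply: nE.
have [n hn] : exists n, forall m, (n <= m)%N -> ~ F m w.
  apply: contrapT => H; apply: nL => n _; apply: contrapT => H'; apply: H.
  by exists n => m nm Fm; apply: H'; exists m.
exists (n + N)%N => // m /= nm.
have Nm := leq_trans (leq_addl n N) nm.
by rewrite -(subnK Nm); apply: hn; rewrite leq_subRL// addnC.
Qed.

End eps.

Lemma small_time_convergence :
  {ae P, forall w, X t w / t `^ kappa @[t --> 0^'+] --> (0 : R)}.
Proof.
have e0 (j : nat) : 0 < j.+1%:R^-1 / 4 :> R by rewrite divr_gt0// invr_gt0.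
have ex : {ae P, forall w, forall j : nat,
    \forall n \near \oo, ~ exceedance (j.+1%:R^-1 / 4) n w}.
  by apply: ae_foralln => j; exact: exceedance_finite_ae.
apply: filterS3 (levy_start X_levy) (levy_cadlag X_levy) ex => w X0 [Xr _] Xe.
apply: powR_cvg0_from_dyadic => // j.
apply: filterS (Xe j) => n nE k i ik.
rewrite leNgt; apply/negP => lt; apply: nE; exists k => //; exists i => //=.
by rewrite X0 subr0 (_ : 4 * _ = j.+1%:R^-1)// mulrCA divff ?mulr1.
Qed.

End small_time.

(** * Smallness of the centring drift *)

Section center.
Context {R : realType}.
Variables (Pi : {measure set R -> \bar R}) (kappa gamma : R).
Hypothesis hPi : levy_measure Pi.
Hypothesis kappa_gt : 1 / 2 < kappa.
Local Notation D := (`[-1, 1]%classic : set R).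
Local Notation h := (scale kappa).
Hypothesis J_fin : (\int[Pi]_(x in D) (`|x| `^ kappa^-1)%:E < +oo)%E.

Let k0 : 0 < kappa. Proof. by move: kappa_gt; lra. Qed.
Let mD : measurable D. Proof. exact: measurable_itv. Qed.
Let h0 n : 0 < h n. Proof. exact: scale_gt0. Qed.

Lemma integrable_levy_power : Pi.-integrable D (EFin \o (fun x => `|x| `^ kappa^-1)).
Proof.
apply/integrableP; split; first by apply/measurable_EFinP; exact: measurable_levy_power.
by under eq_integral do rewrite /= ger0_norm ?powR_ge0//.
Qed.

Lemma dominated_vanish (g : nat -> R -> R) :
  (forall n, measurable_fun D (g n)) ->
  (forall n x, `|x| <= 1 -> 0 <= g n x <= `|x| `^ kappa^-1) ->
  (forall x, `|x| <= 1 -> g n x @[n --> \oo] --> 0) ->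
  forall e, 0 < e -> \forall n \near \oo, \int[Pi]_(x in D) g n x <= e.
Proof.
move=> mg gb g0 e e0.
have [|||||_ _ cv] := @dominated_convergence _ _ R Pi D mD (fun n x => (g n x)%:E) (fun=> 0%E)
  (EFin \o (fun x => `|x| `^ kappa^-1)).
- by move=> n; apply/measurable_EFinP; exact: mg.
- exact: measurable_cst.
- by apply: aeW => x /unit_itvP x1; apply: cvg_EFin; [exact: nearW|exact: g0].
- exact: integrable_levy_power.
- apply: aeW => x n /unit_itvP x1 /=; rewrite lee_fin ger0_norm; last by case/andP: (gb n x x1).
  by case/andP: (gb n x x1).
move: cv; rewrite integral0 => /fine_cvgP[_ cv].
have cv' : \forall n \near \oo, fine (\int[Pi]_(x in D) (g n x)%:E)%E < e
  by exact: (cvgr_lt _ cv).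
by apply: filterS cv' => n; exact: ltW.
Qed.

(** In the variable w = 2^n x^(1/kappa) the claim reads w^kappa <= w: true for w <= 1 when kappa >=
    1, and for w > 1 when kappa < 1. Accordingly the small jumps are dominated in the first case and
    the large ones in the second. *)
Lemma scale_domination (x : R) n : 0 <= x ->
  (1 <= kappa -> x <= h n) -> (kappa < 1 -> h n < x) ->
  2 ^- n / h n * x <= x `^ kappa^-1.
Proof.
move=> x0 H1 H2; rewrite mulrAC -mulrA div_scale//.
have [->|xn0] := eqVneq x 0.
  by rewrite powR0 ?invr_eq0 ?gt_eqF// mulr0 powR0 ?gt_eqF// mulr0.
have y0 : 0 < x `^ kappa^-1 by rewrite powR_gt0// lt_def xn0.
set w := 2 ^+ n * _; have w0 : 0 < w by rewrite mulr_gt0// exprn_gt0.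
rewrite -[leRHS](mulKf (x := 2 ^+ n))// ?expf_neq0//.
rewrite ler_wpM2l ?(ltW (exp2V_gt0 _))// -/w.
case: (leP 1 kappa) => k1.
  apply: ge1r_powR => //; rewrite w0/= leNgt -scale_lt// -leNgt; exact: H1.
apply: ler1_powR; last exact: ltW.
by rewrite ltW// -scale_lt//; exact: H2.
Qed.

Lemma scale_ratio n : 2 ^- n / h n = (2^-1 `^ (1 - kappa)) ^+ n.
Proof.
rewrite -[RHS]powR_mulrn ?powR_ge0// -[RHS]powRrM [in RHS]mulrC [RHS]powRrM powR_mulrn// -expr2V.
rewrite powRB; last by apply/implyP => _; rewrite gt_eqF// exp2V_gt0.
by rewrite powRr1// ltW// exp2V_gt0.
Qed.

Lemma scale_near_lt (x : R) : 0 < x -> \forall n \near \oo, h n < x.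
Proof.
move=> x0; have y0 : 0 < x `^ kappa^-1 by rewrite powR_gt0.
have cv : (2^-1 : R) ^+ n @[n --> \oo] --> 0 by apply: cvg_expr; rewrite ger0_norm; lra.
have : \forall n \near \oo, (2^-1 : R) ^+ n < x `^ kappa^-1 by exact: (cvgr_lt _ cv).
apply: filterS => n; rewrite -expr2V => hn.
by rewrite scale_lt ?(ltW x0)// -ltr_pdivrMl ?exprn_gt0// mulr1.
Qed.

(** Here 2^-n / h_n tends to 0, which disposes of [gamma] and of every fixed jump; the integral over
    the jumps larger than h_n vanishes by dominated convergence. *)
Lemma center_small_lt1 : kappa < 1 -> forall e, 0 < e ->
  \forall n \near \oo, 2 ^- n * `|levy_center Pi gamma (h n)| <= e * h n.
Proof.
move=> k1 e e0.
have cvq : 2 ^- n / h n @[n --> \oo] --> 0.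
  under eq_fun do rewrite scale_ratio.
  apply: cvg_expr; rewrite ger0_norm ?powR_ge0//.
  by apply: powR_lt1; lra.
pose g (n : nat) (x : R) := 2 ^- n / h n * (`|x| * \1_[set x | h n < `|x|] x) : R.
have mg n : measurable_fun D (g n).
  apply: measurable_funM => //; apply: measurable_funM => //.
  by apply: measurable_indic; exact: measurable_gt_norm.
have gb n (x : R) : `|x| <= 1 -> 0 <= g n x <= `|x| `^ kappa^-1.
  move=> x1; have q0 : 0 <= 2 ^- n / h n by rewrite divr_ge0// ltW// exp2V_gt0.
  rewrite /g indic_gt_norm; case: ltP => /= hx.
    rewrite mulr1 mulr_ge0//=; apply: scale_domination => //; lra.
  by rewrite !mulr0 lexx powR_ge0.
have g0 (x : R) : `|x| <= 1 -> g n x @[n --> \oo] --> 0.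
  move=> x1; apply: (@squeeze_cvgr _ _ _ _ (fun=> 0) (fun n => 2 ^- n / h n)).
  - apply: nearW => n; rewrite (andP (gb n x x1)).1/= /g.
    have q0 : 0 <= 2 ^- n / h n by rewrite divr_ge0// ltW// exp2V_gt0.
    rewrite ler_piMr// indic_gt_norm; case: ltP => _ /=; lra.
  - exact: cvg_cst.
  - exact: cvq.
have e2 : 0 < e / 2 by rewrite divr_gt0.
have H1 := dominated_vanish g mg gb g0 _ e2.
have H2 : \forall n \near \oo, 2 ^- n / h n * `|gamma| <= e / 2.
  have : 2 ^- n / h n * `|gamma| @[n --> \oo] --> 0.
    by rewrite -[X in _ --> X](mul0r `|gamma|); apply: cvgMl.
  by move=> cv; apply: filterS (cvgr_lt _ cv _ e2) => n; exact: ltW.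
near=> n.
have q0 : 0 <= 2 ^- n / h n by rewrite divr_ge0// ltW// exp2V_gt0.
rewrite -ler_pdivrMr// mulrAC.
have h1 : 2 ^- n / h n * `|gamma| <= e / 2 by near: n.
have h2 : \int[Pi]_(x in D) g n x <= e / 2 by near: n.
have il := integrable_large Pi hPi (h n) (h0 n).
have h3 : `|\int[Pi]_(x in D) (x * \1_[set x | h n < `|x|] x)| <=
    \int[Pi]_(x in D) (`|x| * \1_[set x | h n < `|x|] x).
  apply: (le_trans (le_normr_Rintegral mD il)).
  rewrite le_eqVlt; apply/orP; left; apply/eqP; apply: eq_Rintegral => x _.
  by rewrite normrM indic_gt_norm [`|_%:R|]ger0_norm.
move: h2; rewrite /g RintegralZl//; last first.
  apply: eq_integrable (integrable_norm il) => // x _ /=.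
  by rewrite normrM indic_gt_norm [`|_%:R|]ger0_norm.
rewrite /levy_center => h2.
have := ler_wpM2l q0 h3.
have := ler_wpM2l q0 (ler_normB gamma (\int[Pi]_(x in D) (x * \1_[set x | h n < `|x|] x))).
rewrite mulrDr; lra.
Unshelve. all: by end_near. Qed.

Lemma levy_abs_integral_fin : 1 <= kappa -> (\int[Pi]_(x in D) `|x|%:E < +oo)%E.
Proof.
move=> k1; apply: le_lt_trans J_fin; apply: ge0_subfun_integral => x /unit_itvP x1.
  by rewrite lee_fin.
rewrite lee_fin; have [->|x0] := eqVneq x 0; first by rewrite normr0 powR_ge0.
apply: ger1_powR; first by rewrite normr_gt0 x0.
by rewrite invf_le1.
Qed.

(** Now 2^-n / h_n >= 1, and a nonzero drift would not be negligible. With drift 0 the centre c_n is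
    the integral of x over |x| <= h_n; at each x the integrand is eventually 0, and dominated
    convergence applies. *)
Lemma center_small_ge1 : 1 <= kappa -> drift gamma Pi = 0 -> forall e, 0 < e ->
  \forall n \near \oo, 2 ^- n * `|levy_center Pi gamma (h n)| <= e * h n.
Proof.
move=> k1 dr e e0.
have ix : Pi.-integrable D (EFin \o (fun x : R => x)).
  apply/integrableP; split; first by apply/measurable_EFinP.
  exact: levy_abs_integral_fin.
pose g (n : nat) (x : R) := 2 ^- n / h n * (`|x| * (1 - \1_[set x | h n < `|x|] x)) : R.
have mg n : measurable_fun D (g n).
  apply: measurable_funM => //; apply: measurable_funM => //; apply: measurable_funB => //.
  by apply: measurable_indic; exact: measurable_gt_norm.
have gb n (x : R) : `|x| <= 1 -> 0 <= g n x <= `|x| `^ kappa^-1.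
  move=> x1; have q0 : 0 <= 2 ^- n / h n by rewrite divr_ge0// ltW// exp2V_gt0.
  rewrite /g indic_gt_norm; case: ltP => /= hx.
    by rewrite subrr !mulr0 lexx powR_ge0.
  rewrite subr0 mulr1 mulr_ge0//=; apply: scale_domination => //; lra.
have g0 (x : R) : `|x| <= 1 -> g n x @[n --> \oo] --> 0.
  move=> x1; have [->|xn0] := eqVneq x 0.
    by rewrite (_ : (fun n => g n 0) = fun=> 0)//; [exact: cvg_cst|]; apply/funext => n;
      rewrite /g normr0 mul0r mulr0.
  apply: cvg_near_cst; have x0 : 0 < `|x| by rewrite normr_gt0.
  apply: filterS (scale_near_lt _ x0) => n hn.
  by rewrite /g indic_gt_norm hn subrr !mulr0.
have H1 := dominated_vanish g mg gb g0 _ e0.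
near=> n.
have q0 : 0 <= 2 ^- n / h n by rewrite divr_ge0// ltW// exp2V_gt0.
rewrite -ler_pdivrMr// mulrAC.
have h2 : \int[Pi]_(x in D) g n x <= e by near: n.
have il := integrable_large Pi hPi (h n) (h0 n).
have is' : Pi.-integrable D (EFin \o (fun x => x * (1 - \1_[set x | h n < `|x|] x))).
  apply: eq_integrable (integrableB mD ix il) => // x _ /=.
  by rewrite -EFinB; congr EFin; ring.
have cE : levy_center Pi gamma (h n) = \int[Pi]_(x in D) (x * (1 - \1_[set x | h n < `|x|] x)).
  move: dr => /eqP; rewrite /drift subr_eq0 => /eqP dr.
  rewrite /levy_center {1}dr -RintegralB//.
  by apply: eq_Rintegral => x _; ring.
have h3 : `|levy_center Pi gamma (h n)| <=
    \int[Pi]_(x in D) (`|x| * (1 - \1_[set x | h n < `|x|] x)).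
  rewrite cE; apply: (le_trans (le_normr_Rintegral mD is')).
  rewrite le_eqVlt; apply/orP; left; apply/eqP; apply: eq_Rintegral => x _.
  by rewrite normrM indic_gt_norm [`|1 - _|]ger0_norm// subr_ge0 lern1; case: ltP.
move: h2; rewrite /g RintegralZl//; last first.
  apply: eq_integrable (integrable_norm is') => // x _ /=.
  by rewrite normrM indic_gt_norm [`|1 - _|]ger0_norm// subr_ge0 lern1; case: ltP.
move=> h2; exact: le_trans (ler_wpM2l q0 h3) h2.
Unshelve. all: by end_near. Qed.

End center.

(** * Bounded variation *)

Section two_sided_series.
Context {R : realType}.
Implicit Types (phi : R -> R) (x y : R).

(* Applied to theta |-> 1 - cos (theta y), the sum over k is a discrete version of
   \int_0^oo (1 - cos (theta y)) / theta^2 d(theta), a multiple of |y|. *)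
Definition two_sided phi (k : nat) : R := 2 ^- k * phi (2 ^+ k) + 2 ^+ k * phi (2 ^- k).

Lemma two_sided_le phi1 phi2 k : (forall t, phi1 t <= phi2 t) ->
  two_sided phi1 k <= two_sided phi2 k.
Proof.
by move=> h; apply: lerD; apply: ler_wpM2l => //; rewrite ?exprn_ge0// ltW// exp2V_gt0.
Qed.

Lemma two_sided_ge0 phi k : (forall t, 0 <= phi t) -> 0 <= two_sided phi k.
Proof.
by move=> h; rewrite addr_ge0// mulr_ge0// ?exprn_ge0// ltW// exp2V_gt0.
Qed.

(** An even majorant of 1 - cos that, unlike 1 - cos, is monotone in |v|: an upper bound on the
    modulus of the argument can be substituted. *)
Definition capped_sqr (v : R) : R := Num.min 2 (v ^+ 2 / 2).

Lemma one_sub_cos_le_capped v : 1 - cos v <= capped_sqr v.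
Proof. by rewrite le_min one_sub_cos_le2 one_sub_cos_le_sqr. Qed.

Lemma capped_sqr_ge0 v : 0 <= capped_sqr v.
Proof. by rewrite le_min ler0n divr_ge0// sqr_ge0. Qed.

Lemma capped_sqr_le v w : `|v| <= `|w| -> capped_sqr v <= capped_sqr w.
Proof.
move=> vw; rewrite /capped_sqr le_min ge_min lexx/= ge_min; apply/orP; right.
rewrite ler_wpM2r// -[leLHS]real_normK ?num_real// -[leRHS]real_normK ?num_real//.
by rewrite lerXn2r// nnegrE.
Qed.

(** A single frequency suffices, the one bringing |t y| into [1/2, 1]: a high frequency 2^k if |y|
    <= 1, a low one 2^-k otherwise. *)
Lemma norm_le_two_sided y : `|y| != 0 ->
  exists k, `|y| <= 16 * two_sided (fun t => 1 - cos (t * y)) k.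
Proof.
move=> yn0; have y0 : 0 < `|y| by rewrite lt_def yn0 normr_ge0.
have lb t : 1 / 2 <= `|t * y| <= 1 -> 1 / 16 <= 1 - cos (t * y).
  move=> /andP[h1 h2]; apply: le_trans (one_sub_cos_ge_sqr _ h2).
  by rewrite -[(t * y) ^+ 2]real_normK ?num_real//; nra.
have [y1|y1] := leP `|y| 1.
  have [|m /andP[m1 m2]] := @dyadic_bracket_le1 R `|y|; first by rewrite y0.
  exists m; have p0 : 0 < 2 ^+ m :> R by rewrite exprn_gt0.
  have := lb (2 ^+ m); rewrite normrM (gtr0_norm p0) => /(_ _) H.
  have {}H : 1 / 16 <= 1 - cos (2 ^+ m * y).
    apply: H; have pq : 2 ^+ m * 2 ^- m = 1 :> R by rewrite divff ?gt_eqF.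
    have := ler_wpM2l (ltW p0) m2; have := ler_wpM2l (ltW p0) (ltW m1).
    by rewrite exprSr invfM mulrA pq; lra.
  apply: (@le_trans _ _ (16 * (2 ^- m * (1 - cos (2 ^+ m * y))))).
    by have q0 := @exp2V_gt0 R m; nra.
  by rewrite ler_wpM2l// lerDl mulr_ge0 ?one_sub_cos_ge0// ltW.
have [m /andP[m1 m2]] := dyadic_bracket_ge1 _ (ltW y1).
exists m.+1; have p0 : 0 < 2 ^- m.+1 :> R by exact: exp2V_gt0.
have := lb (2 ^- m.+1); rewrite normrM (gtr0_norm p0) => /(_ _) H.
have {}H : 1 / 16 <= 1 - cos (2 ^- m.+1 * y).
  apply: H; have pq : 2 ^- m.+1 * 2 ^+ m.+1 = 1 :> R by rewrite mulVf ?expf_neq0.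
  have := ler_wpM2l (ltW p0) (ltW m2); have := ler_wpM2l (ltW p0) m1.
  have : 2 ^- m.+1 * 2 ^+ m = 1 / 2 :> R by rewrite exprS; field; rewrite expf_neq0.
  by rewrite pq; lra.
apply: (@le_trans _ _ (16 * (2 ^+ m.+1 * (1 - cos (2 ^- m.+1 * y))))).
  have q0 : 0 < 2 ^+ m.+1 :> R by rewrite exprn_gt0.
  by nra.
by rewrite ler_wpM2l// lerDr mulr_ge0 ?one_sub_cos_ge0// ltW.
Qed.

(** Each half of a term is |x| times [capped_sqr] w / w with w = 2^k |x| or 2^-k |x|, and this
    quotient is at most 2 min(w, 1/w). Inverting w turns the second half into the first with 1/|x|
    in place of |x|; hence 24 = 2 (halves) times 2 times 6. *)
Lemma sum_two_sided_capped_le x N :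
  \sum_(k < N) two_sided (fun t => capped_sqr (t * x)) k <= 24 * `|x|.
Proof.
have [->|xn0] := eqVneq x 0.
  rewrite normr0 mulr0 big1// => k _.
  by rewrite /two_sided !mulr0 /capped_sqr expr0n/= mul0r min_r// !mulr0 addr0.
have x0 : 0 < `|x| by rewrite normr_gt0.
have c w : 0 < w -> capped_sqr w / w <= 2 * Num.min w w^-1.
  move=> w0; rewrite ler_pdivrMr// -mulrA minr_pMl ?(ltW w0)// mulVf ?gt_eqF// minr_pMr//.
  by rewrite mulr1 minC le_min2 // -expr2; have := sqr_ge0 w; lra.
have six (z : R) : 0 < z -> \sum_(k < N) Num.min (2 ^+ k * z) (2 ^+ k * z)^-1 <= 6.
  move=> z0; have := @sum_geometric_min R 2 z N.
  rewrite (_ : 2 * (2 + 1) / (2 - 1) = 6 :> R); last by field.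
  by apply => //; lra.
have cN t : 0 < t -> capped_sqr (t * x) = capped_sqr (t * `|x|).
  by move=> t0; apply/le_anti; rewrite !capped_sqr_le// !normrM normr_id.
apply: (@le_trans _ _ (\sum_(k < N) (`|x| * (2 * Num.min (2 ^+ k * `|x|) (2 ^+ k * `|x|)^-1) +
    `|x| * (2 * Num.min (2 ^+ k * `|x|^-1) (2 ^+ k * `|x|^-1)^-1)))).
  apply: ler_sum => k _; have p0 : 0 < 2 ^+ k :> R by rewrite exprn_gt0.
  have q0 := @exp2V_gt0 R k.
  rewrite /two_sided !cN//; apply: lerD.
    have -> : 2 ^- k * capped_sqr (2 ^+ k * `|x|) =
        `|x| * (capped_sqr (2 ^+ k * `|x|) / (2 ^+ k * `|x|)).
      by field; rewrite !gt_eqF.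
    by rewrite ler_wpM2l// c// mulr_gt0.
  have -> : 2 ^+ k * capped_sqr (2 ^- k * `|x|) =
      `|x| * (capped_sqr (2 ^- k * `|x|) / (2 ^- k * `|x|)).
    by field; rewrite !gt_eqF.
  rewrite ler_wpM2l// (le_trans (c _ _)) ?mulr_gt0//.
  have e1 : (2 ^+ k / `|x|)^-1 = 2 ^- k * `|x| by rewrite invfM invrK.
  have e2 : (2 ^- k * `|x|)^-1 = 2 ^+ k / `|x| by rewrite invfM invrK.
  by rewrite e1 e2 minC.
rewrite big_split/= -!mulr_sumr.
have := six _ x0; have xi0 : 0 < `|x|^-1 by rewrite invr_gt0.
by have := six _ xi0; nra.
Qed.

End two_sided_series.

Section mean_increment.
Context d (T : measurableType d) (R : realType) (P : probability T R).
Variables (X : R -> {RV P >-> R}) (gamma : R) (Pi : {measure set R -> \bar R}).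
Hypothesis X_levy : levy_process X.
Hypothesis X_triplet : levy_triplet X gamma 0 Pi.
Local Notation D := (`[-1, 1]%classic : set R).
Hypothesis abs_fin : (\int[Pi]_(x in D) `|x|%:E < +oo)%E.
Local Notation psi := (levy_re Pi).

Let mD : measurable D. Proof. exact: measurable_itv. Qed.
Let hPi := triplet_levy _ _ _ _ _ _ _ X_triplet.

Let abs_mass : R := \int[Pi]_(x in D) `|x|.

Let iabs : Pi.-integrable D (EFin \o (fun x : R => `|x|)).
Proof.
apply/integrableP; split; first by apply/measurable_EFinP; exact: normr_measurable.
by under eq_integral do rewrite /= normr_id.
Qed.

Let abs_mass_ge0 : 0 <= abs_mass. Proof. exact: Rintegral_ge0. Qed.

Lemma sum_two_sided_levy_re N :
  Pi.-integrable D (EFin \o (fun x => \sum_(k < N) two_sided (fun t => 1 - cos (t * x)) k)) /\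
  \sum_(k < N) two_sided psi k =
    \int[Pi]_(x in D) \sum_(k < N) two_sided (fun t => 1 - cos (t * x)) k.
Proof.
elim: N => [|N [IH1 IH2]].
  split; first by under [X in _ \o X]eq_fun do rewrite big_ord0; exact: integrable0.
  rewrite big_ord0; under eq_Rintegral do rewrite big_ord0.
  by rewrite Rintegral_cst// mul0r.
have i1 := integrable_one_sub_cos Pi hPi.
have it : Pi.-integrable D (EFin \o (fun x => two_sided (fun t => 1 - cos (t * x)) N)).
  exact: (integrableD mD (integrableZl mD _ (i1 _)) (integrableZl mD _ (i1 _))).
split.
  under [X in _ \o X]eq_fun do rewrite big_ord_recr.
  exact: (integrableD mD IH1 it).
rewrite big_ord_recr/= IH2; under [RHS]eq_Rintegral do rewrite big_ord_recr/=.
rewrite RintegralD//; congr (_ + _).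
rewrite /two_sided RintegralD//; first by rewrite !RintegralZl.
- exact: (integrableZl mD _ (i1 _)).
- exact: (integrableZl mD _ (i1 _)).
Qed.

Lemma sum_two_sided_levy_re_le N : \sum_(k < N) two_sided psi k <= 24 * abs_mass.
Proof.
have [i1 ->] := sum_two_sided_levy_re N.
rewrite /abs_mass -RintegralZl//; apply: le_Rintegral => //;
  first exact: (integrableZl mD 24 iabs).
move=> x _; apply: le_trans (sum_two_sided_capped_le x N).
by apply: ler_sum => k _; apply: two_sided_le => t; exact: one_sub_cos_le_capped.
Qed.

Let slope : R := `|gamma| + 2 * abs_mass.

Let slope_ge0 : 0 <= slope. Proof. by rewrite addr_ge0// mulr_ge0. Qed.

Lemma levy_drift_le theta : `|gamma * theta + levy_im Pi theta| <= `|theta * slope|.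
Proof.
rewrite [leRHS]normrM (ger0_norm slope_ge0) mulrDr; apply: (le_trans (ler_normD _ _)).
rewrite normrM mulrC lerD2l /levy_im.
apply: (le_trans (le_normr_Rintegral mD (integrable_sinB Pi hPi theta))).
rewrite mulrA /abs_mass -RintegralZl//; apply: le_Rintegral => //.
- exact: (integrable_norm (integrable_sinB Pi hPi theta)).
- exact: (integrableZl mD (`|theta| * 2) iabs).
move=> x _; apply: (le_trans (ler_normB _ _)).
have := norm_sin_le (theta * x); rewrite normrM; lra.
Qed.

(** 16 comes from [norm_le_two_sided] and 24 from [sum_two_sided_capped_le], used once for the jumps
    and once for the drift. *)
Definition mean_const : R := 16 * (24 * abs_mass + 24 * slope).

(** The drift contribution must stay capped: a bound linear in theta, as in
    [expectation_one_sub_cos_le], would contribute a constant for each k to the two-sided sum, which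
    would then diverge. *)
Lemma expectation_one_sub_cos_capped s theta : 0 <= s ->
  (\int[P]_w (1 - cos (theta * X s w))%:E <=
    (s * psi theta + capped_sqr (theta * (s * slope)))%:E)%E.
Proof.
move=> s0; have := @expectation_one_sub_cos _ _ _ _ _ _ _ X_triplet s theta 0 s0.
under eq_integral do rewrite mulr0 subr0.
move=> ->; rewrite mul0r subr0 lee_fin.
set b := gamma * theta + levy_im Pi theta; set E := expR _.
have E1 : 1 - E <= s * psi theta.
  by have := expR_ge1Dx (- (s * psi theta)); rewrite -/E; lra.
have E0 : 0 <= E by exact: expR_ge0.
have El : E <= 1.
  by rewrite /E -expR0 ler_expR oppr_le0 mulr_ge0// levy_re_ge0.
have h1 : 1 - cos (s * b) <= capped_sqr (theta * (s * slope)).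
  apply: (le_trans (one_sub_cos_le_capped _)); apply: capped_sqr_le.
  rewrite mulrCA normrM [leRHS]normrM ler_wpM2l//; exact: levy_drift_le.
have := one_sub_cos_ge0 (s * b); nra.
Qed.

Lemma mean_norm_le s : 0 <= s -> (\int[P]_w `|X s w|%:E <= (mean_const * s)%:E)%E.
Proof.
move=> s0.
pose f k w := two_sided (fun t => 1 - cos (t * X s w)) k.
have f0 k w : (0 <= (f k w)%:E)%E.
  by rewrite lee_fin; apply: two_sided_ge0 => t; exact: one_sub_cos_ge0.
have mc t : measurable_fun setT (fun w => 1 - cos (t * X s w)).
  by apply: measurable_funB => //; apply: measurable_cos_comp; exact: measurable_funM.
have mf k : measurable_fun setT (fun w => (f k w)%:E).
  by apply/measurable_EFinP; apply: measurable_funD; apply: measurable_funM.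
have Xle : (\int[P]_w `|X s w|%:E <= \int[P]_w (16%:E * \sum_(k <oo) (f k w)%:E))%E.
  apply: ge0_subfun_integral => w _ //.
  have [->|Xn0] := eqVneq `|X s w| 0.
    by rewrite mule_ge0// nneseries_ge0.
  have [k hk] := norm_le_two_sided _ Xn0.
  apply: (@le_trans _ _ (16%:E * (f k w)%:E)%E); first by rewrite -EFinM lee_fin.
  rewrite lee_wpmul2l// (@nneseriesD1 _ (fun k => (f k w)%:E) k)//.
  by rewrite leeDl// nneseries_ge0.
apply: (le_trans Xle); rewrite ge0_integralZl//; last 2 first.
- by apply: ge0_emeasurable_sum => [k w _ _|k _].
- by move=> w _; apply: nneseries_ge0.
rewrite integral_nneseries//.
rewrite /mean_const -mulrA EFinM lee_wpmul2l//.
have fk k : (\int[P]_w (f k w)%:E <=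
    (s * two_sided psi k + two_sided (fun t => capped_sqr (t * (s * slope))) k)%:E)%E.
  have p0 : 0 <= 2 ^+ k :> R by rewrite exprn_ge0.
  have q0 : 0 <= 2 ^- k :> R by rewrite ltW// exp2V_gt0.
  have c0 t w : (0 <= (1 - cos (t * X s w))%:E)%E by rewrite lee_fin one_sub_cos_ge0.
  have mcE t : measurable_fun setT (fun w => (1 - cos (t * X s w))%:E) by exact/measurable_EFinP.
  under eq_integral do rewrite /f /two_sided EFinD !EFinM.
  rewrite ge0_integralD//; [|exact: measurable_funeM..].
  rewrite !ge0_integralZl_EFin//.
  have e1 := @lee_wpmul2l R (2 ^- k)%:E q0 _ _ (expectation_one_sub_cos_capped s (2 ^+ k) s0).
  have e2 := @lee_wpmul2l R (2 ^+ k)%:E p0 _ _ (expectation_one_sub_cos_capped s (2 ^- k) s0).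
  apply: (le_trans (leeD e1 e2)).
  by rewrite -!EFinM -EFinD lee_fin /two_sided; lra.
apply: (@le_trans _ _ (\sum_(k <oo)
  (s * two_sided psi k + two_sided (fun t => capped_sqr (t * (s * slope))) k)%:E)%E).
  by apply: lee_nneseries => [k _ _|k _]; [apply: integral_ge0 => w _; exact: f0|exact: fk].
apply: nneseries_le_fin => [k|N].
  by rewrite addr_ge0// ?mulr_ge0// two_sided_ge0// => t;
    [exact: levy_re_ge0|exact: capped_sqr_ge0].
rewrite big_split/= -mulr_sumr mulrDl; apply: lerD.
  by rewrite mulrC ler_wpM2r// sum_two_sided_levy_re_le.
apply: (le_trans (sum_two_sided_capped_le _ N)).
by rewrite normrM !ger0_norm//; lra.
Qed.

Lemma mean_norm_increment_le s t : 0 <= s <= t ->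
  (\int[P]_w `|X t w - X s w|%:E <= (mean_const * (t - s))%:E)%E.
Proof.
move=> /andP[s0 st].
have ts0 : 0 <= t - s by rewrite subr_ge0.
apply: le_trans (mean_norm_le _ ts0).
have mY : measurable_fun setT (fun w => X t w - X s w) by exact: measurable_funB.
have mZ : measurable_fun setT (X (t - s)) by exact: measurable_funP.
have ma : measurable_fun setT (fun x : R => `|x|%:E) by exact/measurable_EFinP.
have := @ge0_integral_pushforward _ _ _ _ R _ mY P setT
  (fun x => `|x|%:E) measurableT ma (fun x _ => normr_ge0 x).
rewrite preimage_setT => /= <-.
have := @ge0_integral_pushforward _ _ _ _ R _ mZ P setT
  (fun x => `|x|%:E) measurableT ma (fun x _ => normr_ge0 x).
rewrite preimage_setT => /= <-.
rewrite le_eqVlt; apply/orP; left; apply/eqP; apply: eq_measure_integral => A mA _.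
rewrite /pushforward; exact: (levy_stationary X_levy).
Qed.

End mean_increment.

(** * Variation along dyadic grids *)

Section dyadic_variation.
Context {R : realType}.
Implicit Types (f : R -> R).

Lemma variation_subsequence (g : nat -> R) (j : nat -> nat) m :
  (forall i, (i < m)%N -> (j i <= j i.+1)%N) ->
  \sum_(0 <= i < m) `|g (j i.+1) - g (j i)| <= \sum_(0 <= l < j m) `|g l.+1 - g l|.
Proof.
elim: m => [|m IH] jle; first by rewrite big_geq// sumr_ge0.
rewrite big_nat_recr//= (big_cat_nat (leq0n _) (jle m (ltnSn m)))/=.
apply: lerD; first by apply: IH => i im; apply: jle; exact: ltnW.
rewrite -(telescope_sumr _ (jle m (ltnSn m))).
exact: ler_norm_sum.
Qed.

Definition dyadic_variation f (k M : nat) : R :=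
  \sum_(0 <= i < M) `|f (i.+1%:R * 2 ^- k) - f (i%:R * 2 ^- k)|.

Lemma dyadic_variation_le_refine f k M :
  dyadic_variation f k M <= dyadic_variation f k.+1 (2 * M).
Proof.
have := variation_subsequence (fun i => f (i%:R * 2 ^- k.+1)) (fun i => 2 * i)%N M.
move=> /(_ _)/(le_trans _); apply; last by move=> i _; rewrite leq_mul2l leqnSn orbT.
rewrite le_eqVlt; apply/orP; left; apply/eqP; apply: eq_bigr => i _.
have e l : (2 * l)%:R * 2 ^- k.+1 = l%:R * 2 ^- k :> R.
  by rewrite natrM exprS; field; rewrite expf_neq0.
by rewrite !e.
Qed.

Lemma dyadic_variation_mono f k M M' : (M <= M')%N ->
  dyadic_variation f k M <= dyadic_variation f k M'.
Proof.
by move=> MM; rewrite /dyadic_variation (big_cat_nat (leq0n _) MM)/= lerDl sumr_ge0.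
Qed.

(** The index is strictly above [p] 2^k, so that the dyadic points tend to [p] from the right, the
    side on which paths are continuous. *)
Definition dyadic_above (p : R) (k : nat) : nat := (Num.truncn (p * 2 ^+ k)).+1.

Lemma cvg_dyadic_above f p : 0 <= p -> f s @[s --> p^'+] --> f p ->
  f ((dyadic_above p k)%:R * 2 ^- k) @[k --> \oo] --> f p.
Proof.
move=> p0 fp; apply/cvgrPdist_le => e e0.
move/cvgrPdist_le : fp => /(_ e e0); rewrite near_withinE => /nbhs_ballP[del /= d0 hd].
have cv : (2^-1 : R) ^+ n @[n --> \oo] --> 0 by apply: cvg_expr; rewrite ger0_norm; lra.
have : \forall n \near \oo, (2^-1 : R) ^+ n < del by exact: (cvgr_lt _ cv).
apply: filterS => k; rewrite -expr2V => kd.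
have p0' : 0 < 2 ^+ k :> R by rewrite exprn_gt0.
have /andP[h1 h2] : (Num.truncn (p * 2 ^+ k))%:R <= p * 2 ^+ k < (dyadic_above p k)%:R.
  by apply: truncn_itv; rewrite mulr_ge0// ltW.
have h3 : p < (dyadic_above p k)%:R * 2 ^- k by rewrite ltr_pdivlMr.
have h4 : (dyadic_above p k)%:R * 2 ^- k <= p + 2 ^- k.
  by rewrite ler_pdivrMr// mulrDl mulVf ?gt_eqF// /dyadic_above -natr1 lerD2r.
by apply: hd => //=; rewrite /ball/= ltr_distlC; lra.
Qed.

(** Each point of a partition is moved to the dyadic point just above it; the variation over the
    moved points is at most the dyadic one, and right continuity lets the level tend to infinity.
    Since [t] < [N], the moved points stay within [0, N]. *)
Lemma bounded_variation_from_dyadic f (t B : R) (N : nat) : 0 <= t -> t < N%:R ->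
  (forall p, 0 <= p -> f s @[s --> p^'+] --> f p) ->
  (forall k, dyadic_variation f k (N * 2 ^ k) <= B) ->
  bounded_variation 0 t f.
Proof.
move=> t0 tN fr fB; exists B => _ [s st <-].
rewrite /variation; set p := nth t (0 :: s).
have p0 i : (i < (size s).+1)%N -> 0 <= p i by move=> si; exact: itv_partition_nth_ge.
have pt i : (i < (size s).+1)%N -> p i <= t by move=> si; exact: itv_partition_nth_le.
have pp i : (i < size s)%N -> p i <= p i.+1.
  move=> si; case: st => /(pathP t)/(_ i si) h _.
  by rewrite ltW.
pose F k := \sum_(0 <= i < size s)
  `|f ((dyadic_above (p i.+1) k)%:R * 2 ^- k) - f ((dyadic_above (p i) k)%:R * 2 ^- k)|.
have cv : F k @[k --> \oo] --> \sum_(0 <= i < size s) `|f (p i.+1) - f (p i)|.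
  suff : forall m, (m <= size s)%N -> (\sum_(0 <= i < m)
    `|f ((dyadic_above (p i.+1) k)%:R * 2 ^- k) - f ((dyadic_above (p i) k)%:R * 2 ^- k)|)
      @[k --> \oo] --> \sum_(0 <= i < m) `|f (p i.+1) - f (p i)|.
    by apply.
  elim => [|m IH] ms.
    by under eq_fun do rewrite big_geq//; rewrite big_geq//; exact: cvg_cst.
  under eq_fun do rewrite big_nat_recr//=.
  rewrite big_nat_recr//=; apply: cvgD; first by apply: IH; exact: ltnW.
  apply: cvg_norm; apply: cvgB; apply: cvg_dyadic_above.
  - exact: p0.
  - by apply: fr; exact: p0.
  - by apply: p0; rewrite ltnS ltnW.
  - by apply: fr; apply: p0; rewrite ltnS ltnW.
rewrite -[leLHS](cvg_lim _ cv)//; apply: limr_le; first by apply/cvg_ex; eexists; exact: cv.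
apply: nearW => k; apply: (le_trans _ (fB k)).
apply: (le_trans (variation_subsequence (fun l => f (l%:R * 2 ^- k))
  (fun i => dyadic_above (p i) k) _ _)).
  move=> i si; rewrite /dyadic_above ltnS.
  by apply: Num.Theory.le_truncn; rewrite ler_wpM2r ?exprn_ge0// pp.
apply: dyadic_variation_mono.
rewrite /dyadic_above -(@ltr_nat R).
have ps := pt (size s) (ltnSn _); have ps0 := p0 (size s) (ltnSn _).
have pk : 0 < 2 ^+ k :> R by rewrite exprn_gt0.
have /andP[h1 _] := truncn_itv (mulr_ge0 ps0 (ltW pk)).
apply: (le_lt_trans h1); rewrite natrM natrX ltr_pM2r//.
exact: le_lt_trans tN.
Qed.

End dyadic_variation.

(** * Bounded variation of the paths *)

Section levy_bounded_variation.
Context d (T : measurableType d) (R : realType) (P : probability T R).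
Variables (X : R -> {RV P >-> R}) (gamma : R) (Pi : {measure set R -> \bar R}).
Hypothesis X_levy : levy_process X.
Hypothesis X_triplet : levy_triplet X gamma 0 Pi.
Local Notation D := (`[-1, 1]%classic : set R).
Hypothesis abs_fin : (\int[Pi]_(x in D) `|x|%:E < +oo)%E.

Let V (N k : nat) (w : T) : R := dyadic_variation (fun t => X t w) k (N * 2 ^ k).

Let mV N k : measurable_fun setT (V N k).
Proof.
apply: measurable_sum => i.
apply: measurableT_comp => //; exact: measurable_funB.
Qed.

Let V0 N k w : 0 <= V N k w.
Proof. exact: sumr_ge0. Qed.

Let Vnd N w : nondecreasing_seq (fun k => (V N k w)%:E).
Proof.
apply/nondecreasing_seqP => k; rewrite lee_fin /V expnS mulnCA.
exact: dyadic_variation_le_refine.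
Qed.

Lemma mean_dyadic_variation_le N k :
  (\int[P]_w (V N k w)%:E <= (mean_const _ gamma Pi * N%:R)%:E)%E.
Proof.
have mI i : measurable_fun setT (fun w => (`|X (i.+1%:R * 2 ^- k) w - X (i%:R * 2 ^- k) w|)%:E).
  by apply/measurable_EFinP; apply: measurableT_comp => //; exact: measurable_funB.
under eq_integral do rewrite /V /dyadic_variation -sumEFin.
rewrite ge0_integral_sum//.
apply: (@le_trans _ _ (\sum_(0 <= i < N * 2 ^ k) (mean_const _ gamma Pi * 2 ^- k)%:E)%E).
  apply: lee_sum => i _.
  have p0 : 0 <= 2 ^- k :> R by rewrite ltW// exp2V_gt0.
  have st : 0 <= (i%:R : R) * 2 ^- k <= i.+1%:R * 2 ^- k.
    by rewrite mulr_ge0//= ler_wpM2r// ler_nat.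
  apply: (le_trans (mean_norm_increment_le _ _ _ _ _ _ _ X_levy X_triplet abs_fin _ _ st)).
  by rewrite -mulrBl -natrB// subSnn mul1r.
rewrite sumEFin lee_fin sumr_const_nat subn0 -[leLHS]mulr_natl natrM natrX.
by rewrite le_eqVlt; apply/orP; left; apply/eqP; field; rewrite expf_neq0.
Qed.

(** The dyadic variations over [0, N] increase with the level and their expectations stay bounded,
    so by monotone convergence their limit is integrable, hence almost surely finite, for all
    integers N at once. *)
Lemma levy_in_bv : in_bv X.
Proof.
have VN N : {ae P, forall w, exists B : R, forall k, V N k w <= B}.
  have cv := @cvg_monotone_convergence _ _ R P setT measurableT (fun k w => (V N k w)%:E)
    (fun k => (measurable_EFinP _ _).2 (mV N k)) (fun k w _ => V0 N k w) (fun w _ => Vnd N w).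
  have ml : measurable_fun setT (fun w => limn (fun k => (V N k w)%:E)).
    apply: (emeasurable_fun_cvg (fun k w => (V N k w)%:E)) => [k|w _].
      by apply/measurable_EFinP; exact: mV.
    exact: ereal_nondecreasing_is_cvgn.
  have l0 w : (0 <= limn (fun k => (V N k w)%:E))%E.
    by apply: lime_ge; [exact: ereal_nondecreasing_is_cvgn|apply: nearW => k; rewrite lee_fin].
  have il : P.-integrable setT (fun w => limn (fun k => (V N k w)%:E)).
    apply/integrableP; split => //.
    under eq_integral do rewrite gee0_abs//.
    apply: (@le_lt_trans _ _ (mean_const _ gamma Pi * N%:R)%:E); last by rewrite ltry.
    rewrite -(cvg_lim _ cv)//; apply: lime_le.
      by apply/cvg_ex; eexists; exact: cv.
    by apply: nearW => k; exact: mean_dyadic_variation_le.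
  have := integrable_ae measurableT il.
  apply: filterS => w /(_ I) lf.
  exists (fine (limn (fun k => (V N k w)%:E))) => k.
  rewrite -lee_fin fineK//.
  apply: lime_ge; first exact: ereal_nondecreasing_is_cvgn.
  by exists k => // m /= km; exact: Vnd.
have H : {ae P, forall w, forall N : nat, exists B : R, forall k, V N k w <= B}.
  by apply: ae_foralln => N; exact: VN.
apply: filterS2 (levy_cadlag X_levy) H => w [fr _] hB t t0.
have [B hB'] := hB (Num.truncn t).+1.
apply: (@bounded_variation_from_dyadic _ _ t B (Num.truncn t).+1) => //.
by case/andP: (truncn_itv t0).
Qed.

End levy_bounded_variation.

(** * Divergence *)

Section quartic_kernel.
Context {R : realType}.
Implicit Types x y z : R.

(** The coefficients 1/2 and 1/8 cancel the quadratic terms, z^2 / 4 against (2z)^2 / 16. *)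
Definition quartic z : R := (1 - cos z) / 2 - (1 - cos (2 * z)) / 8.

Lemma quarticE z : quartic z = ((1 - cos z) / 2) ^+ 2.
Proof.
have -> : quartic z = (1 - cos z) / 2 - (1 - cos (z *+ 2)) / 8.
  by rewrite /quartic mulr_natl.
rewrite cos_mulr2n -mulr_natr; by field.
Qed.

Lemma quartic_ge0 z : 0 <= quartic z.
Proof. by rewrite quarticE sqr_ge0. Qed.

Lemma quartic_le1 z : quartic z <= 1.
Proof.
rewrite quarticE expr_le1//; have := one_sub_cos_le2 z; have := one_sub_cos_ge0 z; lra.
Qed.

Lemma quartic_le z : quartic z <= z ^+ 4.
Proof.
rewrite quarticE (exprM z 2 2).
apply: lerXn2r; rewrite ?nnegrE ?sqr_ge0 ?divr_ge0 ?one_sub_cos_ge0//.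
by have := one_sub_cos_le_sqr z; have := sqr_ge0 z; lra.
Qed.

Lemma quartic_ge z : `|z| <= 1 -> z ^+ 4 / 64 <= quartic z.
Proof.
move=> z1; rewrite quarticE (_ : z ^+ 4 / 64 = (z ^+ 2 / 8) ^+ 2); last by field.
apply: lerXn2r; rewrite ?nnegrE ?divr_ge0 ?sqr_ge0 ?one_sub_cos_ge0//.
by have := one_sub_cos_ge_sqr _ z1; lra.
Qed.

Lemma quartic_norm z : quartic `|z| = quartic z.
Proof.
by rewrite !quarticE cos_norm.
Qed.

Lemma measurable_quartic : measurable_fun setT quartic.
Proof.
apply: measurable_funB.
  apply: measurable_funM => //; apply: measurable_funB => //; exact: measurable_cos_comp.
apply: measurable_funM => //; apply: measurable_funB => //.
exact: measurable_cosM.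
Qed.

Variable kappa : R.
Hypothesis kappa_gt : 1 / 2 < kappa.
Local Notation h := (scale kappa).
Let k0 : 0 < kappa. Proof. by move: kappa_gt; lra. Qed.
Let h0 n : 0 < h n. Proof. exact: scale_gt0. Qed.

(** With w = 2^n (|y| / c)^(1/kappa) the kernel is at most w^(4 kappa) <= w^2 for w <= 1, as 4 kappa
    >= 2, and at most 1 beyond; after multiplication by 2^-n this is the summand of
    [sum_geometric_min]. *)
Lemma sum_quartic_le c y N : 0 < c ->
  \sum_(n < N) 2 ^- n * quartic (y / (c * h n)) <= 6 * (`|y| / c) `^ kappa^-1.
Proof.
move=> c0.
have qE n : quartic (y / (c * h n)) = quartic (`|y| / c / h n).
  by rewrite -quartic_norm normrM normfV (gtr0_norm (mulr_gt0 c0 (h0 n))) invfM mulrA.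
under eq_bigr do rewrite qE.
set x := `|y| / c; have x0 : 0 <= x by rewrite divr_ge0// ltW.
have [->|xn0] := eqVneq x 0.
  rewrite powR0 ?invr_eq0 ?gt_eqF// mulr0 big1// => n _.
  by rewrite mul0r quarticE cos0 subrr mul0r expr0n mulr0.
set Y := x `^ kappa^-1.
have Y0 : 0 < Y by rewrite powR_gt0// lt_def xn0.
apply: (@le_trans _ _ (Y * \sum_(n < N) Num.min (2 ^+ n * Y) (2 ^+ n * Y)^-1)).
  rewrite mulr_sumr; apply: ler_sum => n _.
  rewrite div_scale// -/Y; set w := 2 ^+ n * Y.
  have w0 : 0 < w by rewrite mulr_gt0// exprn_gt0.
  have -> : 2 ^- n = Y / w :> R.
    by rewrite /w invfM mulrCA divff ?mulr1// gt_eqF.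
  rewrite -mulrA ler_wpM2l ?(ltW Y0)// mulrC ler_pdivrMr//.
  rewrite minr_pMl ?(ltW w0)// mulVf ?gt_eqF// le_min quartic_le1 andbT -expr2.
  have [w1|w1] := leP w 1.
    apply: (le_trans (quartic_le _)).
    rewrite -!powR_mulrn ?powR_ge0 ?(ltW w0)// -powRrM ger_powR ?w0//.
    by move: kappa_gt; lra.
  apply: (le_trans (quartic_le1 _)); rewrite expr_ge1 ?ltW//.
rewrite mulrC ler_wpM2r ?(ltW Y0)//.
have := @sum_geometric_min R 2 Y N; rewrite (_ : 2 * (2 + 1) / (2 - 1) = 6 :> R); last by field.
by apply => //; lra.
Qed.

Lemma sum_exp2V_le N : \sum_(n < N) 2 ^- n <= 2 :> R.
Proof.
under eq_bigr do rewrite expr2V.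
have q : 0 <= (2^-1 : R) < 1 by lra.
have := sum_geometric_le 2^-1 N q.
by rewrite (_ : (1 - 2^-1)^-1 = 2 :> R)//; field.
Qed.

(* The quartic decay absorbs all |y| <= c h_(N-1) into the single term
   4 (1 - cos y), whose expectation is O(s) uniformly in N. *)
Lemma quartic_sum_detects c (N' : nat) : 0 < c -> exists N, forall y,
  \sum_(n < N') 2 ^- n * quartic (y / (c * h n)) <=
  12 * (\sum_(n < N) 2 ^- n * (c * h n < `|y|)%R%:R) + 4 * (1 - cos y).
Proof.
move=> c0.
pose Q := \sum_(n < N') 2 ^- n / (c * h n) ^+ 4.
have Q0 : 0 <= Q.
  by apply: sumr_ge0 => n _;
    rewrite divr_ge0 ?exprn_ge0 ?(ltW (mulr_gt0 c0 (h0 n)))// ltW// exp2V_gt0.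
(* Below the cut-off c h_(N1) the whole sum is at most Q |y|^4 <= y^2 <= 4 (1 - cos y), whatever the
   size of [Q]. *)
have [N1 hN1] : exists N1, c * h N1 <= 1 /\ Q * (c * h N1) ^+ 2 <= 1.
  have d0 : 0 < Num.min 1 (Q + 1)^-1 by rewrite lt_min ltr01 invr_gt0; lra.
  have [N1 _ /(_ N1 (leqnn _)) hN] := scale_near_lt _ kappa_gt _ (divr_gt0 d0 c0).
  exists N1; move: hN; rewrite ltr_pdivlMr// mulrC lt_min => /andP[u1 u2].
  split; first exact: ltW.
  have p0 := mulr_gt0 c0 (h0 N1).
  apply: (@le_trans _ _ (Q * (c * h N1))); first by rewrite ler_wpM2l// expr2 ler_piMr// ltW.
  apply: (@le_trans _ _ (Q * (Q + 1)^-1)); first by rewrite ler_wpM2l// ltW.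
  by rewrite ler_pdivrMr; lra.
exists N1.+1 => y.
have s0 N : 0 <= \sum_(n < N) 2 ^- n * (c * h n < `|y|)%R%:R :> R.
  by apply: sumr_ge0 => n _; rewrite mulr_ge0// ltW// exp2V_gt0.
have one N (m : nat) : (m < N)%N -> c * h m < `|y| ->
    2 ^- m <= \sum_(n < N) 2 ^- n * (c * h n < `|y|)%R%:R :> R.
  move=> mN cm; rewrite (bigD1 (Ordinal mN))//= cm mulr1 lerDl.
  by apply: sumr_ge0 => n _; rewrite mulr_ge0// ltW// exp2V_gt0.
have cos0 := one_sub_cos_ge0 y.
(* For |y| > [c] the left side is at most \sum 2^-n <= 2, while the indicator at n = 0 is already 1
   because h_0 = 1. *)
have [y1|y1] := leP `|y| c; last first.
  have hz : h 0 = 1 by rewrite /scale expr0 invr1 powR1.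
  have := one N1.+1 0%N (ltn0Sn _); rewrite hz mulr1 expr0 invr1 => /(_ y1) o.
  have : \sum_(n < N') 2 ^- n * quartic (y / (c * h n)) <= 2.
    apply: le_trans (sum_exp2V_le N'); apply: ler_sum => n _.
    by rewrite ler_piMr ?quartic_le1// ltW// exp2V_gt0.
  lra.
have [y2|y2] := leP `|y| (c * h N1).
  have [u1 u2] := hN1.
  apply: (@le_trans _ _ (Q * `|y| ^+ 4)).
    rewrite mulr_suml; apply: ler_sum => n _.
    rewrite -mulrA ler_wpM2l ?(ltW (exp2V_gt0 _))//.
    apply: (le_trans (quartic_le _)).
    rewrite expr_div_n mulrC ler_wpM2l//; first by rewrite invr_ge0 exprn_ge0// ltW// mulr_gt0.
    by rewrite -normrX ler_norm.
  apply: (@le_trans _ _ (`|y| ^+ 2)).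
    rewrite (exprD _ 2 2) mulrA ler_piMl ?sqr_ge0//.
    apply: le_trans u2; rewrite ler_wpM2l// lerXn2r// nnegrE// ltW// mulr_gt0//.
  have := one_sub_cos_ge_sqr y (le_trans y2 u1).
  rewrite real_normK ?num_real//; have := s0 N1.+1; lra.
(* In the middle range 6 (|y| / c)^(1/kappa) <= 6 / 2^m = 12 / 2^(m+1), and the indicator at n = m +
   1 equals 1; this is the origin of 12. *)
apply: (le_trans (sum_quartic_le _ _ _ c0)).
have yc0 : 0 <= `|y| / c by rewrite divr_ge0// ltW.
have yc : 0 < `|y| / c by rewrite divr_gt0// (lt_trans _ y2)// mulr_gt0.
have [|m /andP[m1 m2]] := @dyadic_bracket_le1 R ((`|y| / c) `^ kappa^-1).
  by rewrite powR_gt0//= powR_le1 ?yc0 ?invr_ge0 ?ler_pdivrMr ?mul1r// ltW.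
have mN1 : (m < N1)%N.
  move: y2; rewrite -ltr_pdivlMl// mulrC scale_lt// => y2.
  rewrite ltnNge; apply/negP => Nm.
  have := @le_exp2V R _ _ Nm => le.
  have := le_trans m2 le; rewrite leNgt => /negP; apply.
  by rewrite -ltr_pdivrMl ?exprn_gt0// in y2 *; rewrite mulr1 in y2.
have m1' : c * h m.+1 < `|y|.
  rewrite -ltr_pdivlMl// mulrC scale_lt// -ltr_pdivrMl ?exprn_gt0// mulr1//.
have := one N1.+1 m.+1 mN1 m1'.
have : 2 ^- m = 2 * 2 ^- m.+1 :> R by rewrite exprSr invfM; lra.
lra.
Qed.

End quartic_kernel.

(** * The quartic kernel under the Levy measure *)

Section quartic_mass.
Context {R : realType}.
Variables (Pi : {measure set R -> \bar R}) (kappa : R).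
Hypothesis hPi : levy_measure Pi.
Hypothesis kappa_gt : 1 / 2 < kappa.
Local Notation D := (`[-1, 1]%classic : set R).
Local Notation h := (scale kappa).
Local Notation psi := (levy_re Pi).
Let k0 : 0 < kappa. Proof. by move: kappa_gt; lra. Qed.
Let h0 n : 0 < h n. Proof. exact: scale_gt0. Qed.
Let mD : measurable D. Proof. exact: measurable_itv. Qed.

Definition quartic_mass (a : R) : R := psi a^-1 / 2 - psi (2 * a^-1) / 8.

Lemma quartic_massE a :
  Pi.-integrable D (EFin \o (fun x => quartic (x / a))) /\
  \int[Pi]_(x in D) quartic (x / a) = quartic_mass a.
Proof.
have i1 := integrable_one_sub_cos Pi hPi.
have eq x : quartic (x / a) = 2^-1 * (1 - cos (a^-1 * x)) - 8^-1 * (1 - cos (2 * a^-1 * x)).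
  by rewrite /quartic mulrA [2 * x]mulrC -[x * 2 / a]mulrA [x / a]mulrC [x * _]mulrC; lra.
have ib := integrableB mD (integrableZl mD 2^-1 (i1 a^-1)) (integrableZl mD 8^-1 (i1 (2 * a^-1))).
split; first by under [X in _ \o X]eq_fun do rewrite eq; exact: ib.
under eq_Rintegral do rewrite eq.
rewrite RintegralB//; last 2 first.
- exact: (integrableZl mD 2^-1 (i1 a^-1)).
- exact: (integrableZl mD 8^-1 (i1 (2 * a^-1))).
by rewrite !RintegralZl// /quartic_mass /levy_re; lra.
Qed.

(** For |x| <= [c] some n puts |x| / (c h_n) in [2^(-kappa), 1], where the kernel is at least
    (2^(-kappa))^4 / 64. The term x^2 / c^2, integrable under the Levy measure, takes care of |x| >
    [c]. *)
Lemma power_le_quartic c (x : R) : 0 < c -> `|x| <= 1 ->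
  exists n, `|x| `^ kappa^-1 <=
    64 * c `^ kappa^-1 / (2^-1 `^ kappa) ^+ 4 * (2 ^- n * quartic (x / (c * h n))) +
    c ^- 2 * x ^+ 2.
Proof.
move=> c0 x1.
have q0 n : 0 <= 64 * c `^ kappa^-1 / (2^-1 `^ kappa) ^+ 4 * (2 ^- n * quartic (x / (c * h n))).
  by rewrite mulr_ge0 ?divr_ge0 ?mulr_ge0 ?powR_ge0 ?exprn_ge0 ?quartic_ge0.
have r0 : 0 <= c ^- 2 * x ^+ 2 by rewrite mulr_ge0 ?sqr_ge0// invr_ge0 exprn_ge0// ltW.
have [xc|xc] := leP `|x| c; last first.
  exists 0%N; apply: (@le_trans _ _ (c ^- 2 * x ^+ 2)); last by rewrite lerDr.
  apply: (@le_trans _ _ 1); first by rewrite powR_le1 ?normr_ge0 ?x1 ?invr_ge0 ?ltW.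
  rewrite mulrC ler_pdivlMr ?exprn_gt0// mul1r -[leRHS]real_normK ?num_real//.
  by rewrite lerXn2r ?nnegrE ?normr_ge0 ?(ltW c0) ?(ltW xc).
have [xe0|xn0] := eqVneq x 0.
  exists 0%N; rewrite {1}xe0 normr0 powR0 ?invr_eq0 ?gt_eqF//.
  by rewrite addr_ge0.
have x0 : 0 < `|x| by rewrite normr_gt0.
have y0 : 0 < `|x| / c by rewrite divr_gt0.
have Y0 : 0 < (`|x| / c) `^ kappa^-1 by rewrite powR_gt0.
have [|m /andP[m1 m2]] := @dyadic_bracket_le1 R ((`|x| / c) `^ kappa^-1).
  by rewrite Y0/= powR_le1 ?(ltW y0) ?invr_ge0 ?ler_pdivrMr ?mul1r// ltW.
exists m; apply: (@le_trans _ _ (64 * c `^ kappa^-1 / (2^-1 `^ kappa) ^+ 4 *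
  (2 ^- m * quartic (x / (c * h m))))); last by rewrite lerDl.
have xE : `|x| `^ kappa^-1 = c `^ kappa^-1 * (`|x| / c) `^ kappa^-1.
  rewrite -powRM ?(ltW c0) ?(ltW y0)// mulrC divfK// gt_eqF//.
have zE : `|x / (c * h m)| = (2 ^+ m * (`|x| / c) `^ kappa^-1) `^ kappa.
  by rewrite -div_scale ?(ltW y0)// normrM normfV (gtr0_norm (mulr_gt0 c0 (h0 m))) invfM mulrA.
have w1 : 2 ^+ m * (`|x| / c) `^ kappa^-1 <= 1 by rewrite -ler_pdivlMl ?exprn_gt0// mulr1.
have w2 : 2^-1 <= 2 ^+ m * (`|x| / c) `^ kappa^-1.
  rewrite -ler_pdivrMl ?exprn_gt0// -invfM -exprSr ltW//.
have z1 : `|x / (c * h m)| <= 1.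
  by rewrite zE powR_le1// ?w1 ?andbT ?mulr_ge0 ?exprn_ge0 ?powR_ge0// ltW.
have b0 : 0 < 2^-1 `^ kappa :> R by rewrite powR_gt0.
have z2 : 2^-1 `^ kappa <= `|x / (c * h m)|.
  by rewrite zE ge0_ler_powR ?nnegrE ?mulr_ge0 ?exprn_ge0 ?powR_ge0// ltW.
have qg : (2^-1 `^ kappa) ^+ 4 / 64 <= quartic (x / (c * h m)).
  apply: le_trans (quartic_ge _ z1); rewrite ler_wpM2r//.
  have -> : (x / (c * h m)) ^+ 4 = `|x / (c * h m)| ^+ 4.
    by rewrite (exprM _ 2 2) [RHS](exprM _ 2 2) real_normK ?num_real.
  by rewrite lerXn2r ?nnegrE// ltW.
rewrite xE -!mulrA mulrCA ler_wpM2l ?powR_ge0//.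
apply: (le_trans m2).
have b4 : 0 < (2^-1 `^ kappa) ^+ 4 :> R by rewrite exprn_gt0.
set q := quartic _ in qg *.
have -> : 64 * ((2^-1 `^ kappa) ^- 4 * (2 ^- m * q)) = 2 ^- m * (64 * q / (2^-1 `^ kappa) ^+ 4)
  by ring.
by rewrite ler_peMr ?(ltW (exp2V_gt0 _))// ler_pdivlMr// mul1r; lra.
Qed.

Hypothesis J_inf : (\int[Pi]_(x in D) (`|x| `^ kappa^-1)%:E = +oo)%E.

(** Were the partial sums bounded, exchanging sum and integral would make the kernel series
    integrable, and with it |x|^(1/kappa), by [power_le_quartic]. *)
Lemma quartic_mass_diverges c L : 0 < c ->
  exists N, L <= \sum_(n < N) 2 ^- n * quartic_mass (c * h n).
Proof.
move=> c0; apply: contrapT => nL.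
have L_ub N : \sum_(n < N) 2 ^- n * quartic_mass (c * h n) <= L.
  by rewrite leNgt; apply/negP => lt; apply: nL; exists N; exact: ltW.
pose f n (x : R) := 2 ^- n * quartic (x / (c * h n)).
have f0 n x : 0 <= f n x by rewrite mulr_ge0 ?quartic_ge0// ltW// exp2V_gt0.
have mq n : measurable_fun D (fun x => quartic (x / (c * h n))).
  apply: measurable_funTS; apply: measurableT_comp; first exact: measurable_quartic.
  exact: measurable_funM.
have mf n : measurable_fun D (fun x => (f n x)%:E).
  by apply/measurable_EFinP; apply: measurable_funM.
have fin : (\int[Pi]_(x in D) \sum_(n <oo) (f n x)%:E <= L%:E)%E.
  rewrite integral_nneseries//; last by move=> n x _; rewrite lee_fin.
  have e n : (\int[Pi]_(x in D) (f n x)%:E = (2 ^- n * quartic_mass (c * h n))%:E)%E.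
    have [iq <-] := quartic_massE (c * h n).
    rewrite -RintegralZl// /Rintegral fineK//; apply: integrable_fin_num => //.
    exact: (integrableZl mD (2 ^- n) iq).
  under eq_eseriesr do rewrite e.
  apply: nneseries_le_fin => // n.
  by rewrite -lee_fin -e; apply: integral_ge0 => x _; rewrite lee_fin.
pose K1 := 64 * c `^ kappa^-1 / (2^-1 `^ kappa) ^+ 4 : R.
have K10 : 0 <= K1 by rewrite divr_ge0 ?mulr_ge0 ?powR_ge0 ?exprn_ge0 ?powR_ge0.
have c20 : 0 <= c ^- 2 by rewrite invr_ge0 exprn_ge0// ltW.
have S0 x : (0 <= \sum_(n <oo) (f n x)%:E)%E by apply: nneseries_ge0 => n _ _; rewrite lee_fin.
have mS : measurable_fun D (fun x => (\sum_(n <oo) (f n x)%:E)%E).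
  by apply: ge0_emeasurable_sum => // n x _ _; rewrite lee_fin.
have mX2 : measurable_fun D (fun x : R => (x ^+ 2)%:E).
  by apply/measurable_EFinP; exact: measurable_funX.
suff : (\int[Pi]_(x in D) (`|x| `^ kappa^-1)%:E < +oo)%E by rewrite J_inf.
apply: (@le_lt_trans _ _ (\int[Pi]_(x in D) (K1%:E * (\sum_(n <oo) (f n x)%:E) +
  (c ^- 2)%:E * (x ^+ 2)%:E))%E).
  apply: ge0_subfun_integral => x /unit_itvP x1; first by rewrite lee_fin powR_ge0.
  have [n hn] := power_le_quartic _ _ c0 x1.
  apply: (@le_trans _ _ (K1 * f n x + c ^- 2 * x ^+ 2)%:E); first by rewrite lee_fin.
  rewrite EFinD !EFinM leeD2r// -EFinM -EFinM lee_wpmul2l//.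
  rewrite (@nneseriesD1 _ (fun n => (f n x)%:E) n)//; last by move=> i _; rewrite lee_fin.
  by rewrite leeDl// nneseries_ge0// => i _ _; rewrite lee_fin.
rewrite ge0_integralD//; last 4 first.
- by move=> x _; rewrite mule_ge0.
- exact: measurable_funeM.
- by move=> x _; rewrite mule_ge0// lee_fin ?sqr_ge0.
- exact: measurable_funeM.
rewrite !ge0_integralZl//; last by move=> x _; rewrite lee_fin sqr_ge0.
apply: lte_add_pinfty; apply: lte_mul_pinfty => //.
- exact: le_lt_trans fin (ltry _).
- have /integrableP[_] := levy_sqr_integrable Pi hPi.
  apply: le_lt_trans; rewrite le_eqVlt; apply/orP; left; apply/eqP.
  by apply: eq_integral => x _ /=; rewrite ger0_norm ?sqr_ge0.
Qed.

End quartic_mass.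

(** * Moments of the marginals at small times *)

Section small_time_moments.
Context d (T : measurableType d) (R : realType) (P : probability T R).
Variables (X : R -> {RV P >-> R}) (gamma : R) (Pi : {measure set R -> \bar R}).
Hypothesis X_triplet : levy_triplet X gamma 0 Pi.
Local Notation psi := (levy_re Pi).

Definition cos_moment s theta : R :=
  1 - expR (- (s * psi theta)) * cos (s * (gamma * theta + levy_im Pi theta)).

Lemma cos_momentE s theta : 0 <= s ->
  (\int[P]_w (1 - cos (theta * X s w))%:E = (cos_moment s theta)%:E)%E.
Proof.
move=> s0; have := @expectation_one_sub_cos _ _ _ _ _ _ _ X_triplet s theta 0 s0.
by under eq_integral do rewrite mulr0 subr0; move=> ->; rewrite mul0r subr0.
Qed.

Definition moment_error theta : R :=
  psi theta ^+ 2 + (gamma * theta + levy_im Pi theta) ^+ 2 / 2.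

(** In (1 - E) + E (1 - cos(s b)), with E = exp(-s psi), the first term differs from s psi by at
    most (s psi)^2 and the second is at most (s b)^2 / 2. An explicit error of order s^2 can be
    summed over finitely many frequencies before s is chosen. *)
Lemma cos_moment_approx s theta : 0 <= s ->
  `|cos_moment s theta - s * psi theta| <= s ^+ 2 * moment_error theta.
Proof.
move=> s0; rewrite /cos_moment /moment_error.
set b := gamma * theta + _; set a := psi theta.
have a0 : 0 <= a by exact: levy_re_ge0.
have sa0 : 0 <= s * a by rewrite mulr_ge0.
set E := expR _.
have E1 : 1 - E <= s * a by have := expR_ge1Dx (- (s * a)); rewrite -/E; lra.
have E0 : 0 < E by exact: expR_gt0.
have El : E <= 1 by rewrite /E -expR0 ler_expR oppr_le0.
have E2 : E * (1 + s * a) <= 1.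
  have := expR_ge1Dx (s * a); have EE : E * expR (s * a) = 1 by rewrite /E -expRD addNr expR0.
  nra.
have c1 := one_sub_cos_le_sqr (s * b); have c2 := one_sub_cos_ge0 (s * b).
have e2 : s ^+ 2 * (a ^+ 2 + b ^+ 2 / 2) = (s * a) ^+ 2 + (s * b) ^+ 2 / 2
  by rewrite !exprMn; ring.
rewrite e2 ler_norml; apply/andP; split.
  have : s * a - (s * a) ^+ 2 <= 1 - E by nra.
  have := sqr_ge0 (s * b); nra.
have := sqr_ge0 (s * a); nra.
Qed.

Lemma quartic_moment_ge s a : 0 <= s ->
  ((s * quartic_mass Pi a - s ^+ 2 * (moment_error a^-1 + moment_error (2 * a^-1)))%:E <=
   \int[P]_w (quartic (X s w / a))%:E)%E.
Proof.
move=> s0.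
have mX : measurable_fun setT (X s) by exact: measurable_funP.
have mq : measurable_fun setT (fun w => (quartic (X s w / a))%:E).
  apply/measurable_EFinP; apply: (measurableT_comp measurable_quartic).
  exact: measurable_funM.
have mc t : measurable_fun setT (fun w => (1 - cos (t * X s w))%:E).
  apply/measurable_EFinP; apply: measurable_funB => //; apply: measurable_cos_comp.
  exact: measurable_funM.
have c0 t w : (0 <= (1 - cos (t * X s w))%:E)%E by rewrite lee_fin one_sub_cos_ge0.
have q0 w : (0 <= (quartic (X s w / a))%:E)%E by rewrite lee_fin quartic_ge0.
have e : (\int[P]_w (quartic (X s w / a))%:E + (8^-1 * cos_moment s (2 * a^-1))%:E =
          (2^-1 * cos_moment s a^-1)%:E)%E.
  rewrite !EFinM -!cos_momentE// -!ge0_integralZl_EFin//.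
  rewrite -ge0_integralD//; last exact: measurable_funeM.
  apply: eq_integral => w _; rewrite -!EFinM -EFinD; congr EFin.
  rewrite /quartic (_ : 2 * (X s w / a) = 2 * a^-1 * X s w); last by ring.
  by rewrite (_ : X s w / a = a^-1 * X s w); [lra|ring].
have [h1 h2] := (cos_moment_approx s a^-1 s0, cos_moment_approx s (2 * a^-1) s0).
move: h1 h2; rewrite !ler_norml => /andP[h1 h1'] /andP[h2 h2'].
have m0 t : 0 <= s ^+ 2 * moment_error t.
  by rewrite mulr_ge0 ?sqr_ge0// addr_ge0 ?divr_ge0 ?sqr_ge0.
have m1 := m0 a^-1; have m2 := m0 (2 * a^-1).
(* The identity [e] itself rules out an infinite value of the integral. *)
move: e; case: (\int[P]_w _)%E => [r| |]// .
  rewrite -EFinD => -[e]; rewrite lee_fin /quartic_mass; lra.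
Qed.

End small_time_moments.

(** On a grid of 2^K cells over [0, 2^-n0], the indices from 2^(K-m-1) to 2^(K-m) - 1 describe the
    m-th dyadic block of times, and there are 2^(K-m-1) of them. *)
Lemma sum_dyadic_blocks {R : realType} (p q : nat -> R) (N K : nat) : (N <= K)%N ->
  (forall i, 0 <= q i) ->
  (forall m i, (m < N)%N -> (2 ^ (K - m.+1) <= i < 2 ^ (K - m))%N -> p m <= q i) ->
  \sum_(m < N) 2 ^+ (K - m.+1) * p m <= \sum_(2 ^ (K - N) <= i < 2 ^ K) q i.
Proof.
elim: N => [|N IH] NK q0 pq; first by rewrite big_ord0 subn0 big_geq.
have l1 : (2 ^ (K - N.+1) <= 2 ^ (K - N))%N by rewrite leq_exp2l// leq_sub2l.
have l2 : (2 ^ (K - N) <= 2 ^ K)%N by rewrite leq_exp2l// leq_subr.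
rewrite big_ord_recr/= (big_cat_nat l1 l2)/= addrC; apply: lerD; last first.
  apply: IH => [||m i mN]; [exact: ltnW|exact: q0|by apply: pq; exact: ltnW].
apply: (@le_trans _ _ (\sum_(2 ^ (K - N.+1) <= i < 2 ^ (K - N)) p N)).
  rewrite sumr_const_nat -[leRHS]mulr_natl.
  have -> : (2 ^ (K - N) - 2 ^ (K - N.+1) = 2 ^ (K - N.+1))%N.
    have -> : (K - N = (K - N.+1).+1)%N by rewrite -subSn.
    by rewrite expnS mul2n -addnn addnK.
  by rewrite natrX.
by apply: ler_sum_nat => i hi; apply: pq.
Qed.

(** Meant for events that constrain the path at every time of an interval: uncountable
    intersections, reached only through measurable supersets of small probability. *)
Lemma negligible_small d (T : measurableType d) (R : realType) (P : {measure set T -> \bar R})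
    (G : set T) :
  (forall e : R, 0 < e -> exists E, [/\ measurable E, G `<=` E & (P E <= e%:E)%E]) ->
  P.-negligible G.
Proof.
move=> h.
have e0 n : 0 < n.+1%:R^-1 :> R by rewrite invr_gt0.
pose E n := sval (cid (h _ (e0 n))).
have hE n : [/\ measurable (E n), G `<=` E n & (P (E n) <= (n.+1%:R^-1)%:E)%E].
  by rewrite /E; case: cid.
have mE : measurable (\bigcap_n E n) by apply: bigcapT_measurable => n; case: (hE n).
exists (\bigcap_n E n); split => //; last by move=> w Gw n _; case: (hE n) => _ GE _; exact: GE.
apply/eqP; rewrite eq_le measure_ge0 andbT; apply/lee_addgt0Pr => e e_gt0; rewrite add0e.
have [n hn] : exists n : nat, n.+1%:R^-1 <= e.
  exists (Num.truncn e^-1); rewrite invf_ple ?posrE// ltW//.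
  have ei : 0 <= e^-1 by rewrite invr_ge0 ltW.
  by case/andP: (truncn_itv ei).
case: (hE n) => mEn _ Pn.
apply: (@le_trans _ _ (P (E n))); last by apply: (le_trans Pn); rewrite lee_fin.
by apply: le_measure; rewrite ?inE//; exact: bigcap_inf.
Qed.

(** * Lower bound on the probability of large increments *)

Section large_increments.
Context d (T : measurableType d) (R : realType) (P : probability T R).
Variables (X : R -> {RV P >-> R}) (gamma : R) (Pi : {measure set R -> \bar R}) (kappa : R).
Hypothesis X_levy : levy_process X.
Hypothesis X_triplet : levy_triplet X gamma 0 Pi.
Hypothesis kappa_gt : 1 / 2 < kappa.
Local Notation D := (`[-1, 1]%classic : set R).
Local Notation h := (scale kappa).
Local Notation psi := (levy_re Pi).
Hypothesis J_inf : (\int[Pi]_(x in D) (`|x| `^ kappa^-1)%:E = +oo)%E.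

Let k0 : 0 < kappa. Proof. by move: kappa_gt; lra. Qed.
Let hPi := triplet_levy _ _ _ _ _ _ _ X_triplet.
Let mD : measurable D. Proof. exact: measurable_itv. Qed.

Definition tail_prob (s r : R) : R := fine (P [set w | (r < `|X s w|)%R]).

Let mtail s r : measurable [set w | r < `|X s w|].
Proof.
rewrite -[X in measurable X]setTI.
have : measurable_fun setT (X s) by exact: measurable_funP.
by move=> /(_ measurableT _ (measurable_gt_norm r)).
Qed.

Lemma tail_probE s r : P [set w | (r < `|X s w|)%R] = (tail_prob s r)%:E.
Proof. by rewrite /tail_prob fineK// fin_num_measure. Qed.

Lemma tail_prob_ge0 s r : 0 <= tail_prob s r.
Proof. by rewrite fine_ge0. Qed.

Lemma tail_prob_le s r r' : r <= r' -> tail_prob s r' <= tail_prob s r.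
Proof.
move=> rr; rewrite -lee_fin -!tail_probE; apply: le_measure; rewrite ?inE//.
by move=> w /=; exact: le_lt_trans.
Qed.

(** Stochastic continuity at time 0, with the threshold 1/2 that [concentration_le] asks for. At [h]
    = 1 every jump falls in the quadratic branch of [tail_weight], whose integral is finite. *)
Lemma tail_prob_small r : 0 < r -> exists2 s0, 0 < s0 &
  forall s, 0 <= s <= s0 -> tail_prob s r <= 1 / 2.
Proof.
move=> r0; pose c := levy_center Pi gamma 1.
pose m := fine (\int[Pi]_(x in D) (x ^+ 2)%:E)%E.
have m0 : 0 <= m by rewrite fine_ge0// integral_ge0// => x _; rewrite lee_fin sqr_ge0.
have mE : (\int[Pi]_(x in D) (tail_weight 1 (`|x| / 1))%:E = m%:E)%E.
  rewrite /m fineK; last by apply: integrable_fin_num => //; exact: levy_sqr_integrable.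
  apply: eq_integral => x /[1!inE] /unit_itvP x1.
  by rewrite divr1 /tail_weight x1 real_normK ?num_real.
have r2 : 0 < r / 2 by rewrite divr_gt0.
have tc0 := tail_const_ge0 (r / 2) 1 r2 ltr01.
set tc := tail_const (r / 2) 1 in tc0 *.
have q0 : 0 <= 16 * tc * m by rewrite !mulr_ge0.
exists (Num.min (r / 2 / (`|c| + 1)) (1 / 2 / (16 * tc * m + 1))).
  by rewrite lt_min !divr_gt0//; have := normr_ge0 c; lra.
move=> s /andP[s0]; rewrite le_min => /andP[].
have c1 : 0 < `|c| + 1 by have := normr_ge0 c; lra.
rewrite ler_pdivlMr// => sc; rewrite ler_pdivlMr; last lra.
move=> sm; rewrite -lee_fin -tail_probE.
have mY : measurable [set w | r / 2 * 1 < `|X s w - s * c|].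
  rewrite -[X in measurable X]setTI.
  have : measurable_fun setT (fun w => X s w - s * c) by exact: measurable_funB.
  by move=> /(_ measurableT _ (measurable_gt_norm (r / 2 * 1))).
apply: (@le_trans _ _ (P [set w | (r / 2 * 1 < `|X s w - s * c|)%R])).
  apply: le_measure; rewrite ?inE// => w /= rX.
  have : `|X s w| <= `|X s w - s * c| + `|s * c|.
    by rewrite -{1}(subrK (s * c) (X s w)) ler_normD.
  rewrite normrM (ger0_norm s0); lra.
have e01 : 0 < (1 : R) <= 1 by rewrite ltr01 lexx.
apply: (le_trans (@levy_tail_bound _ _ _ _ _ _ _ X_triplet s 1 (r / 2) 1 s0 ltr01 r2 e01)).
rewrite mE -EFinM lee_fin -/tc.
rewrite mulrDr mulr1 in sm.
by rewrite (_ : 16 * s * tc * m = s * (16 * tc * m)); [lra|ring].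
Qed.

(** [N] does not depend on [s]: the number of dyadic blocks is settled before the mesh, which may
    then tend to 0. *)
Lemma tail_sum_large (c L : R) : 0 < c -> exists N, exists2 s0, 0 < s0 &
  forall s, 0 < s <= s0 -> s * L <= \sum_(n < N) 2 ^- n * tail_prob s (c * h n).
Proof.
move=> c0.
(* 12 and 4 are the coefficients in [quartic_sum_detects]: 4 psi(1) pays for its cosine term, 12 L
   leaves L after division, and the final 1 pays for the errors, since s^2 M <= s for s <= 1 / (M +
   1). *)
have [N' hN'] := quartic_mass_diverges Pi kappa hPi kappa_gt J_inf c (12 * L + 4 * psi 1 + 1) c0.
have [N hN] := quartic_sum_detects _ kappa_gt c N' c0.
pose me := moment_error _ gamma Pi.
pose err n := me (c * h n)^-1 + me (2 * (c * h n)^-1).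
pose M := \sum_(n < N') 2 ^- n * err n + 4 * me 1.
have me0 t : 0 <= me t by rewrite addr_ge0 ?divr_ge0 ?sqr_ge0.
have M0 : 0 <= M.
  rewrite addr_ge0 ?mulr_ge0// sumr_ge0// => n _.
  by rewrite mulr_ge0 ?(ltW (exp2V_gt0 _))// /err addr_ge0.
exists N, (M + 1)^-1; first by rewrite invr_gt0; lra.
move=> s /andP[s0]; rewrite -[X in _ <= X]mul1r ler_pdivlMr ?[1 * _]mul1r; last lra.
move=> sM.
have mq a : measurable_fun setT (fun w => quartic (X s w / a)).
  apply: (measurableT_comp measurable_quartic); exact: measurable_funM.
have p0 n : 0 <= 2 ^- n :> R by rewrite ltW// exp2V_gt0.
have mi r : measurable_fun setT (fun w => ((r < `|X s w|)%R%:R : R)).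
  apply: (measurableT_comp (measurable_gt_normR setT r)); exact: measurable_funP.
have mc : measurable_fun setT (fun w => 1 - cos (X s w)).
  by apply: measurable_funB => //; apply: measurable_cos_comp; exact: measurable_funP.
have lhs : ((\sum_(n < N') 2 ^- n * (s * quartic_mass Pi (c * h n) - s ^+ 2 * err n))%:E <=
    \int[P]_w (\sum_(n < N') 2 ^- n * quartic (X s w / (c * h n)))%:E)%E.
  under eq_integral do rewrite -sumEFin.
  rewrite ge0_integral_sum//; last 2 first.
  - by move=> n; apply/measurable_EFinP; exact: measurable_funM.
  - by move=> n w _; rewrite lee_fin mulr_ge0 ?quartic_ge0.
  rewrite -sumEFin; apply: lee_sum => n _.
  under eq_integral do rewrite EFinM.
  rewrite ge0_integralZl_EFin//; last 2 first.
  - by move=> w _; rewrite lee_fin quartic_ge0.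
  - exact/measurable_EFinP.
  by rewrite EFinM lee_wpmul2l//; apply: quartic_moment_ge => //; exact: ltW.
have rhs : (\int[P]_w (12 * (\sum_(n < N) 2 ^- n * (c * h n < `|X s w|)%R%:R) +
    4 * (1 - cos (X s w)))%:E =
    (12 * (\sum_(n < N) 2 ^- n * tail_prob s (c * h n)) + 4 * cos_moment _ gamma Pi s 1)%:E)%E.
  have ms : measurable_fun setT (fun w =>
    (\sum_(n < N) 2 ^- n * (c * h n < `|X s w|)%R%:R : R)%:E).
    by apply/measurable_EFinP; apply: measurable_sum => n; apply: measurable_funM.
  under eq_integral do rewrite EFinD !EFinM.
  rewrite ge0_integralD//; last 3 first.
  - by move=> w _; rewrite mule_ge0// lee_fin sumr_ge0// => n _; rewrite mulr_ge0.
  - exact: measurable_funeM.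
  - by apply: measurable_funeM; exact/measurable_EFinP.
  rewrite !ge0_integralZl_EFin//; last 2 first.
  - exact/measurable_EFinP.
  - by move=> w _; rewrite lee_fin sumr_ge0// => n _; rewrite mulr_ge0.
  have -> : (\int[P]_w (1 - cos (X s w))%:E = (cos_moment _ gamma Pi s 1)%:E)%E.
    rewrite -(@cos_momentE _ _ _ _ _ _ _ X_triplet s 1 (ltW s0)).
    by apply: eq_integral => w _; rewrite mul1r.
  transitivity (12%:E * (\sum_(n < N) 2 ^- n * tail_prob s (c * h n))%:E +
      4%:E * (cos_moment _ gamma Pi s 1)%:E)%E; last by rewrite -!EFinM -EFinD.
  congr (_ * _ + _)%E.
  under eq_integral do rewrite -sumEFin.
  rewrite ge0_integral_sum//; last by move=> n; apply/measurable_EFinP; exact: measurable_funM.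
  rewrite -sumEFin; apply: eq_bigr => n _.
  under eq_integral do rewrite EFinM.
  rewrite ge0_integralZl_EFin//; last exact/measurable_EFinP.
  rewrite EFinM; congr (_ * _)%E; rewrite -tail_probE.
  rewrite -[X in P X]setIT -integral_indic//; apply: eq_integral => w _.
  by rewrite indicE; congr ((nat_of_bool _)%:R)%:E; apply/idP/idP; rewrite inE.
have : (\int[P]_w (\sum_(n < N') 2 ^- n * quartic (X s w / (c * h n)))%:E <=
   \int[P]_w (12 * (\sum_(n < N) 2 ^- n * (c * h n < `|X s w|)%R%:R) +
     4 * (1 - cos (X s w)))%:E)%E.
  apply: ge0_subfun_integral => w _; last by rewrite lee_fin.
  by rewrite lee_fin sumr_ge0// => n _; rewrite mulr_ge0 ?quartic_ge0.
rewrite rhs => /(le_trans lhs); rewrite lee_fin.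
have /ler_normlP[_ h1] := cos_moment_approx _ gamma Pi s 1 (ltW s0).
have -> : \sum_(n < N') 2 ^- n * (s * quartic_mass Pi (c * h n) - s ^+ 2 * err n) =
    s * (\sum_(n < N') 2 ^- n * quartic_mass Pi (c * h n)) -
    s ^+ 2 * (\sum_(n < N') 2 ^- n * err n).
  rewrite !mulr_sumr -sumrB; apply: eq_bigr => n _; ring.
set Q := \sum_(n < N') 2 ^- n * quartic_mass _ _ in hN' *.
set S := \sum_(n < N) _.
move: sM h1; rewrite /M -/me; set Er := \sum_(n < N') _ => sM h1 H.
have s2 : s ^+ 2 * (Er + 4 * me 1) <= s.
  rewrite expr2 -mulrA ler_piMr ?(ltW s0)//; move: sM; lra.
have : s * (12 * L + 4 * psi 1 + 1) <= s * Q by rewrite ler_wpM2l// ltW.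
lra.
Qed.

End large_increments.

(** * Independent increments along a fine grid *)

Section divergence.
Context d (T : measurableType d) (R : realType) (P : probability T R).
Variables (X : R -> {RV P >-> R}) (gamma : R) (Pi : {measure set R -> \bar R}) (kappa : R).
Hypothesis X_levy : levy_process X.
Hypothesis X_triplet : levy_triplet X gamma 0 Pi.
Hypothesis kappa_gt : 1 / 2 < kappa.
Local Notation D := (`[-1, 1]%classic : set R).
Local Notation h := (scale kappa).
Local Notation prob := (tail_prob _ _ _ P X).
Hypothesis J_inf : (\int[Pi]_(x in D) (`|x| `^ kappa^-1)%:E = +oo)%E.

Let k0 : 0 < kappa. Proof. by move: kappa_gt; lra. Qed.

(* If |c| <= 2 r then |X s - c| <= r forces |X s| <= 3 r; otherwise it forces
   |X s| > r. *)
Lemma concentration_le (s c r : R) : 0 <= r -> prob s r <= 1 / 2 ->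
  (P (X s @^-1` [set x | (`|x - c| <= r)%R]) <= (expR (- prob s (3 * r)))%:E)%E.
Proof.
move=> r0 pr.
have mX : measurable_fun setT (X s) by exact: measurable_funP.
have mG a : measurable [set w | a < `|X s w|].
  by have := mX measurableT _ (measurable_gt_norm a); rewrite setTI.
have mS : measurable (X s @^-1` [set x | `|x - c| <= r]).
  rewrite (_ : _ @^-1` _ = ~` [set w | r < `|X s w - c|]); last first.
    by apply/seteqP; split => w /=; rewrite leNgt => /negP.
  apply: measurableC; rewrite -[X in measurable X]setTI.
  have : measurable_fun setT (fun w => X s w - c) by exact: measurable_funB.
  by move=> /(_ measurableT _ (measurable_gt_norm r)).
have h3 : prob s (3 * r) <= 1 / 2 by apply: le_trans (tail_prob_le _ _ _ _ _ _ _ _ _) pr; lra.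
have ex : 1 - prob s (3 * r) <= expR (- prob s (3 * r))
  by have := expR_ge1Dx (- prob s (3 * r)); lra.
have [c2|c2] := leP `|c| (2 * r).
  apply: (@le_trans _ _ (P (~` [set w | 3 * r < `|X s w|]))).
    apply: le_measure; rewrite ?inE//; first exact: measurableC.
    move=> w /= Xc; apply/negP; rewrite -leNgt.
    have : `|X s w| <= `|X s w - c| + `|c| by rewrite -{1}(subrK c (X s w)) ler_normD.
    lra.
  by rewrite probability_setC// tail_probE -EFinB lee_fin.
apply: (@le_trans _ _ (P [set w | r < `|X s w|])).
  apply: le_measure; rewrite ?inE// => w /= Xc.
  have : `|c| <= `|X s w| + `|X s w - c|.
    by rewrite -{1}(subKr (X s w) c) (le_trans (ler_normB _ _)).
  lra.
by rewrite tail_probE lee_fin; lra.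
Qed.

Variable a : R -> R.

Lemma grid_event_small (C e : R) (n0 : nat) : 0 < C -> 0 < e ->
  exists E : set T, [/\ measurable E,
    [set w | forall t, 0 < t <= 2 ^- n0 -> `|X t w - a t| <= C * t `^ kappa] `<=` E &
    (P E <= e%:E)%E].
Proof.
move=> C0 e0.
pose b := (2 ^- n0 : R) `^ kappa.
have b0 : 0 < b by rewrite powR_gt0// exp2V_gt0.
have bh m : (2 ^- (n0 + m)) `^ kappa = b * h m.
  by rewrite /b /scale -powRM ?ltW ?exp2V_gt0// exprD invfM.
(* Increments are confined to radius 2 C t^kappa, [concentration_le] triples the radius, and [b]
   turns h_m into the power of 2^-(n0+m). *)
pose c := 6 * C * b.
have c0 : 0 < c by rewrite !mulr_gt0.
(* Chosen so that 2^K / 2 times s L is exactly 1 / e for the mesh s = 2^-(n0+K). *)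
pose L : R := 2 ^+ n0.+1 * e^-1.
have [N [s1 s10 hN]] := tail_sum_large _ _ _ _ _ _ _ _ X_triplet kappa_gt J_inf c L c0.
(* A lower bound for the radii of the constrained increments: making this radius exceeded with
   probability at most 1/2 settles them all. *)
have rN0 : 0 < 2 * C * (b * h N) by rewrite !mulr_gt0// scale_gt0.
have [s2 s20 hs2] := tail_prob_small _ _ _ _ _ _ _ X_triplet _ rN0.
have [K [NK sK]] : exists K, (N <= K)%N /\ 2 ^- (n0 + K) <= Num.min s1 s2.
  have m0 : 0 < Num.min s1 s2 by rewrite lt_min s10.
  have cv : (2^-1 : R) ^+ n @[n --> \oo] --> 0 by apply: cvg_expr; rewrite ger0_norm; lra.
  have [k1 _ hk1] : \forall n \near \oo, (2^-1 : R) ^+ n < Num.min s1 s2 by exact: (cvgr_lt _ cv).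
  exists (maxn N k1); split; first exact: leq_maxl.
  by rewrite expr2V ltW//; apply: hk1 => /=; rewrite (leq_trans (leq_maxr N k1))// leq_addl.
move: sK; rewrite le_min => /andP[sK1 sK2].
set s := 2 ^- (n0 + K) in sK1 sK2.
have s0 : 0 < s by exact: exp2V_gt0.
pose t (i : nat) := i%:R * s.
pose r i := 2 * C * (t i.+1) `^ kappa.
pose cc i := a (t i.+1) - a (t i).
(* Earlier increments are left free: they lie below the last of the N dyadic blocks, and time 0,
   where [a] is not controlled, is among their end points. *)
pose I0 := (2 ^ (K - N))%N.
pose B i := if (I0 <= i)%N then [set x : R | `|x - cc i| <= r i] else setT.
have mB i : measurable (B i).
  rewrite /B; case: ifP => // _.
  have -> : [set x : R | `|x - cc i| <= r i] = ~` [set x | r i < `|x - cc i|].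
    by apply/seteqP; split => w /=; rewrite leNgt => /negP.
  apply: measurableC; rewrite -[X in measurable X]setTI.
  have : measurable_fun setT (fun x : R => x - cc i) by exact: measurable_funB.
  by move=> /(_ measurableT _ (measurable_gt_norm (r i))).
pose inc i w := X (t i.+1) w - X (t i) w.
have t0 i : 0 <= t i by rewrite mulr_ge0// ltW.
have tS i : t i <= t i.+1 by rewrite ler_wpM2r ?ler_nat// ltW.
have tpow i m : (i.+1 <= 2 ^ (K - m))%N -> (m <= K)%N -> t i.+1 <= 2 ^- (n0 + m).
  move=> im mK; rewrite /t /s -(subnKC mK) addnA exprD invfM mulrA mulrAC.
  rewrite ler_piMl ?(ltW (exp2V_gt0 _))// ler_pdivrMr ?exprn_gt0// mul1r.
  by rewrite -natrX ler_nat.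
exists (\bigcap_(i in [set: 'I_(2 ^ K)]) (inc i @^-1` B i)); split.
- rewrite -(bigcap_ordE _ _ (2 ^ K) (fun i => inc i @^-1` B i)).
  apply: bigcap_measurableType => // i _; rewrite -[X in measurable X]setTI.
  by have : measurable_fun setT (inc i) by [exact: measurable_funB]; apply.
- move=> w hw i _; rewrite /B /=; case: ifP => // Ii; rewrite /= /inc /cc.
  have i0 : (0 < i)%N by rewrite (leq_trans _ Ii)// expn_gt0.
  have ti0 : 0 < t i by rewrite mulr_gt0// ltr0n.
  have ti1 : t i.+1 <= 2 ^- n0.
    by have := tpow i 0%N; rewrite subn0 addn0; apply => //; exact: ltn_ord.
  have h1 : `|X (t i.+1) w - a (t i.+1)| <= C * (t i.+1) `^ kappa.
    by apply: hw; rewrite ti1 (lt_le_trans ti0).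
  have h2 : `|X (t i) w - a (t i)| <= C * (t i) `^ kappa.
    by apply: hw; rewrite ti0 (le_trans _ ti1).
  have h3 : (t i) `^ kappa <= (t i.+1) `^ kappa by rewrite ge0_ler_powR ?nnegrE// ltW.
  have -> : X (t i.+1) w - X (t i) w - (a (t i.+1) - a (t i)) =
    (X (t i.+1) w - a (t i.+1)) - (X (t i) w - a (t i)) by ring.
  have := ler_normB (X (t i.+1) w - a (t i.+1)) (X (t i) w - a (t i)).
  have := ler_wpM2l (ltW C0) h3; rewrite /r; lra.
pose q i := if (I0 <= i)%N then prob s (3 * r i) else 0.
have q0 i : 0 <= q i by rewrite /q; case: ifP => // _; exact: tail_prob_ge0.
have r0 i : 0 <= r i by rewrite mulr_ge0 ?powR_ge0// mulr_ge0// ltW.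
have ind := @levy_indep _ _ _ _ _ X_levy (2 ^ K) t (t0 0%N) (fun i _ => tS i)
  (fun i => B i) (fun i => mB i).
rewrite ind.
have one (i : 'I_(2 ^ K)) :
  (P ((fun w => X (t i.+1) w - X (t i) w)%R @^-1` B i) <= (expR (- q i))%:E)%E.
  rewrite (levy_stationary X_levy)//.
  have -> : t i.+1 - t i = s by rewrite /t -mulrBl -natrB// subSnn mul1r.
  rewrite /B /q; case: ifPn => Ii.
    apply: concentration_le => //.
    apply: le_trans (hs2 s _); last by rewrite ltW.
    apply: tail_prob_le; rewrite /r ler_wpM2l ?mulr_ge0 ?(ltW C0)//.
    rewrite -bh ge0_ler_powR ?nnegrE ?t0// ?ltW ?exp2V_gt0//.
    have -> : 2 ^- (n0 + N) = 2 ^+ (K - N) * s.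
      rewrite /s (_ : (n0 + K = (n0 + N) + (K - N))%N); last by rewrite -addnA subnKC.
      by rewrite [in RHS]exprD invfM mulrCA divff ?mulr1// expf_neq0.
    by rewrite ltr_pM2r// -natrX ltr_nat ltnS.
  by rewrite preimage_setT oppr0 expR0 probability_le1.
apply: (@le_trans _ _ (\prod_(i < 2 ^ K) (expR (- q i))%:E)%E).
  suff : (0 <= \prod_(i < 2 ^ K) P ((fun w => X (t i.+1) w - X (t i) w)%R @^-1` B i) <=
          \prod_(i < 2 ^ K) (expR (- q i))%:E)%E by case/andP.
  apply: (big_ind2 (fun x y => (0 <= x <= y)%E)) => [|x1 y1 x2 y2 /andP[a0 a1] /andP[b1 b2]|i _].
  - by rewrite lexx lee01.
  - by rewrite mule_ge0// lee_pmul.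
  - by rewrite measure_ge0 one.
have -> : (\prod_(i < 2 ^ K) (expR (- q i))%:E = (expR (- \sum_(i < 2 ^ K) q i))%:E)%E.
  elim/big_rec2: _ => [|i x y _ ->]; first by rewrite oppr0 expR0.
  by rewrite opprD expRD EFinM.
rewrite lee_fin.
have qs : e^-1 <= \sum_(i < 2 ^ K) q i.
  have qsum : \sum_(2 ^ (K - N) <= i < 2 ^ K) q i <= \sum_(i < 2 ^ K) q i.
    rewrite -(big_mkord xpredT q).
    have l : (2 ^ (K - N) <= 2 ^ K)%N by rewrite leq_exp2l// leq_subr.
    by rewrite [leRHS](big_cat_nat (leq0n _) l)/= lerDr sumr_ge0.
  apply: le_trans qsum.
  apply: (le_trans _ (@sum_dyadic_blocks _ (fun m => prob s (c * h m)) q N K NK q0 _));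
    last first.
    move=> m i mN /andP[im1 im2].
    have Ii : (I0 <= i)%N by rewrite (leq_trans _ im1)// leq_exp2l// leq_sub2l.
    rewrite /q Ii; apply: tail_prob_le.
    have mK : (m <= K)%N by rewrite (leq_trans _ NK)// ltnW.
    have : (t i.+1) `^ kappa <= b * h m.
      by rewrite -bh ge0_ler_powR ?nnegrE ?t0 ?(ltW (exp2V_gt0 _)) ?(ltW k0)//; exact: tpow.
    move=> /(ler_wpM2l (ltW C0)); rewrite /r /c; lra.
  have -> : \sum_(m < N) 2 ^+ (K - m.+1) * prob s (c * h m) =
      2 ^+ K / 2 * \sum_(m < N) 2 ^- m * prob s (c * h m).
    rewrite mulr_sumr; apply: eq_bigr => m _; rewrite mulrA; congr (_ * _).
    have mK : (m.+1 <= K)%N by rewrite (leq_trans _ NK).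
    rewrite -{2}(subnK mK) exprD exprS; field; rewrite expf_neq0//.
  have := hN s; rewrite s0 sK1 => /(_ isT).
  have KL : 2 ^+ K / 2 * (s * L) = e^-1.
    rewrite /s /L exprD exprS; field.
    by rewrite gt_eqF// !expf_neq0.
  by rewrite -KL => h; rewrite ler_wpM2l// divr_ge0// exprn_ge0.
set S := \sum_(i < 2 ^ K) q i in qs *.
have ei : 0 < e^-1 by rewrite invr_gt0.
(* exp(S) >= 1 + S >= 1 / e, hence exp(-S) <= e. *)
rewrite expRN -[leRHS]invrK lef_pV2 ?posrE ?expR_gt0//.
apply: (le_trans qs); have := expR_ge1Dx S; lra.
Qed.

(** A finite upper limit gives a bound on some right neighbourhood of 0. Rounding the bound up to an
    integer and shrinking the neighbourhood to a dyadic one covers the exceptional set by countably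
    many events, each negligible by [grid_event_small]. *)
Lemma limsup_infinite :
  {ae P, forall w,
      limf_esup (fun t : R => (`|X t w - a t| / t `^ kappa)%:E) (0 : R)^'+
        = +oo%E}.
Proof.
pose G (C n0 : nat) := [set w | forall t, 0 < t <= 2 ^- n0 ->
  `|X t w - a t| <= C.+1%:R * t `^ kappa].
have nG : P.-negligible (\bigcup_C \bigcup_n0 G C n0).
  apply: negligible_bigcup => C; apply: negligible_bigcup => n0.
  apply: negligible_small => e e0; exact: grid_event_small.
apply: negligibleS nG => w /= /eqP; rewrite -ltey => lim.
have [V V0 supV] : exists2 V : set R, (0 : R)^'+ V &
    (ereal_sup ((fun t : R => (`|X t w - a t| / t `^ kappa)%:E) @` V) < +oo)%E.
  apply: contrapT => H; move: lim; rewrite ltNge => /negP; apply.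
  rewrite limf_esupE; apply: le_ereal_inf_tmp => _ [V FV <-].
  rewrite leNgt; apply/negP => lt; apply: H; by exists V.
have [r rV] : exists r : R, forall t, V t -> `|X t w - a t| / t `^ kappa <= r.
  move: supV; set S := ereal_sup _ => S1.
  exists (fine S) => t Vt.
  have hS : ((`|X t w - a t| / t `^ kappa)%:E <= S)%E by apply: ereal_sup_ubound; exists t.
  have Sf : S \is a fin_num by rewrite fin_real// (lt_le_trans _ hS) ?ltNyr.
  by rewrite -lee_fin fineK.
move: V0 => /nbhs_ballP[del /= d0 hd].
have cv : (2^-1 : R) ^+ n @[n --> \oo] --> 0 by apply: cvg_expr; rewrite ger0_norm; lra.
have [n0 _ hn0] : \forall n \near \oo, (2^-1 : R) ^+ n < del by exact: (cvgr_lt _ cv).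
exists (Num.truncn `|r|) => //; exists n0 => // t /andP[t0 tn].
have tk : 0 < t `^ kappa by rewrite powR_gt0.
rewrite -ler_pdivrMr//.
have Vt : V t.
  apply: hd => //=; rewrite /ball/= sub0r normrN ger0_norm ?(ltW t0)//.
  by apply: (le_lt_trans tn); rewrite expr2V; apply: hn0 => /=.
apply: (le_trans (rV t Vt)); apply: (le_trans (ler_norm r)); apply: ltW.
by case/andP: (truncn_itv (normr_ge0 r)).
Qed.

End divergence.

Theorem theorem2p1 (d : measure_display) (T : measurableType d) (R : realType)
    (P : probability T R) (X : R -> {RV P >-> R})
    (gamma sigma2 : R) (Pi : {measure set R -> \bar R}) (kappa : R)
    (X_levy : levy_process X)
    (X_triplet : levy_triplet X gamma sigma2 Pi)
    (no_gaussian : sigma2 = 0)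
    (kappa_gt : 1 / 2 < kappa)
    (bv_drift0 : in_bv X -> drift gamma Pi = 0) :
  ((\int[lebesgue_measure]_(x in `]0%R, 1%R[) levy_tail Pi (x `^ kappa) < +oo)%E ->
    {ae P, forall w, X t w / t `^ kappa @[t --> 0^'+] --> (0 : R)}) /\
  ((\int[lebesgue_measure]_(x in `]0%R, 1%R[) levy_tail Pi (x `^ kappa) = +oo)%E ->
    forall a : R -> R,
    {ae P, forall w,
      limf_esup (fun t : R => (`|X t w - a t| / t `^ kappa)%:E) (0 : R)^'+
        = +oo%E}).
Proof.
subst sigma2.
have hPi := triplet_levy _ _ _ _ _ _ _ X_triplet.
split=> [I_fin|I_inf a].
  have J_fin : (\int[Pi]_(x in `[(-1)%R, 1%R]) (`|x| `^ kappa^-1)%:E < +oo)%E.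
    apply: le_lt_trans (levy_tail_integral_ge _ _ hPi kappa_gt) _.
    by rewrite lte_mul_pinfty.
  apply: (small_time_convergence _ _ _ _ _ _ _ _ X_levy X_triplet kappa_gt J_fin).
  have [k1|k1] := leP 1 kappa; last exact: center_small_lt1.
  apply: center_small_ge1 => //; apply: bv_drift0.
  apply: (levy_in_bv _ _ _ _ _ _ _ X_levy X_triplet).
  exact: levy_abs_integral_fin J_fin k1.
apply: (limsup_infinite _ _ _ _ _ _ _ _ X_levy X_triplet kappa_gt).
apply/eqP; rewrite -leye_eq leNgt; apply/negP => J_fin.
have := levy_tail_integral_le _ _ hPi kappa_gt.
by rewrite I_inf leye_eq => /eqP E;
  move: (lte_mul_pinfty (ler0n _ 6 : (0 <= 6%:E)%E) isT J_fin); rewrite E.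
Qed.
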